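(* Let $\alpha\in(0,1]$ and $\beta\in[0,1)$, and let $f(z)=z+\sum_{k=2}^\infty a_k z^k\in\mathcal{G}(\alpha)$. Then for all $n\ge 2$ the section $s_n(z;f)$ is starlike of order $\beta$ in the disk $|z|<\rho_{\mathcal{S}^*}$, where $\rho_{\mathcal{S}^*}$ is the least positive root in $[0,1)$ of the equation $J_{\alpha,\beta}(\rho)=0$, with $$J_{\alpha,\beta}(\rho)=\bigl(1-(1-\rho)^{1+\alpha}\bigr)\bigl((1+\alpha)(1-\beta-\rho)+\beta\rho\bigr)+\alpha(1+\alpha)(1+\alpha-\rho)\left(\bigl((3-\beta)\rho-(2-\beta)\bigr)\ln(1-\rho)-(2-\beta)\rho+\left(2-\frac{\beta}{2}\right)\rho^2\right).$$
   Context: Let $\mathbb{D}=\{z\in\mathbb{C}:|z|<1\}$ and let $\mathcal{A}$ be the family of analytic functions $f$ in $\mathbb{D}$ with $f(0)=0$ and $f'(0)=1$, i.e. $f(z)=z+\sum_{k=2}^\infty a_kz^k$. For $\alpha>0$, $\mathcal{G}(\alpha)$ is the class of locally univalent $f\in\mathcal{A}$ (so $f'(z)\ne0$ in $\mathbb{D}$) satisfying $\Re\left(1+\frac{zf''(z)}{f'(z)}\right)<1+\frac{\alpha}{2}$ for all $z\in\mathbb{D}$. The $n$-th section (partial sum) of $f$ is the polynomial $s_n(z;f)=z+\sum_{k=2}^n a_kz^k$. For $0\le\beta<1$, a function $g$ (normalized by $g(0)=0$, $g'(0)=1$) is starlike of order $\beta$ in the disk $|z|<r$ if $g(z)\ne0$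 for $0<|z|<r$ and $\Re\left(\frac{zg'(z)}{g(z)}\right)>\beta$ for all $|z|<r$ (the quotient being given its limiting value $1$ at $z=0$). *)

(* Defs.v *)
From Stdlib Require Import Reals.
From Coquelicot Require Import Coquelicot.

Open Scope C_scope.

(* [f] is locally the sum of a power series at every point of [|z| < r]. *)
Definition analytic_in (r : R) (f : C -> C) : Prop :=
  forall z0 : C, (Cmod z0 < r)%R ->
  exists (c : nat -> C) (eps : R), (0 < eps)%R /\
    forall z : C, (Cmod (z - z0) < eps)%R ->
      is_pseries (K := C_AbsRing) (V := C_NormedModule) c (z - z0) (f z).

(* [C_derive] is total and computed along the real direction only; it is the
   complex derivative wherever the function is complex differentiable, so it is
   only used for functions assumed analytic. *)
Definition normalized (f : C -> C) : Prop :=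
  f 0 = 0 /\ C_derive f 0 = 1.

Definition class_A (f : C -> C) : Prop :=
  analytic_in 1 f /\ normalized f.

Definition locally_univalent (f : C -> C) : Prop :=
  forall z0 : C, (Cmod z0 < 1)%R ->
  exists eps : R, (0 < eps)%R /\
    forall z w : C, (Cmod (z - z0) < eps)%R -> (Cmod (w - z0) < eps)%R ->
      f z = f w -> z = w.

(* For analytic [f], local univalence is equivalent to [f' <> 0]; both are
   recorded. *)
Definition class_G (alpha : R) (f : C -> C) : Prop :=
  class_A f /\
  locally_univalent f /\
  (forall z : C, (Cmod z < 1)%R -> C_derive f z <> 0) /\
  (forall z : C, (Cmod z < 1)%R ->
     (Re (1 + z * C_derive (C_derive f) z / C_derive f z) < 1 + alpha / 2)%R).

Definition has_expansion (f : C -> C) (a : nat -> C) : Prop :=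
  a 0%nat = 0 /\ a 1%nat = 1 /\
  forall z : C, (Cmod z < 1)%R ->
    is_pseries (K := C_AbsRing) (V := C_NormedModule) a z (f z).

Definition section (a : nat -> C) (n : nat) (z : C) : C :=
  z + sum_n_m (fun k : nat => a k * z ^ k) 2 n.

(* The value at [0] is the limiting one for normalized [g]. *)
Definition starlike_quotient (g : C -> C) (z : C) : C :=
  if Ceq_dec z 0 then 1 else z * C_derive g z / g z.

(* Analyticity of [g] in the disk makes [C_derive g] its complex derivative. *)
Definition starlike (beta r : R) (g : C -> C) : Prop :=
  analytic_in r g /\ normalized g /\
  (forall z : C, (0 < Cmod z < r)%R -> g z <> 0) /\
  (forall z : C, (Cmod z < r)%R -> (beta < Re (starlike_quotient g z))%R).

Open Scope R_scope.

Definition J (alpha beta rho : R) : R :=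
  (1 - Rpower (1 - rho) (1 + alpha)) *
    ((1 + alpha) * (1 - beta - rho) + beta * rho) +
  alpha * (1 + alpha) * (1 + alpha - rho) *
    (((3 - beta) * rho - (2 - beta)) * ln (1 - rho)
     - (2 - beta) * rho + (2 - beta / 2) * rho ^ 2).

Definition least_positive_root (F : R -> R) (rho : R) : Prop :=
  0 < rho < 1 /\ F rho = 0 /\ forall x : R, 0 < x < rho -> F x <> 0.

(* Main.v *)
Require Import Defs.
From Stdlib Require Import Reals Lra Lia.
From Coquelicot Require Import Coquelicot.

(** Write [s_n = f - sigma] and [w = z f' / f].  Then
    [z s_n' / s_n = w + (w sigma - z sigma') / s_n], and [J > 0] at [r = |z|] is,
    up to a positive factor, the inequality
    [L (M - beta) > |z sigma'| + (2 - beta) |sigma|] in which [f] and [w] are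
    replaced by their extremal values [L <= |f|] and [M <= Re w], and the
    coefficients of [sigma] by [alpha / (k (k - 1))] for all [k >= 3].  With an
    upper bound [|w| <= N] such that [M + N <= 2], this gives
    [Re (z s_n' / s_n) > beta] ([log_derivative_perturbation]).  As [J] is positive
    before its least root ([J_least_root]), it remains to prove these bounds
    for [f] and its coefficients.

    The tools are the mean value property and Cauchy's formula on circles around
    [0] ([mean_value], [cauchy_formula]): the derivative of a circular mean in the
    parameter that shrinks the circle is the mean of the derivative of a periodic
    function.

    Coefficients: [|z f''| < |z f'' - alpha f'|], as [z f'' / f'] has real part
    below [alpha / 2].  Clunie's method, that is, Bessel's inequality for the
    quotient, turns this into [k (k - 1) |a_k| <= alpha] ([coefficient_bound]).

    Growth and [w]: by the Schwarz formula, [log f' (z)] is [alpha] times an average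
    of [log (1 - zeta)] over [|zeta| = |z| / rho], for each [rho < 1]
    ([exp_representation]).  The set of [u + i v] with [|v| < pi / 2] and
    [e^u cos v >= c] is convex because [- ln o cos] is; hence lower bounds for the
    real parts of [(1 - zeta) / (1 - t zeta)] and of its inverse become bounds for
    [f' (z) / f' (t z)] and its inverse, with exponent [alpha] ([exp_cos_mean],
    [distortion]).  Integration in [t] bounds [Re (f / z)] from below, which gives
    [L] ([growth]), and confines [f / (z f')], the average of [f' (t z) / f' (z)],
    to a half-plane and to a disk with diameter on the real axis, which gives [N]
    and [M] ([log_derivative_bounds]). *)

Open Scope R_scope.

(** * Continuity and complex differentiability *)

Lemma C_ext (z w : C) : Re z = Re w -> Im z = Im w -> z = w.
Proof. destruct z, w; simpl; congruence. Qed.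

Lemma continuous_C {U : UniformSpace} (f : U -> C) (x : U) :
  continuous (fun u => Re (f u)) x -> continuous (fun u => Im (f u)) x ->
  continuous (U := C_UniformSpace) f x.
Proof.
  intros H1 H2. apply filterlim_locally. intros eps.
  generalize (proj1 (filterlim_locally _ _) H1 eps) (proj1 (filterlim_locally _ _) H2 eps).
  intros K1 K2. generalize (filter_and _ _ K1 K2). apply filter_imp.
  intros u [A B]; split; assumption.
Qed.

Lemma continuous_Re {U : UniformSpace} (f : U -> C) (x : U) :
  continuous (U := C_UniformSpace) f x -> continuous (fun u => Re (f u)) x.
Proof.
  intros H. apply filterlim_locally. intros eps.
  generalize (proj1 (filterlim_locally _ _) H eps). apply filter_imp.
  intros u [A B]; exact A.
Qed.

Lemma continuous_Im {U : UniformSpace} (f : U -> C) (x : U) :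
  continuous (U := C_UniformSpace) f x -> continuous (fun u => Im (f u)) x.
Proof.
  intros H. apply filterlim_locally. intros eps.
  generalize (proj1 (filterlim_locally _ _) H eps). apply filter_imp.
  intros u [A B]; exact B.
Qed.

Lemma continuous_Rplus {U : UniformSpace} (f g : U -> R) x :
  continuous f x -> continuous g x -> continuous (fun u => f u + g u) x.
Proof. exact (continuous_plus f g x). Qed.

Lemma continuous_Rmult {U : UniformSpace} (f g : U -> R) x :
  continuous f x -> continuous g x -> continuous (fun u => f u * g u) x.
Proof. exact (continuous_mult f g x). Qed.

Lemma continuous_Ropp {U : UniformSpace} (f : U -> R) x :
  continuous f x -> continuous (fun u => - f u) x.
Proof. exact (continuous_opp f x). Qed.

Lemma continuous_Rinv_comp {U : UniformSpace} (f : U -> R) x :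
  continuous f x -> f x <> 0 -> continuous (fun u => / f u) x.
Proof.
  intros H H0. apply (continuous_comp f Rinv). exact H.
  apply continuity_pt_filterlim. apply continuity_pt_inv.
  apply continuity_pt_id. exact H0.
Qed.

Lemma continuous_Cplus {U : UniformSpace} (f g : U -> C) x :
  continuous (U := C_UniformSpace) f x -> continuous (U := C_UniformSpace) g x ->
  continuous (U := C_UniformSpace) (fun u => f u + g u)%C x.
Proof.
  intros Hf Hg. apply continuous_C; simpl; apply continuous_Rplus;
  (apply continuous_Re || apply continuous_Im); assumption.
Qed.

Lemma continuous_Copp {U : UniformSpace} (f : U -> C) x :
  continuous (U := C_UniformSpace) f x ->
  continuous (U := C_UniformSpace) (fun u => - f u)%C x.
Proof.
  intros Hf. apply continuous_C; simpl; apply continuous_Ropp;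
  (apply continuous_Re || apply continuous_Im); assumption.
Qed.

Lemma continuous_Cminus {U : UniformSpace} (f g : U -> C) x :
  continuous (U := C_UniformSpace) f x -> continuous (U := C_UniformSpace) g x ->
  continuous (U := C_UniformSpace) (fun u => f u - g u)%C x.
Proof. intros; apply continuous_Cplus; [|apply continuous_Copp]; assumption. Qed.

Lemma continuous_Cmult {U : UniformSpace} (f g : U -> C) x :
  continuous (U := C_UniformSpace) f x -> continuous (U := C_UniformSpace) g x ->
  continuous (U := C_UniformSpace) (fun u => f u * g u)%C x.
Proof.
  intros Hf Hg.
  generalize (continuous_Re _ _ Hf) (continuous_Im _ _ Hf)
    (continuous_Re _ _ Hg) (continuous_Im _ _ Hg); intros.
  apply continuous_C; simpl; repeat
   (apply continuous_Rplus || apply continuous_Ropp || apply continuous_Rmult); assumption.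
Qed.

Lemma continuous_Cconj {U : UniformSpace} (f : U -> C) x :
  continuous (U := C_UniformSpace) f x ->
  continuous (U := C_UniformSpace) (fun u => Cconj (f u)) x.
Proof.
  intros Hf. apply continuous_C; simpl; [|apply continuous_Ropp];
  (apply continuous_Re || apply continuous_Im); assumption.
Qed.

Lemma Re_Im_sq_neq_0 (z : C) : z <> 0%C -> Re z ^ 2 + Im z ^ 2 <> 0.
Proof.
  intros Hz H. apply Hz. rewrite <- Cmod2_alt in H. apply Cmod_eq_0.
  destruct (Req_dec (Cmod z) 0) as [E|E]; [exact E|].
  exfalso. revert H. apply pow_nonzero, E.
Qed.

Lemma continuous_Cinv {U : UniformSpace} (f : U -> C) x :
  continuous (U := C_UniformSpace) f x -> f x <> 0%C ->
  continuous (U := C_UniformSpace) (fun u => / f u)%C x.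
Proof.
  intros Hf H0.
  generalize (continuous_Re _ _ Hf) (continuous_Im _ _ Hf); intros.
  generalize (Re_Im_sq_neq_0 _ H0); intros H2.
  assert (Hsq : continuous (fun u => / (Re (f u) * (Re (f u) * 1) + Im (f u) * (Im (f u) * 1))) x).
  { apply continuous_Rinv_comp; [|exact H2].
    repeat (apply continuous_Rplus || apply continuous_Rmult); 
      try assumption; apply continuous_const. }
  apply continuous_C; simpl; apply continuous_Rmult; try apply continuous_Ropp; assumption.
Qed.

Lemma continuous_RtoC {U : UniformSpace} (f : U -> R) x :
  continuous f x -> continuous (U := C_UniformSpace) (fun u => RtoC (f u)) x.
Proof. intros; apply continuous_C; simpl; [assumption|apply continuous_const]. Qed.

Lemma continuous_Cpow {U : UniformSpace} (f : U -> C) n x :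
  continuous (U := C_UniformSpace) f x ->
  continuous (U := C_UniformSpace) (fun u => f u ^ n)%C x.
Proof.
  intros; induction n; simpl. apply continuous_const.
  apply continuous_Cmult; assumption.
Qed.

Lemma continuous_Cmod {U : UniformSpace} (f : U -> C) x :
  continuous (U := C_UniformSpace) f x -> continuous (fun u => Cmod (f u)) x.
Proof.
  intros Hf. unfold Cmod.
  apply (continuous_comp (fun u => fst (f u) ^ 2 + snd (f u) ^ 2) sqrt).
  - generalize (continuous_Re _ _ Hf) (continuous_Im _ _ Hf); intros.
    simpl. repeat (apply continuous_Rplus || apply continuous_Rmult); try assumption;
    apply continuous_const.
  - apply continuous_sqrt.
Qed.

(** Balls of [C] are squares, so metric statements go through this lemma. *)
Lemma locally_Cmod (P : C -> Prop) (z : C) :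
  locally (T := C_UniformSpace) z P <->
  exists d, 0 < d /\ forall w, Cmod (w - z) < d -> P w.
Proof.
  split.
  - intros [d Hd]. exists d. split. apply cond_pos. intros w Hw. apply Hd.
    apply C_NormedModule_mixin_compat1. exact Hw.
  - intros [d [Hd H]].
    assert (Hs : 0 < d / 2) by lra.
    exists (mkposreal _ Hs). intros w [H1 H2]. apply H.
    change (Rabs (fst w - fst z) < d / 2) in H1.
    change (Rabs (snd w - snd z) < d / 2) in H2.
    apply Rle_lt_trans with (Rabs (fst w - fst z) + Rabs (snd w - snd z)); [|lra].
    replace (w - z)%C with (RtoC (fst w - fst z) + Ci * RtoC (snd w - snd z))%C
      by (apply C_ext; simpl; ring).
    eapply Rle_trans; [apply Cmod_triangle|].
    rewrite Cmod_mult, Cmod_Ci, !Cmod_R. lra.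
Qed.

Lemma locally_disk (R0 : R) (z : C) :
  Cmod z < R0 -> locally (T := C_UniformSpace) z (fun w => Cmod w < R0).
Proof.
  intros H. apply locally_Cmod. exists (R0 - Cmod z). split. lra.
  intros w Hw. replace w with (z + (w - z))%C by ring.
  eapply Rle_lt_trans; [apply Cmod_triangle|lra].
Qed.

Lemma continuous_neq_0 (F : C -> C) (z : C) :
  continuous (U := C_UniformSpace) F z -> F z <> 0%C ->
  locally (T := C_UniformSpace) z (fun w => F w <> 0%C).
Proof.
  intros Hc H0. assert (Hp := proj1 (Cmod_gt_0 _) H0).
  generalize (proj1 (filterlim_locally _ _) (continuous_Cmod _ _ Hc) (mkposreal _ Hp)).
  apply filter_imp. intros w Hw E. 
  change (Rabs (Cmod (F w) - Cmod (F z)) < Cmod (F z)) in Hw.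
  rewrite E, Cmod_0 in Hw. apply Rabs_def2 in Hw. lra.
Qed.

(** Carathéodory's form of complex differentiability turns the rules for
    derivatives into continuity statements. *)
Definition cdiff (F : C -> C) (z l : C) : Prop :=
  exists phi : C -> C,
    continuous (U := C_UniformSpace) phi z /\ phi z = l /\
    locally (T := C_UniformSpace) z (fun w => F w = F z + phi w * (w - z))%C.

Lemma cdiff_continuous F z l :
  cdiff F z l -> continuous (U := C_UniformSpace) F z.
Proof.
  intros [phi [Hp [_ Hl]]].
  apply continuous_ext_loc with (fun w => F z + phi w * (w - z))%C.
  - revert Hl. apply filter_imp. intros; symmetry; assumption.
  - apply continuous_Cplus; [apply continuous_const|].
    apply continuous_Cmult; [exact Hp|].
    apply continuous_Cminus; [apply continuous_id|apply continuous_const].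
Qed.

Lemma cdiff_ext_loc F G z l :
  locally (T := C_UniformSpace) z (fun w => F w = G w) -> cdiff F z l -> cdiff G z l.
Proof.
  intros He [phi [Hp [E Hl]]]. exists phi. repeat split; try assumption.
  assert (Hz := locally_singleton _ _ He). simpl in Hz.
  generalize (filter_and _ _ He Hl). apply filter_imp.
  intros w [A B]. rewrite <- A, <- Hz. exact B.
Qed.

Lemma cdiff_const c z : cdiff (fun _ => c) z 0%C.
Proof.
  exists (fun _ => 0%C). repeat split. apply continuous_const.
  apply filter_forall. intros w; change C in w; ring.
Qed.

Lemma cdiff_id z : cdiff (fun w => w) z 1%C.
Proof.
  exists (fun _ => 1%C). repeat split. apply continuous_const.
  apply filter_forall. intros w; change C in w; ring.
Qed.

Lemma cdiff_plus F G z l m :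
  cdiff F z l -> cdiff G z m -> cdiff (fun w => F w + G w)%C z (l + m)%C.
Proof.
  intros [p [Hp [Ep Lp]]] [q [Hq [Eq Lq]]].
  exists (fun w => p w + q w)%C. repeat split.
  - apply continuous_Cplus; assumption.
  - congruence.
  - generalize (filter_and _ _ Lp Lq). apply filter_imp.
    intros w [A B]. rewrite A, B. ring.
Qed.

Lemma cdiff_mult F G z l m :
  cdiff F z l -> cdiff G z m ->
  cdiff (fun w => F w * G w)%C z (l * G z + F z * m)%C.
Proof.
  intros HF HG. assert (HcG := cdiff_continuous _ _ _ HG).
  destruct HF as [p [Hp [Ep Lp]]], HG as [q [Hq [Eq Lq]]].
  exists (fun w => p w * G w + F z * q w)%C. repeat split.
  - apply continuous_Cplus; apply continuous_Cmult; try assumption. apply continuous_const.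
  - congruence.
  - generalize (filter_and _ _ Lp Lq). apply filter_imp.
    intros w [A B]. rewrite A, B. ring.
Qed.

Lemma cdiff_inv F z l :
  cdiff F z l -> F z <> 0%C -> cdiff (fun w => / F w)%C z (- (l / (F z * F z)))%C.
Proof.
  intros HF H0. assert (HcF := cdiff_continuous _ _ _ HF).
  assert (Hn := continuous_neq_0 _ _ HcF H0).
  destruct HF as [p [Hp [Ep Lp]]].
  exists (fun w => - (p w * / (F w * F z)))%C. repeat split.
  - apply continuous_Copp, continuous_Cmult; [assumption|].
    apply continuous_Cinv. apply continuous_Cmult; [assumption|apply continuous_const].
    apply Cmult_neq_0; assumption.
  - rewrite Ep. reflexivity.
  - generalize (filter_and _ _ Lp Hn). apply filter_imp. 
    intros w [A B]. 
    assert (E : (p w * (w - z) = F w - F z)%C) by (rewrite A; ring).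
    replace (- (p w * / (F w * F z)) * (w - z))%C
      with (- (p w * (w - z)) * / (F w * F z))%C by ring.
    rewrite E. field. split; assumption.
Qed.

Lemma cdiff_eq F z l m : cdiff F z l -> l = m -> cdiff F z m.
Proof. intros; subst; assumption. Qed.

Lemma cdiff_pow n z : cdiff (fun w => w ^ n)%C z (INR n * z ^ pred n)%C.
Proof.
  induction n.
  - simpl. eapply cdiff_eq. apply cdiff_const. ring.
  - simpl pred. eapply cdiff_eq. apply (cdiff_mult _ _ _ _ _ (cdiff_id z) IHn).
    rewrite S_INR, RtoC_plus. destruct n; simpl; ring.
Qed.

Lemma cdiff_C_derive F z l : cdiff F z l -> C_derive F z = l.
Proof.
  intros [p [Hp [Ep Lp]]]. unfold C_derive. apply is_C_lim_unique.
  apply filterlim_ext_loc with p.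
  - unfold locally', within. revert Lp. apply filter_imp. intros w A Hw.
    assert (B : (w - z <> 0)%C) by (apply Cminus_eq_contra; exact Hw).
    rewrite A. field. exact B.
  - rewrite <- Ep. intros P HP. generalize (Hp P HP).
    unfold filtermap, locally', within. apply filter_imp. auto.
Qed.

(** Curves are differentiated componentwise because the mean value theorem,
    the integral and differentiation under it are used for real functions. *)
Definition cder (g : R -> C) (t : R) (d : C) : Prop :=
  is_derive (fun s => Re (g s)) t (Re d) /\ is_derive (fun s => Im (g s)) t (Im d).

Lemma is_derive_continuous_mult (p h : R -> R) t d :
  continuous p t -> is_derive h t d ->
  is_derive (fun s => p s * (h s - h t)) t (p t * d).
Proof.
  intros Hp Hh. apply is_derive_Reals. apply is_derive_Reals in Hh.
  apply continuity_pt_filterlim in Hp.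
  assert (Q : limit1_in (fun s => p (t + s) * ((h (t + s) - h t) / s)) (fun s => s <> 0) (p t * d) 0).
  { apply limit_mul.
    - intros e He. destruct (Hp e He) as [a [Ha H]]. exists a. split. exact Ha.
      intros s [Hs1 Hs2]. simpl in *. unfold Rdist in *.
      apply H. split. split. exact I. intros E. apply Hs1. lra.
      replace (t + s - t) with (s - 0) by ring. exact Hs2.
    - intros e He. destruct (Hh e He) as [a H]. exists a. split. apply cond_pos.
      intros s [Hs1 Hs2]. simpl in *. unfold Rdist in *. apply H. exact Hs1.
      rewrite Rminus_0_r in Hs2. exact Hs2. }
  intros e He. destruct (Q e He) as [a [Ha H]]. exists (mkposreal a Ha).
  intros s Hs1 Hs2. simpl in *. unfold Rdist in H.
  replace ((p (t + s) * (h (t + s) - h t) - p t * (h t - h t)) / s)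
    with (p (t + s) * ((h (t + s) - h t) / s)) by (field; exact Hs1).
  apply H. split. exact Hs1. rewrite Rminus_0_r; exact Hs2.
Qed.

Lemma is_derive_continuous (h : R -> R) t d : is_derive h t d -> continuous h t.
Proof. intros H. apply (ex_derive_continuous h). exists d; exact H. Qed.

Lemma cder_continuous g t d : cder g t d -> continuous (U := C_UniformSpace) g t.
Proof. intros [A B]. apply continuous_C; eapply is_derive_continuous; eassumption. Qed.

Lemma cder_eq g t d e : cder g t d -> d = e -> cder g t e.
Proof. intros; subst; assumption. Qed.

Lemma cder_comp F g t l d :
  cdiff F (g t) l -> cder g t d -> cder (fun s => F (g s)) t (l * d)%C.
Proof.
  intros [p [Hp [Ep Lp]]] Hg. assert (Hc := cder_continuous _ _ _ Hg).
  destruct Hg as [G1 G2].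
  assert (Hpg : continuous (U := C_UniformSpace) (fun s => p (g s)) t)
    by (apply (continuous_comp g p); assumption).
  assert (P1 := continuous_Re _ _ Hpg). assert (P2 := continuous_Im _ _ Hpg).
  assert (L : locally t (fun s => F (g s) = F (g t) + p (g s) * (g s - g t))%C)
    by (exact (Hc _ Lp)).
  split.
  - apply is_derive_ext_loc with
      (fun s => Re (F (g t)) + (Re (p (g s)) * (Re (g s) - Re (g t)) 
                                - Im (p (g s)) * (Im (g s) - Im (g t)))).
    + revert L. apply filter_imp. intros s A. rewrite A. simpl. unfold Re, Im. ring.
    + replace (Re (l * d)) with (0 + (Re (p (g t)) * Re d - Im (p (g t)) * Im d))
        by (rewrite Ep; simpl; unfold Re, Im; ring).
      apply @is_derive_plus. apply @is_derive_const. 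
      apply @is_derive_minus.
      * exact (is_derive_continuous_mult (fun s => Re (p (g s))) _ _ _ P1 G1).
      * exact (is_derive_continuous_mult (fun s => Im (p (g s))) _ _ _ P2 G2).
  - apply is_derive_ext_loc with
      (fun s => Im (F (g t)) + (Re (p (g s)) * (Im (g s) - Im (g t)) 
                                + Im (p (g s)) * (Re (g s) - Re (g t)))).
    + revert L. apply filter_imp. intros s A. rewrite A. simpl. unfold Re, Im. ring.
    + replace (Im (l * d)) with (0 + (Re (p (g t)) * Im d + Im (p (g t)) * Re d))
        by (rewrite Ep; simpl; unfold Re, Im; ring).
      apply @is_derive_plus. apply @is_derive_const. 
      apply @is_derive_plus.
      * exact (is_derive_continuous_mult (fun s => Re (p (g s))) _ _ _ P1 G2).
      * exact (is_derive_continuous_mult (fun s => Im (p (g s))) _ _ _ P2 G1).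
Qed.

Lemma is_derive_Rmult (f g : R -> R) t d e :
  is_derive f t d -> is_derive g t e ->
  is_derive (fun s => f s * g s) t (d * g t + f t * e).
Proof. intros; apply (is_derive_mult f g); try assumption. exact Rmult_comm. Qed.

Lemma cder_mult f g t d e :
  cder f t d -> cder g t e -> cder (fun s => f s * g s)%C t (d * g t + f t * e)%C.
Proof.
  intros [A B] [A' B']. split.
  - replace (Re (d * g t + f t * e)) with
     ((Re d * Re (g t) + Re (f t) * Re e) - (Im d * Im (g t) + Im (f t) * Im e))
      by (unfold Re, Im; simpl; ring).
    apply (is_derive_minus (fun s => Re (f s) * Re (g s)) (fun s => Im (f s) * Im (g s)));
      apply (is_derive_Rmult (fun s => _ (f s)) (fun s => _ (g s))); assumption.
  - replace (Im (d * g t + f t * e)) with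
     ((Re d * Im (g t) + Re (f t) * Im e) + (Im d * Re (g t) + Im (f t) * Re e))
      by (unfold Re, Im; simpl; ring).
    apply (is_derive_plus (fun s => Re (f s) * Im (g s)) (fun s => Im (f s) * Re (g s)));
      apply (is_derive_Rmult (fun s => _ (f s)) (fun s => _ (g s))); assumption.
Qed.

Lemma real_const_of_derive_0 (h : R -> R) a b :
  a <= b -> (forall t, a <= t <= b -> is_derive h t 0) -> h b = h a.
Proof.
  intros Hab H. destruct (MVT_gen h a b (fun _ => 0)) as [c [_ E]].
  - intros x Hx. rewrite Rmin_left, Rmax_right in Hx by lra. apply H. lra.
  - intros x Hx. rewrite Rmin_left, Rmax_right in Hx by lra.
    apply continuity_pt_filterlim. apply (is_derive_continuous h x 0). apply H; lra.
  - lra.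
Qed.

Lemma cder_0_const (g : R -> C) a b :
  a <= b -> (forall t, a <= t <= b -> cder g t 0%C) -> g b = g a.
Proof.
  intros Hab H. apply C_ext.
  - apply (real_const_of_derive_0 (fun s => Re (g s))); [exact Hab|]. intros; apply H; assumption.
  - apply (real_const_of_derive_0 (fun s => Im (g s))); [exact Hab|]. intros; apply H; assumption.
Qed.

Lemma increasing_of_derive_nonneg (h dh : R -> R) a b :
  a <= b -> (forall t, a <= t <= b -> is_derive h t (dh t)) ->
  (forall t, a <= t <= b -> 0 <= dh t) -> h a <= h b.
Proof.
  intros Hab H Hp. destruct (MVT_gen h a b dh) as [c [Hc E]].
  - intros x Hx. rewrite Rmin_left, Rmax_right in Hx by lra. apply H. lra.
  - intros x Hx. rewrite Rmin_left, Rmax_right in Hx by lra.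
    apply continuity_pt_filterlim. eapply is_derive_continuous. apply H; lra.
  - rewrite Rmin_left, Rmax_right in Hc by lra. 
    assert (0 <= dh c * (b - a)) by (apply Rmult_le_pos; [apply Hp; lra|lra]). lra.
Qed.

(** * Means over a circle *)

Definition rmean (g : R -> R) : R := RInt g 0 (2 * PI) / (2 * PI).
Definition rcont (g : R -> R) : Prop := forall t, continuous g t.
Definition mean (G : R -> C) : C := (rmean (fun t => Re (G t)), rmean (fun t => Im (G t))).
Definition ccont (G : R -> C) : Prop := forall t, continuous (U := C_UniformSpace) G t.

Lemma two_PI_pos : 0 < 2 * PI.
Proof. generalize PI_RGT_0; lra. Qed.

Lemma rcont_ex_RInt g a b : rcont g -> ex_RInt g a b.
Proof. intros H. apply (ex_RInt_continuous g). intros; apply H. Qed.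

Lemma rmean_ext g h : (forall t, g t = h t) -> rmean g = rmean h.
Proof. intros H. unfold rmean. f_equal. apply RInt_ext. intros; apply H. Qed.

Lemma rmean_plus g h : rcont g -> rcont h -> rmean (fun t => g t + h t) = rmean g + rmean h.
Proof.
  intros Hg Hh. unfold rmean. 
  rewrite (RInt_plus g h) by (apply rcont_ex_RInt; assumption).
  unfold plus; simpl. field. generalize two_PI_pos; lra.
Qed.

Lemma rmean_scal c g : rcont g -> rmean (fun t => c * g t) = c * rmean g.
Proof.
  intros Hg. unfold rmean. 
  rewrite (RInt_scal g) by (apply rcont_ex_RInt; assumption).
  unfold scal; simpl; unfold mult; simpl. field. generalize two_PI_pos; lra.
Qed.

Lemma rmean_const c : rmean (fun _ => c) = c.
Proof.
  unfold rmean. rewrite RInt_const. unfold scal; simpl; unfold mult; simpl.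
  field. generalize two_PI_pos; lra.
Qed.

Lemma rmean_le g h : rcont g -> rcont h -> (forall t, g t <= h t) -> rmean g <= rmean h.
Proof.
  intros Hg Hh H. unfold rmean. generalize two_PI_pos; intros P.
  apply Rmult_le_compat_r. apply Rlt_le, Rinv_0_lt_compat; exact P.
  apply RInt_le; try (apply rcont_ex_RInt; assumption). lra. intros; apply H.
Qed.

Lemma rmean_gt_0 g : rcont g -> (forall t, 0 < g t) -> 0 < rmean g.
Proof.
  intros Hg H. unfold rmean. generalize two_PI_pos; intros P.
  apply Rdiv_lt_0_compat; [|exact P]. apply RInt_gt_0; auto.
Qed.

Lemma ccont_Re G : ccont G -> rcont (fun t => Re (G t)).
Proof. intros H t. apply continuous_Re, H. Qed.

Lemma ccont_Im G : ccont G -> rcont (fun t => Im (G t)).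
Proof. intros H t. apply continuous_Im, H. Qed.

Lemma rcont_scal c g : rcont g -> rcont (fun t => c * g t).
Proof. intros H t. apply continuous_Rmult; [apply continuous_const|apply H]. Qed.

Lemma mean_ext G H : (forall t, G t = H t) -> mean G = mean H.
Proof. intros E. unfold mean. f_equal; apply rmean_ext; intros; rewrite E; reflexivity. Qed.

Lemma mean_plus G H : ccont G -> ccont H -> mean (fun t => G t + H t)%C = (mean G + mean H)%C.
Proof.
  intros HG HH. apply C_ext; unfold mean, Re, Im; simpl;
  (rewrite <- rmean_plus; [reflexivity| |]); 
  first [apply (ccont_Re _ HG)|apply (ccont_Re _ HH)|apply (ccont_Im _ HG)|apply (ccont_Im _ HH)].
Qed.

Lemma mean_scal c G : ccont G -> mean (fun t => c * G t)%C = (c * mean G)%C.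
Proof.
  intros HG. generalize (ccont_Re _ HG) (ccont_Im _ HG); intros H1 H2.
  apply C_ext; simpl; unfold Rminus; try rewrite Ropp_mult_distr_l;
    rewrite <- !rmean_scal, <- rmean_plus by (try apply rcont_scal; assumption);
    apply rmean_ext; intros; unfold Re, Im; simpl; ring.
Qed.

Lemma mean_const c : mean (fun _ => c) = c.
Proof. apply C_ext; simpl; apply rmean_const. Qed.

Lemma mean_opp G : ccont G -> mean (fun t => - G t)%C = (- mean G)%C.
Proof.
  intros H. rewrite (mean_ext _ (fun t => (-(1)) * G t)%C) by (intros; ring).
  rewrite mean_scal by exact H. ring.
Qed.

Lemma mean_minus G H : ccont G -> ccont H -> mean (fun t => G t - H t)%C = (mean G - mean H)%C.
Proof.
  intros HG HH. unfold Cminus. rewrite mean_plus, mean_opp; try assumption. reflexivity.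
  intros t. apply continuous_Copp, HH.
Qed.

Lemma mean_conj G : ccont G -> mean (fun t => Cconj (G t)) = Cconj (mean G).
Proof.
  intros HG. apply C_ext; simpl. reflexivity.
  replace (- rmean (fun t => Im (G t))) with (-1 * rmean (fun t => Im (G t))) by ring.
  rewrite <- rmean_scal by (apply ccont_Im; exact HG).
  apply rmean_ext. intros; unfold Im; simpl; ring.
Qed.

Lemma rmean_derive (f df : R -> R -> R) s0 :
  locally s0 (fun s => forall t, is_derive (fun u => f u t) s (df s t)) ->
  locally s0 (fun s => rcont (f s)) ->
  (forall t, continuous (fun p : R * R => df (fst p) (snd p)) (s0, t)) ->
  is_derive (fun s => rmean (f s)) s0 (rmean (df s0)).
Proof.
  intros Hd Hc H2. unfold rmean.
  apply is_derive_ext with (fun s => / (2 * PI) * RInt (f s) 0 (2 * PI)).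
  { intros; apply Rmult_comm. }
  replace (RInt (df s0) 0 (2 * PI) / (2 * PI)) with
    (/ (2 * PI) * RInt (df s0) 0 (2 * PI)) by (unfold Rdiv; ring).
  apply is_derive_scal.
  rewrite <- (RInt_ext (fun t => Derive (fun u => f u t) s0)).
  2:{ intros t _. apply is_derive_unique. apply locally_singleton in Hd. apply Hd. }
  apply is_derive_RInt_param.
  - revert Hd. apply filter_imp. intros s H t _. eexists. apply H.
  - intros t _. apply continuity_2d_pt_ext_loc with (fun s t => df s t).
    + destruct Hd as [d Hd]. exists d. intros u v Hu _. symmetry. 
      apply is_derive_unique. apply Hd. exact Hu.
    + apply continuity_2d_pt_filterlim. exact (H2 t).
  - revert Hc. apply filter_imp. intros s H. apply rcont_ex_RInt, H.
Qed.

Lemma mean_cder (G D : R -> R -> C) s0 :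
  locally s0 (fun s => forall t, cder (fun u => G u t) s (D s t)) ->
  locally s0 (fun s => ccont (G s)) ->
  (forall t, continuous (U := C_UniformSpace) (fun p : R * R => D (fst p) (snd p)) (s0, t)) ->
  cder (fun s => mean (G s)) s0 (mean (D s0)).
Proof.
  intros H1 H2 H3. split; simpl.
  - apply (rmean_derive (fun s t => Re (G s t)) (fun s t => Re (D s t))).
    + revert H1. apply filter_imp. intros s H t. apply H.
    + revert H2. apply filter_imp. intros s H. apply ccont_Re, H.
    + intros t. apply (continuous_Re (fun p : R * R => D (fst p) (snd p))), H3.
  - apply (rmean_derive (fun s t => Im (G s t)) (fun s t => Im (D s t))).
    + revert H1. apply filter_imp. intros s H t. apply H.
    + revert H2. apply filter_imp. intros s H. apply ccont_Im, H.
    + intros t. apply (continuous_Im (fun p : R * R => D (fst p) (snd p))), H3.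
Qed.

Lemma mean_derivative_0 (G D : R -> C) :
  (forall t, cder G t (D t)) -> ccont D -> G (2 * PI) = G 0 -> mean D = 0%C.
Proof.
  intros H Hc E. apply C_ext; simpl; unfold rmean.
  - rewrite (is_RInt_unique _ _ _ _ (is_RInt_derive (fun t => Re (G t)) (fun t => Re (D t)) 0 (2 * PI)
      (fun x _ => proj1 (H x)) (fun x _ => ccont_Re _ Hc x))).
    rewrite E. unfold minus, plus, opp; simpl. unfold Rdiv; ring.
  - rewrite (is_RInt_unique _ _ _ _ (is_RInt_derive (fun t => Im (G t)) (fun t => Im (D t)) 0 (2 * PI)
      (fun x _ => proj2 (H x)) (fun x _ => ccont_Im _ Hc x))).
    rewrite E. unfold minus, plus, opp; simpl. unfold Rdiv; ring.
Qed.

Definition cis (t : R) : C := (cos t, sin t).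

Lemma Cmod_cis t : Cmod (cis t) = 1.
Proof.
  unfold Cmod, cis; simpl. replace (_ + _) with 1. apply sqrt_1.
  generalize (sin2_cos2 t); unfold Rsqr; intros; lra.
Qed.

Lemma cis_neq_0 t : cis t <> 0%C.
Proof. apply Cmod_gt_0. rewrite Cmod_cis. lra. Qed.

Lemma cis_conj t : (cis t * Cconj (cis t) = 1)%C.
Proof. rewrite <- Cmod2_conj, Cmod_cis. f_equal; ring. Qed.

Lemma cder_cis t : cder cis t (Ci * cis t)%C.
Proof.
  split; simpl; unfold Re, Im; simpl; auto_derive; trivial; ring.
Qed.

Lemma continuous_cis t : continuous (U := C_UniformSpace) cis t.
Proof. eapply cder_continuous, cder_cis. Qed.

Lemma cis_2PI : cis (2 * PI) = cis 0.
Proof. unfold cis. rewrite cos_2PI, sin_2PI, cos_0, sin_0. reflexivity. Qed.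

(** Continuity of the derivative is what differentiation under the integral
    sign requires; all functions below come from power series, for which it is
    immediate. *)
Definition hol (r : R) (F F' : C -> C) : Prop :=
  forall z, Cmod z < r -> cdiff F z (F' z) /\ continuous (U := C_UniformSpace) F' z.

Lemma hol_continuous r F F' z :
  hol r F F' -> Cmod z < r -> continuous (U := C_UniformSpace) F z.
Proof. intros H Hz. eapply cdiff_continuous, H, Hz. Qed.

Lemma cder_const (c : C) t : cder (fun _ => c) t 0%C.
Proof. split; apply @is_derive_const. Qed.

Lemma cder_linear (a b : C) t : cder (fun s => a + RtoC s * b)%C t b.
Proof.
  split; simpl; unfold Re, Im; simpl; auto_derive; trivial; ring.
Qed.

Lemma cder_affine (a b : C) g t d : cder g t d -> cder (fun s => a + b * g s)%C t (b * d)%C.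
Proof.
  intros H. apply (cder_comp (fun w => a + b * w)%C); [|exact H].
  eapply cdiff_eq. apply cdiff_plus; [apply cdiff_const|apply cdiff_mult; [apply cdiff_const|apply cdiff_id]].
  cbv beta; ring.
Qed.

(** Shrinking the circle [|z| = rho] towards [A] does not change the mean: the
    derivative in the shrinking parameter [s] is, up to the factor [1/(i s)], the
    derivative of a periodic function of the angle. *)
Lemma cauchy_kernel (r rho : R) (F F' : C -> C) (A : C) :
  hol r F F' -> 0 < rho < r -> Cmod A < rho ->
  mean (fun t => F (rho * cis t) * (rho * cis t / (rho * cis t - A)))%C =
  (F A * mean (fun t => rho * cis t / (rho * cis t - A)))%C.
Proof.
  intros HF Hr HA.
  assert (Hnz : forall t, (rho * cis t - A <> 0)%C).
  { intros t E. assert (E' : A = (rho * cis t)%C).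
    { replace A with (rho * cis t - (rho * cis t - A))%C by ring. rewrite E; ring. }
    rewrite E', Cmod_mult, Cmod_cis, Cmod_R, Rabs_pos_eq in HA; lra. }
  set (p := fun s t => (A + RtoC s * (rho * cis t - A))%C).
  set (k := fun t => (rho * cis t / (rho * cis t - A))%C).
  assert (Hp : forall s t, -((r - rho)/(2*rho)) < s < 1 + (r - rho) / (2 * rho) -> Cmod (p s t) < r).
  { intros s t Hs. unfold p.
    replace (A + s * (rho * cis t - A))%C with (RtoC (1 - s) * A + RtoC s * (rho * cis t))%C
      by (rewrite RtoC_minus; ring).
    eapply Rle_lt_trans; [apply Cmod_triangle|].
    rewrite !Cmod_mult, Cmod_cis, !Cmod_R, (Rabs_pos_eq rho) by lra.
    assert (Ha := Cmod_ge_0 A). set (d := (r - rho) / (2 * rho)) in *.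
    assert (Hd : d * (2 * rho) = r - rho) by (unfold d; field; lra).
    assert (Hd0 : 0 < d) by (unfold d; apply Rdiv_lt_0_compat; lra).
    assert (Rabs (1 - s) * Cmod A <= Rabs (1 - s) * rho) by
     (apply Rmult_le_compat_l; [apply Rabs_pos|lra]).
    assert (Rabs (1 - s) + Rabs s < 1 + 2 * d).
    { unfold Rabs. destruct (Rcase_abs (1 - s)), (Rcase_abs s); lra. }
    assert ((Rabs (1 - s) + Rabs s) * rho < (1 + 2 * d) * rho) by (apply Rmult_lt_compat_r; lra).
    lra. }
  set (d := (r - rho) / (2 * rho)) in *.
  assert (Hd0 : 0 < d) by (unfold d; apply Rdiv_lt_0_compat; lra).
  assert (Ck : forall t, continuous (U := C_UniformSpace) k t).
  { intros t. unfold k, Cdiv. 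
    assert (continuous (U := C_UniformSpace) (fun t => rho * cis t)%C t)
      by (apply continuous_Cmult; [apply continuous_const|apply continuous_cis]).
    apply continuous_Cmult; [assumption|]. apply continuous_Cinv; [|apply Hnz].
    apply continuous_Cminus; [assumption|apply continuous_const]. }
  assert (Cp : forall s t, continuous (U := C_UniformSpace) (fun q : R * R => p (fst q) (snd q)) (s, t)).
  { intros s t. unfold p. apply continuous_Cplus; [apply continuous_const|].
    apply continuous_Cmult. apply continuous_RtoC. apply continuous_fst.
    apply continuous_Cminus; [|apply continuous_const].
    apply continuous_Cmult; [apply continuous_const|].
    apply (continuous_comp snd cis). apply continuous_snd. apply continuous_cis. }
  assert (Cp1 : forall s t, continuous (U := C_UniformSpace) (p s) t).
  { intros s t. unfold p. apply continuous_Cplus; [apply continuous_const|].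
    apply continuous_Cmult. apply continuous_const.
    apply continuous_Cminus; [|apply continuous_const].
    apply continuous_Cmult; [apply continuous_const|]. apply continuous_cis. }
  assert (Hder : forall s, 0 <= s <= 1 -> cder (fun s => mean (fun t => F (p s t) * k t)%C) s 0%C).
  { intros s Hs.
    eapply cder_eq.
    - apply (mean_cder (fun s t => F (p s t) * k t)%C (fun s t => F' (p s t) * (rho * cis t))%C).
      + assert (L : locally s (fun u => - d < u < 1 + d)).
        { exists (mkposreal d Hd0). intros y Hy. change (Rabs (y - s) < d) in Hy. 
          apply Rabs_def2 in Hy. lra. }
        revert L. apply filter_imp. intros u Hu t.
        eapply cder_eq.
        * apply cder_mult. apply (cder_comp F (fun u => p u t)). apply HF, Hp, Hu.
          unfold p; apply cder_linear. 
          apply cder_const.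
        * unfold k. cbv beta. field. apply Hnz.
      + assert (L : locally s (fun u => - d < u < 1 + d)).
        { exists (mkposreal d Hd0). intros y Hy. change (Rabs (y - s) < d) in Hy. 
          apply Rabs_def2 in Hy. lra. }
        revert L. apply filter_imp. intros u Hu t.
        apply continuous_Cmult; [|apply Ck]. apply (continuous_comp (p u) F). apply Cp1.
        eapply hol_continuous. exact HF. apply Hp, Hu.
      + intros t. apply continuous_Cmult. 
        apply (continuous_comp (fun q : R * R => p (fst q) (snd q)) F'). apply Cp.
        apply HF. simpl. apply Hp; lra.
        apply continuous_Cmult. apply continuous_const. 
        apply (continuous_comp snd cis). apply continuous_snd. apply continuous_cis.
    - assert (Cx : ccont (fun t => rho * cis t)%C).
      { intros t. apply continuous_Cmult; [apply continuous_const|apply continuous_cis]. }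
      assert (CF : ccont (fun t => F' (p s t) * (rho * cis t))%C).
      { intros t. apply continuous_Cmult; [|apply Cx].
        apply (continuous_comp (p s) F'). apply Cp1. apply HF, Hp; lra. }
      destruct (Req_dec s 0) as [E|E].
      + rewrite E. rewrite (mean_ext _ (fun t => (F' A * rho) * cis t)%C).
        2:{ intros t. unfold p. replace (A + 0 * (rho * cis t - A))%C with A by ring. ring. }
        rewrite mean_scal by (intros t; apply continuous_cis).
        rewrite (mean_derivative_0 (fun t => 0 + (- Ci) * cis t)%C cis); [ring| | |].
        * intros t. eapply cder_eq. apply cder_affine, cder_cis.
          apply C_ext; unfold Re, Im; simpl; ring.
        * intros t; apply continuous_cis.
        * rewrite cis_2PI; reflexivity.
      + assert (Es : RtoC s <> 0%C) by (intros A0; apply RtoC_inj in A0; auto).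
        apply (mean_derivative_0 (fun t => 0 + (- Ci / s) * F (p s t))%C).
        * intros t. eapply cder_eq. apply cder_affine. 
          apply (cder_comp F (p s)). apply HF, Hp; lra.
          apply (cder_comp (fun w => A + s * (rho * w - A))%C cis).
          2: apply cder_cis.
          eapply cdiff_eq. apply cdiff_plus; [apply cdiff_const|apply cdiff_mult; [apply cdiff_const|]].
          apply cdiff_plus; [apply cdiff_mult; [apply cdiff_const|apply cdiff_id]|apply cdiff_const].
          reflexivity.
          cbv beta. transitivity (- (Ci * Ci) * F' (p s t) * (rho * cis t))%C; [field; exact Es|].
          replace (- (Ci * Ci))%C with (RtoC 1) by (apply C_ext; unfold Re, Im; simpl; ring). ring.
        * exact CF.
        * unfold p. rewrite cis_2PI. reflexivity. }
  assert (E := cder_0_const _ 0 1 ltac:(lra) Hder). simpl in E.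
  rewrite <- mean_scal by exact Ck.
  transitivity (mean (fun t => F (p 1 t) * k t)%C).
  - apply mean_ext. intros t. unfold p. 
    replace (A + 1 * (rho * cis t - A))%C with (rho * cis t)%C by ring. reflexivity.
  - rewrite E. apply mean_ext. intros t. unfold p.
    replace (A + 0 * (rho * cis t - A))%C with A by ring. reflexivity.
Qed.

(** The case [A = 0], in which the kernel is constant. *)
Lemma mean_value (r rho : R) (F F' : C -> C) :
  hol r F F' -> 0 < rho < r -> mean (fun t => F (rho * cis t))%C = F 0%C.
Proof.
  intros HF Hr.
  assert (Hk : forall t, (rho * cis t / (rho * cis t - 0) = 1)%C).
  { intros t. field. split; [apply cis_neq_0|].
    intros E. apply RtoC_inj in E. lra. }
  assert (H := cauchy_kernel r rho F F' 0%C HF Hr ltac:(rewrite Cmod_0; lra)).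
  rewrite (mean_ext (fun t => F (rho * cis t)%C) (fun t => F (rho * cis t) * (rho * cis t / (rho * cis t - 0)))%C).
  2:{ intros t. rewrite Hk. ring. }
  rewrite H. rewrite (mean_ext _ (fun _ => 1%C)) by exact Hk. rewrite mean_const. ring.
Qed.

Lemma hol_const r c : hol r (fun _ => c) (fun _ => 0%C).
Proof. intros z _. split; [apply cdiff_const|apply continuous_const]. Qed.

Lemma hol_id r : hol r (fun w => w) (fun _ => 1%C).
Proof. intros z _. split; [apply cdiff_id|apply continuous_const]. Qed.

Lemma hol_plus r F F' G G' :
  hol r F F' -> hol r G G' -> hol r (fun w => F w + G w)%C (fun w => F' w + G' w)%C.
Proof.
  intros HF HG z Hz. split.
  - apply cdiff_plus; [apply HF, Hz|apply HG, Hz].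
  - apply continuous_Cplus; [apply HF, Hz|apply HG, Hz].
Qed.

Lemma hol_mult r F F' G G' :
  hol r F F' -> hol r G G' ->
  hol r (fun w => F w * G w)%C (fun w => F' w * G w + F w * G' w)%C.
Proof.
  intros HF HG z Hz. split.
  - apply cdiff_mult; [apply HF, Hz|apply HG, Hz].
  - apply continuous_Cplus; apply continuous_Cmult;
    solve [apply HF, Hz|apply HG, Hz|eapply hol_continuous; eassumption].
Qed.

Lemma hol_inv r F F' :
  hol r F F' -> (forall z, Cmod z < r -> F z <> 0%C) ->
  hol r (fun w => / F w)%C (fun w => - (F' w / (F w * F w)))%C.
Proof.
  intros HF H0 z Hz. 
  assert (Hc : continuous (U := C_UniformSpace) F z) by (eapply hol_continuous; eassumption).
  split.
  - apply cdiff_inv; [apply HF, Hz|apply H0, Hz].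
  - apply continuous_Copp, continuous_Cmult; [apply HF, Hz|].
    apply continuous_Cinv; [apply continuous_Cmult; exact Hc|].
    apply Cmult_neq_0; apply H0, Hz.
Qed.

Lemma hol_pow r n : exists G', hol r (fun w => w ^ n)%C G'.
Proof.
  exists (fun w => INR n * w ^ pred n)%C. intros z _. split. apply cdiff_pow.
  apply continuous_Cmult; [apply continuous_const|apply continuous_Cpow, continuous_id].
Qed.

Lemma hol_sub r r' F F' : r' <= r -> hol r F F' -> hol r' F F'.
Proof. intros H HF z Hz. apply HF. lra. Qed.

Lemma one_minus_neq_0 (w : C) : Cmod w < 1 -> (1 - w <> 0)%C.
Proof.
  intros H E. assert (E' : w = 1%C) by (replace w with (1 - (1 - w))%C by ring; rewrite E; ring).
  rewrite E', Cmod_1 in H. lra.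
Qed.

Lemma hol_geom r c : (forall z, Cmod z < r -> Cmod (c * z) < 1) ->
  exists G', hol r (fun w => / (1 - c * w))%C G'.
Proof.
  intros H. eexists. apply hol_inv.
  - apply hol_plus; [apply hol_const|].
    instantiate (1 := (fun w => - c)%C).
    intros z Hz. split.
    + exists (fun _ => - c)%C. repeat split. apply continuous_const.
      apply filter_forall. intros w; change C in w; ring.
    + apply continuous_const.
  - intros z Hz. apply one_minus_neq_0, H, Hz.
Qed.

(** On the circle, [1 / (rho x) = conj (rho x) / rho ^ 2], so the kernel is the
    conjugate of [1 / (1 - conj A y / rho ^ 2)], which is holomorphic in [y] on a
    disk of radius greater than [rho] and equals [1] at [0]. *)
Lemma mean_cauchy_kernel (rho : R) (A : C) :
  0 < rho -> Cmod A < rho -> mean (fun t => rho * cis t / (rho * cis t - A))%C = 1%C.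
Proof.
  intros Hr HA. assert (HA0 := Cmod_ge_0 A).
  assert (Hrho : RtoC rho <> 0%C) by (intros E; apply RtoC_inj in E; lra).
  set (r := 2 * rho ^ 2 / (rho + Cmod A)).
  assert (Er : r * (rho + Cmod A) = 2 * rho ^ 2) by (unfold r; field; lra).
  assert (Hr1 : rho < r) by (apply (Rmult_lt_reg_r (rho + Cmod A)); nra).
  set (c := (Cconj A / rho ^ 2)%C).
  assert (Hc : forall z, Cmod z < r -> Cmod (c * z) < 1).
  { intros z Hz. unfold c. rewrite Cmod_mult, Cmod_div by (apply Cpow_nz, Hrho).
    rewrite Cmod_conj, Cmod_pow, Cmod_R, Rabs_pos_eq by lra.
    assert (Hq : 0 < rho ^ 2) by (apply pow_lt; lra).
    apply (Rmult_lt_reg_r (rho ^ 2)). exact Hq.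
    replace (Cmod A / rho ^ 2 * Cmod z * rho ^ 2) with (Cmod A * Cmod z) by (field; lra).
    rewrite Rmult_1_l. apply Rle_lt_trans with (Cmod A * r).
    apply Rmult_le_compat_l; lra.
    apply (Rmult_lt_reg_r (rho + Cmod A)). lra.
    replace (Cmod A * r * (rho + Cmod A)) with (Cmod A * (2 * rho ^ 2)) by (rewrite <- Er; ring).
    replace (rho ^ 2 * (rho + Cmod A)) with (Cmod A * rho ^ 2 + rho * rho ^ 2) by ring.
    assert (Cmod A * rho ^ 2 < rho * rho ^ 2) by (apply Rmult_lt_compat_r; lra). lra. }
  destruct (hol_geom r c Hc) as [G' HG].
  assert (M := mean_value r rho _ _ HG (conj Hr Hr1)).
  assert (Cg : ccont (fun t => / (1 - c * (rho * cis t)))%C).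
  { intros t. apply (continuous_comp (fun t => rho * cis t)%C (fun w => / (1 - c * w))%C).
    apply continuous_Cmult; [apply continuous_const|apply continuous_cis].
    eapply hol_continuous. exact HG. rewrite Cmod_mult, Cmod_cis, Cmod_R, Rabs_pos_eq; lra. }
  rewrite (mean_ext _ (fun t => Cconj (/ (1 - c * (rho * cis t)))%C)).
  - rewrite mean_conj by exact Cg. rewrite M. replace (1 - c * 0)%C with (RtoC 1) by ring.
    apply C_ext; simpl; unfold Re, Im; simpl; field.
  - intros t. 
    assert (H1 : (1 - c * (rho * cis t) <> 0)%C).
    { apply one_minus_neq_0, Hc. rewrite Cmod_mult, Cmod_cis, Cmod_R, Rabs_pos_eq; lra. }
    assert (H2 : (rho * cis t - A <> 0)%C).
    { intros E. assert (E' : A = (rho * cis t)%C).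
      { replace A with (rho * cis t - (rho * cis t - A))%C by ring. rewrite E; ring. }
      rewrite E', Cmod_mult, Cmod_cis, Cmod_R, Rabs_pos_eq in HA; lra. }
    rewrite Cinv_conj by exact H1.
    assert (E : Cconj (1 - c * (rho * cis t)) = ((rho * cis t - A) / (rho * cis t))%C).
    { rewrite Cminus_conj, Cmult_conj. unfold c. rewrite Cdiv_conj by (apply Cpow_nz, Hrho).
      rewrite Cconj_conj, Cmult_conj.
      assert (Hx := cis_neq_0 t).
      assert (Ex : Cconj (cis t) = (/ cis t)%C).
      { generalize (cis_conj t); intros Q. rewrite <- (Cmult_1_r (/ cis t)), <- Q. field. exact Hx. }
      rewrite Ex. 
      replace (Cconj (rho ^ 2)) with (rho ^ 2)%C by (apply C_ext; unfold Re, Im; simpl; ring).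
      replace (Cconj rho) with (RtoC rho) by (apply C_ext; unfold Re, Im; simpl; ring).
      replace (Cconj 1) with (RtoC 1) by (apply C_ext; unfold Re, Im; simpl; ring).
      field. split; assumption. }
    rewrite E. field. repeat split; try assumption. apply cis_neq_0.
Qed.

Lemma cauchy_formula (r rho : R) (F F' : C -> C) (A : C) :
  hol r F F' -> 0 < rho < r -> Cmod A < rho ->
  mean (fun t => F (rho * cis t) * (rho * cis t / (rho * cis t - A)))%C = F A.
Proof.
  intros HF Hr HA. rewrite (cauchy_kernel r rho F F' A HF Hr HA).
  rewrite mean_cauchy_kernel by lra. ring.
Qed.

(** * Power series in the unit disk *)

Definition tends (u : nat -> C) (l : C) : Prop :=
  forall eps, 0 < eps -> exists N, forall n, (N <= n)%nat -> Cmod (u n - l) < eps.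

Fixpoint psum (a : nat -> C) (n : nat) (z : C) : C :=
  match n with O => 0%C | S m => (psum a m z + a m * z ^ m)%C end.

(** Such estimates for all [rho < 1] mean that the radius of convergence is at
    least [1], and they pass to the coefficients of the derivative. *)
Definition pbound (a : nat -> C) : Prop :=
  forall rho, 0 < rho < 1 -> exists B, forall k, Cmod (a k) * rho ^ k <= B.

Definition ps (a : nat -> C) (F : C -> C) : Prop :=
  pbound a /\ forall z, Cmod z < 1 -> tends (fun n => psum a n z) (F z).

Lemma tends_unique u l m : tends u l -> tends u m -> l = m.
Proof.
  intros H1 H2. apply Ceq_minus. apply Cmod_eq_0.
  destruct (Req_dec (Cmod (l - m)) 0) as [E|E]; [exact E|]. exfalso.
  assert (P : 0 < Cmod (l - m) / 2) by (generalize (Cmod_ge_0 (l - m)); lra).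
  destruct (H1 _ P) as [N1 K1], (H2 _ P) as [N2 K2].
  specialize (K1 (N1 + N2)%nat ltac:(lia)). specialize (K2 (N1 + N2)%nat ltac:(lia)).
  set (v := u (N1 + N2)%nat) in *.
  assert (Cmod (l - m) <= Cmod (v - l) + Cmod (v - m)).
  { replace (l - m)%C with (- (v - l) + (v - m))%C by ring.
    eapply Rle_trans; [apply Cmod_triangle|]. rewrite Cmod_opp. lra. }
  lra.
Qed.

Lemma tends_plus u v l m : tends u l -> tends v m -> tends (fun n => u n + v n)%C (l + m)%C.
Proof.
  intros H1 H2 e He. destruct (H1 (e / 2) ltac:(lra)) as [N1 K1], (H2 (e / 2) ltac:(lra)) as [N2 K2].
  exists (N1 + N2)%nat. intros n Hn. specialize (K1 n ltac:(lia)). specialize (K2 n ltac:(lia)).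
  replace (u n + v n - (l + m))%C with ((u n - l) + (v n - m))%C by ring.
  eapply Rle_lt_trans; [apply Cmod_triangle|]. lra.
Qed.

Lemma tends_scal c u l : tends u l -> tends (fun n => c * u n)%C (c * l)%C.
Proof.
  intros H e He. assert (Hc := Cmod_ge_0 c).
  destruct (H (e / (Cmod c + 1))) as [N K]. apply Rdiv_lt_0_compat; lra.
  exists N. intros n Hn. specialize (K n Hn).
  replace (c * u n - c * l)%C with (c * (u n - l))%C by ring. rewrite Cmod_mult.
  apply Rle_lt_trans with ((Cmod c + 1) * Cmod (u n - l)).
  apply Rmult_le_compat_r. apply Cmod_ge_0. lra.
  apply (Rmult_lt_compat_l (Cmod c + 1)) in K; [|lra].
  replace ((Cmod c + 1) * (e / (Cmod c + 1))) with e in K by (field; lra). exact K.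
Qed.

Lemma tends_const c : tends (fun _ => c) c.
Proof. intros e He. exists O. intros. replace (c - c)%C with (RtoC 0) by ring. rewrite Cmod_0. exact He. Qed.

Lemma tends_ext_shift u v l k : (forall n, u (n + k)%nat = v n) -> tends u l -> tends v l.
Proof.
  intros E H e He. destruct (H e He) as [N K]. exists N. intros n Hn.
  rewrite <- E. apply K. lia.
Qed.

Lemma tends_unshift u v l k : (forall n, v (n + k)%nat = u n) -> tends u l -> tends v l.
Proof.
  intros E H e He. destruct (H e He) as [N K]. exists (N + k)%nat. intros n Hn.
  replace n with (n - k + k)%nat by lia. rewrite E. apply K. lia.
Qed.

Lemma tends_Cmod_le u l b : tends u l -> (forall n, Cmod (u n) <= b) -> Cmod l <= b.
Proof.
  intros H Hb. apply Rnot_lt_le. intros L. destruct (H (Cmod l - b)) as [N K]. lra.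
  specialize (K N (le_n _)). specialize (Hb N).
  assert (Cmod l <= Cmod (u N) + Cmod (u N - l)).
  { replace l with (u N - (u N - l))%C at 1 by ring. unfold Cminus at 1.
    eapply Rle_trans; [apply Cmod_triangle|]. rewrite Cmod_opp. lra. }
  lra.
Qed.

Lemma INR_geom_bound q k : 0 <= q < 1 -> INR (S k) * q ^ k <= / (1 - q).
Proof.
  intros Hq. apply Rle_trans with (sum_f_R0 (fun i => q ^ i) k).
  - clear -Hq. assert (H : forall m, (m <= k)%nat -> INR (S m) * q ^ k <= sum_f_R0 (fun i => q ^ i) m).
    { induction m; intros Hm.
      - simpl. rewrite Rmult_1_l. apply Rle_trans with (1 ^ k). apply pow_incr; lra. rewrite pow1; lra.
      - rewrite S_INR. simpl sum_f_R0. rewrite Rmult_plus_distr_r, Rmult_1_l.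
        apply Rplus_le_compat. apply IHm; lia.
        replace k with (S m + (k - S m))%nat by lia. rewrite pow_add.
        apply Rle_trans with (q ^ S m * 1); [|simpl; lra].
        apply Rmult_le_compat_l. apply pow_le; lra.
        apply Rle_trans with (1 ^ (k - S m)). apply pow_incr; lra. rewrite pow1; lra. }
    apply H; lia.
  - rewrite tech3 by lra. unfold Rdiv. rewrite <- (Rmult_1_l (/ (1 - q))) at 2.
    apply Rmult_le_compat_r. apply Rlt_le, Rinv_0_lt_compat; lra.
    assert (0 <= q ^ S k) by (apply pow_le; lra). lra.
Qed.

Lemma pbound_index a : pbound a -> pbound (fun k => INR k * a k)%C.
Proof.
  intros H r Hr. set (r' := (1 + r) / 2). 
  assert (Hr' : 0 < r' < 1) by (unfold r'; lra).
  destruct (H r' Hr') as [B HB]. set (q := r / r').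
  assert (Hq : 0 <= q < 1).
  { unfold q; split. apply Rlt_le, Rdiv_lt_0_compat; lra.
    apply (Rmult_lt_reg_r r'). lra. unfold Rdiv; rewrite Rmult_assoc, Rinv_l by lra. unfold r'; lra. }
  exists (B * / (1 - q)). intros k.
  rewrite Cmod_mult, Cmod_R, Rabs_pos_eq by apply pos_INR.
  replace (r ^ k) with (r' ^ k * q ^ k).
  2:{ rewrite <- Rpow_mult_distr. f_equal. unfold q. field. lra. }
  replace (INR k * Cmod (a k) * (r' ^ k * q ^ k)) with ((Cmod (a k) * r' ^ k) * (INR k * q ^ k)) by ring.
  apply Rmult_le_compat.
  - apply Rmult_le_pos. apply Cmod_ge_0. apply pow_le; lra.
  - apply Rmult_le_pos. apply pos_INR. apply pow_le; lra.
  - apply HB.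
  - eapply Rle_trans; [|apply (INR_geom_bound q k Hq)].
    apply Rmult_le_compat_r. apply pow_le; lra. rewrite S_INR; lra.
Qed.

Lemma pbound_shift a m : pbound a -> pbound (fun k => a (m + k)%nat).
Proof.
  intros H r Hr. destruct (H r Hr) as [B HB]. exists (B / r ^ m). intros k.
  assert (P : 0 < r ^ m) by (apply pow_lt; lra).
  apply (Rmult_le_reg_r (r ^ m)); [exact P|].
  replace (B / r ^ m * r ^ m) with B by (field; lra).
  rewrite Rmult_assoc, <- pow_add. rewrite (Nat.add_comm k). apply HB.
Qed.

Definition dcoef (a : nat -> C) (k : nat) : C := (INR (S k) * a (S k))%C.

Lemma pbound_dcoef a : pbound a -> pbound (dcoef a).
Proof. intros H. exact (pbound_shift _ 1 (pbound_index _ H)). Qed.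

Fixpoint rsum (u : nat -> R) (n : nat) : R :=
  match n with O => 0 | S m => rsum u m + u m end.

Lemma rsum_le u v n : (forall k, u k <= v k) -> rsum u n <= rsum v n.
Proof. intros H; induction n; simpl. lra. specialize (H n). lra. Qed.

Lemma rsum_scal c u n : rsum (fun k => c * u k) n = c * rsum u n.
Proof. induction n; simpl. ring. rewrite IHn; ring. Qed.

Lemma rsum_geom q n : 0 <= q < 1 -> rsum (fun k => q ^ k) n <= / (1 - q).
Proof.
  intros Hq. assert (E : rsum (fun k => q ^ k) n * (1 - q) = 1 - q ^ n).
  { induction n; simpl. ring. rewrite Rmult_plus_distr_r, IHn. ring. }
  apply (Rmult_le_reg_r (1 - q)). lra. rewrite E, Rinv_l by lra.
  assert (0 <= q ^ n) by (apply pow_le; lra). lra.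
Qed.

Lemma psum_Cmod_le a n z : Cmod (psum a n z) <= rsum (fun k => Cmod (a k) * Cmod z ^ k) n.
Proof.
  induction n; simpl. rewrite Cmod_0; lra.
  eapply Rle_trans; [apply Cmod_triangle|]. rewrite Cmod_mult, Cmod_pow. lra.
Qed.

Lemma pbound_sum a r : pbound a -> 0 < r < 1 ->
  exists K, forall n, rsum (fun k => Cmod (a k) * r ^ k) n <= K.
Proof.
  intros H Hr. set (r' := (1 + r) / 2). 
  assert (Hr' : 0 < r' < 1) by (unfold r'; lra).
  destruct (H r' Hr') as [B HB]. set (q := r / r').
  assert (Hq : 0 <= q < 1).
  { unfold q; split. apply Rlt_le, Rdiv_lt_0_compat; lra.
    apply (Rmult_lt_reg_r r'). lra. unfold Rdiv; rewrite Rmult_assoc, Rinv_l by lra. unfold r'; lra. }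
  assert (HB0 : 0 <= B).
  { eapply Rle_trans; [|apply (HB O)]. apply Rmult_le_pos. apply Cmod_ge_0. apply pow_le; lra. }
  exists (B * / (1 - q)). intros n. apply Rle_trans with (rsum (fun k => B * q ^ k) n).
  - apply rsum_le. intros k. 
    replace (r ^ k) with (r' ^ k * q ^ k).
    2:{ rewrite <- Rpow_mult_distr. f_equal. unfold q. field. lra. }
    rewrite <- Rmult_assoc. apply Rmult_le_compat_r. apply pow_le; lra. apply HB.
  - rewrite rsum_scal. apply Rmult_le_compat_l. exact HB0. apply rsum_geom, Hq.
Qed.

Lemma sum_n_psum a n z : sum_n (fun k => a k * z ^ k)%C n = psum a (S n) z.
Proof.
  induction n.
  - rewrite sum_O. simpl. ring.
  - rewrite sum_Sn, IHn. reflexivity.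
Qed.

Lemma is_series_tends a z l :
  is_pseries (K := C_AbsRing) (V := C_NormedModule) a z l <-> tends (fun n => psum a n z) l.
Proof.
  assert (Ep : forall n, pow_n (K := C_AbsRing) z n = (z ^ n)%C).
  { induction n; simpl. reflexivity. rewrite IHn. reflexivity. }
  assert (E : forall n, sum_n (fun k => scal (pow_n (K := C_AbsRing) z k) (a k)) n = psum a (S n) z).
  { intros n. rewrite <- sum_n_psum. apply sum_n_ext. intros k. rewrite Ep. apply Cmult_comm. }
  unfold is_pseries, is_series. split.
  - intros H e He.
    assert (L : locally (T := C_UniformSpace) l (fun w => Cmod (w - l) < e)).
    { apply locally_Cmod. exists e; auto. }
    destruct (H _ L) as [N HN]. exists (S N). intros n Hn.
    destruct n; [lia|]. specialize (HN n ltac:(lia)). rewrite E in HN. exact HN.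
  - intros H P HP. apply (proj1 (locally_Cmod P l)) in HP. destruct HP as [d [Hd K]].
    destruct (H d Hd) as [N HN]. exists N. intros n Hn. apply K. rewrite E. apply HN. lia.
Qed.

Lemma bounded_of_eventually (u : nat -> R) N b :
  (forall n, (N <= n)%nat -> u n <= b) -> exists B, forall n, u n <= B.
Proof.
  induction N; intros H.
  - exists b. intros; apply H; lia.
  - destruct (Rle_dec (u N) b) as [L|L].
    + apply IHN. intros n Hn. destruct (Nat.eq_dec n N); [subst; exact L|apply H; lia].
    + assert (H' : forall n, (N <= n)%nat -> u n <= u N).
      { intros n Hn. destruct (Nat.eq_dec n N); [subst; lra|].
        apply Rle_trans with b. apply H; lia. lra. }
      clear IHN H. assert (Q : forall M, (M <= N)%nat -> exists B, u N <= B /\ forall n, (N - M <= n)%nat -> u n <= B).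
      { induction M; intros HM.
        - exists (u N). split. lra. intros; apply H'; lia.
        - destruct IHM as [B [HB1 HB2]]. lia. exists (Rmax B (u (N - S M)%nat)). split.
          eapply Rle_trans; [exact HB1|apply Rmax_l].
          intros n Hn. destruct (Nat.eq_dec n (N - S M)); [subst; apply Rmax_r|].
          eapply Rle_trans; [apply HB2; lia|apply Rmax_l]. }
      destruct (Q N (le_n _)) as [B [_ HB]]. exists B. intros; apply HB; lia.
Qed.

Lemma ps_of_is_pseries a F :
  (forall z, Cmod z < 1 -> is_pseries (K := C_AbsRing) (V := C_NormedModule) a z (F z)) -> ps a F.
Proof.
  intros H. assert (T : forall z, Cmod z < 1 -> tends (fun n => psum a n z) (F z)).
  { intros z Hz. apply is_series_tends, H, Hz. }
  split; [|exact T]. intros r Hr.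
  destruct (T (RtoC r)) with (eps := 1) as [N HN]. rewrite Cmod_R, Rabs_pos_eq; lra. lra.
  apply (bounded_of_eventually _ N 2). intros n Hn.
  assert (A := HN n Hn). assert (B := HN (S n) ltac:(lia)). simpl in B.
  replace (r ^ n) with (Cmod (RtoC r ^ n)) by (rewrite Cmod_pow, Cmod_R, Rabs_pos_eq by lra; reflexivity).
  rewrite <- Cmod_mult.
  replace (a n * r ^ n)%C with ((psum a n r + a n * r ^ n - F r) + - (psum a n r - F r))%C by ring.
  eapply Rle_trans; [apply Cmod_triangle|]. rewrite Cmod_opp. lra.
Qed.

(** The real and imaginary parts of the terms are dominated by a geometric
    series. *)
Lemma pbound_ps a : pbound a -> exists F, ps a F.
Proof.
  intros H. 
  set (F := fun z : C => (Series (fun k => Re (a k * z ^ k)%C), Series (fun k => Im (a k * z ^ k)%C)) : C).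
  exists F. split; [exact H|]. intros z Hz.
  set (r := (1 + Cmod z) / 2). assert (Hz0 := Cmod_ge_0 z).
  assert (Hr : 0 < r < 1) by (unfold r; lra).
  destruct (H r Hr) as [B HB]. set (q := Cmod z / r).
  assert (Hq : 0 <= q < 1).
  { unfold q; split. apply Rmult_le_pos. lra. apply Rlt_le, Rinv_0_lt_compat; lra.
    apply (Rmult_lt_reg_r r). lra. unfold Rdiv; rewrite Rmult_assoc, Rinv_l by lra. unfold r; lra. }
  assert (HG : ex_series (fun k => B * q ^ k)).
  { apply (ex_series_scal_l B (fun k => q ^ k)). apply ex_series_geom. rewrite Rabs_pos_eq; lra. }
  assert (Hk : forall k, Cmod (a k * z ^ k)%C <= B * q ^ k).
  { intros k. rewrite Cmod_mult, Cmod_pow.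
    replace (Cmod z) with (r * q) by (unfold q; field; lra). rewrite Rpow_mult_distr.
    rewrite <- Rmult_assoc. apply Rmult_le_compat_r. apply pow_le; lra. apply HB. }
  assert (S1 : ex_series (fun k => Re (a k * z ^ k)%C)).
  { apply (ex_series_le (V := R_CompleteNormedModule) _ (fun k => B * q ^ k)); [|exact HG].
    intros k. eapply Rle_trans; [|apply Hk]. apply re_le_Cmod. }
  assert (S2 : ex_series (fun k => Im (a k * z ^ k)%C)).
  { apply (ex_series_le (V := R_CompleteNormedModule) _ (fun k => B * q ^ k)); [|exact HG].
    intros k. eapply Rle_trans; [|apply Hk]. 
    eapply Rle_trans; [|apply Rmax_Cmod]. apply Rmax_r. }
  apply Series_correct in S1. apply Series_correct in S2.
  assert (ER : forall n, sum_n (fun k => Re (a k * z ^ k)%C) n = Re (psum a (S n) z)).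
  { induction n. rewrite sum_O. simpl. unfold Re; simpl; ring.
    rewrite sum_Sn, IHn. reflexivity. }
  assert (EI : forall n, sum_n (fun k => Im (a k * z ^ k)%C) n = Im (psum a (S n) z)).
  { induction n. rewrite sum_O. simpl. unfold Im; simpl; ring.
    rewrite sum_Sn, IHn. reflexivity. }
  intros e He. assert (He2 : 0 < e / 2) by lra.
  destruct (proj1 (filterlim_locally _ _) S1 (mkposreal _ He2)) as [N1 K1].
  destruct (proj1 (filterlim_locally _ _) S2 (mkposreal _ He2)) as [N2 K2].
  exists (S (N1 + N2)). intros n Hn. destruct n; [lia|].
  specialize (K1 n ltac:(lia)). specialize (K2 n ltac:(lia)).
  rewrite ER in K1. rewrite EI in K2.
  change (Rabs (Re (psum a (S n) z) - Re (F z)) < e / 2) in K1.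
  change (Rabs (Im (psum a (S n) z) - Im (F z)) < e / 2) in K2.
  set (P := psum a (S n) z) in *.
  replace (P - F z)%C with (RtoC (Re P - Re (F z)) + Ci * RtoC (Im P - Im (F z)))%C
    by (apply C_ext; unfold Re, Im; simpl; ring).
  eapply Rle_lt_trans; [apply Cmod_triangle|].
  rewrite Cmod_mult, Cmod_Ci, !Cmod_R. lra.
Qed.

(** The remainder [E k] of the expansion of [w ^ k] to first order satisfies
    [E (k + 1) = w * E k + k * z ^ (k - 1) * (w - z) ^ 2].  The factor [r ^ 2]
    avoids the exponent [k - 2]. *)
Lemma pow_taylor_bound (z w : C) r k :
  Cmod z <= r -> Cmod w <= r ->
  r ^ 2 * Cmod (w ^ k - z ^ k - INR k * z ^ pred k * (w - z)) <= INR k ^ 2 * r ^ k * Cmod (w - z) ^ 2.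
Proof.
  intros Hz Hw. assert (Hr : 0 <= r) by (eapply Rle_trans; [apply Cmod_ge_0|exact Hz]).
  set (h := (w - z)%C).
  induction k.
  - simpl. replace (1 - 1 - 0 * 1 * h)%C with (RtoC 0) by ring. rewrite Cmod_0. lra.
  - replace (w ^ S k - z ^ S k - INR (S k) * z ^ pred (S k) * h)%C
      with (w * (w ^ k - z ^ k - INR k * z ^ pred k * h) + INR k * z ^ pred k * (h * h))%C.
    2:{ rewrite S_INR, RtoC_plus. unfold h. destruct k; simpl; ring. }
    apply Rle_trans with (r ^ 2 * (r * Cmod (w ^ k - z ^ k - INR k * z ^ pred k * h)) 
        + INR k * r ^ S k * Cmod h ^ 2).
    + eapply Rle_trans. apply Rmult_le_compat_l. apply pow_le; lra. apply Cmod_triangle.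
      rewrite Rmult_plus_distr_l. apply Rplus_le_compat.
      * apply Rmult_le_compat_l. apply pow_le; lra. rewrite Cmod_mult. 
        apply Rmult_le_compat_r. apply Cmod_ge_0. exact Hw.
      * rewrite !Cmod_mult, Cmod_pow, Cmod_R, Rabs_pos_eq by apply pos_INR.
        destruct k. simpl; lra. simpl pred.
        replace (INR (S k) * r ^ S (S k) * Cmod h ^ 2) with (r ^ 2 * (INR (S k) * r ^ k * (Cmod h * Cmod h)))
          by (simpl; ring).
        apply Rmult_le_compat_l. apply pow_le; lra. 
        apply Rmult_le_compat_r. apply Rmult_le_pos; apply Cmod_ge_0.
        apply Rmult_le_compat_l. apply pos_INR. apply pow_incr. split. apply Cmod_ge_0. exact Hz.
    + assert (Hk := pos_INR k). 
      assert (E : r ^ 2 * (r * Cmod (w ^ k - z ^ k - INR k * z ^ pred k * h)) <= 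
        r * (INR k ^ 2 * r ^ k * Cmod h ^ 2)).
      { replace (r ^ 2 * (r * Cmod (w ^ k - z ^ k - INR k * z ^ pred k * h))) with
         (r * (r ^ 2 * Cmod (w ^ k - z ^ k - INR k * z ^ pred k * h))) by ring.
        apply Rmult_le_compat_l. exact Hr. exact IHk. }
      rewrite S_INR. 
      assert (P : 0 <= r ^ S k * Cmod h ^ 2) by (apply Rmult_le_pos; apply pow_le; [lra|apply Cmod_ge_0]).
      replace (r * (INR k ^ 2 * r ^ k * Cmod h ^ 2)) with (INR k ^ 2 * (r ^ S k * Cmod h ^ 2)) in E by (simpl; ring).
      nra.
Qed.


Lemma ps_taylor_bound a F F' z r : ps a F -> ps (dcoef a) F' -> 0 < r < 1 -> Cmod z <= r ->
  exists K, forall w, Cmod w <= r -> Cmod (F w - F z - F' z * (w - z)) <= K * Cmod (w - z) ^ 2.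
Proof.
  intros HF HF' Hr Hz.
  destruct (pbound_sum _ r (pbound_index _ (pbound_index _ (proj1 HF))) Hr) as [K HK].
  exists (K / r ^ 2). intros w Hw.
  assert (Hr2 : 0 < r ^ 2) by (apply pow_lt; lra).
  apply (tends_Cmod_le (fun n => psum a (S n) w + (-(1)) * psum a (S n) z + (- (w - z)) * psum (dcoef a) n z)%C).
  - replace (F w - F z - F' z * (w - z))%C with (F w + (-(1)) * F z + (- (w - z)) * F' z)%C by ring.
    apply tends_plus. apply tends_plus. 
    + apply (tends_ext_shift (fun n => psum a n w) _ _ 1). intros n; rewrite Nat.add_1_r; reflexivity.
      apply HF. lra.
    + apply tends_scal. 
      apply (tends_ext_shift (fun n => psum a n z) _ _ 1). intros n; rewrite Nat.add_1_r; reflexivity.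
      apply HF. lra.
    + apply tends_scal, HF'. lra.
  - intros n.
    assert (E : forall n, (psum a (S n) w + (-(1)) * psum a (S n) z + (- (w - z)) * psum (dcoef a) n z)%C =
       (psum (fun k => a k * (w ^ k - z ^ k - INR k * z ^ pred k * (w - z)))%C (S n) 1)%C).
    { clear. induction n.
      - simpl. ring.
      - assert (P : forall b m x, psum b (S m) x = (psum b m x + b m * x ^ m)%C) by reflexivity.
        rewrite (P _ (S n) 1%C), <- IHn, Cpow_1_l, (P a (S n) w), (P a (S n) z), (P (dcoef a)).
        unfold dcoef at 2. change (pred (S n)) with n. ring. }
    rewrite E. eapply Rle_trans; [apply psum_Cmod_le|].
    apply Rle_trans with (rsum (fun k => Cmod (w - z) ^ 2 / r ^ 2 * (Cmod (INR k * (INR k * a k)) * r ^ k)) (S n)).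
    + apply rsum_le. intros k. rewrite Cmod_1, pow1, Rmult_1_r.
      rewrite !Cmod_mult, !Cmod_R, !(Rabs_pos_eq (INR k)) by apply pos_INR.
      assert (B := pow_taylor_bound z w r k Hz Hw).
      assert (A := Cmod_ge_0 (a k)).
      apply (Rmult_le_reg_l (r ^ 2)). exact Hr2.
      replace (r ^ 2 * (Cmod (a k) * Cmod (w ^ k - z ^ k - INR k * z ^ pred k * (w - z)))) with
       (Cmod (a k) * (r ^ 2 * Cmod (w ^ k - z ^ k - INR k * z ^ pred k * (w - z)))) by ring.
      eapply Rle_trans. apply Rmult_le_compat_l. exact A. exact B.
      apply Req_le. field. lra.
    + rewrite rsum_scal. 
      replace (K / r ^ 2 * Cmod (w - z) ^ 2) with (Cmod (w - z) ^ 2 / r ^ 2 * K) by (field; lra).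
      apply Rmult_le_compat_l. apply Rmult_le_pos. apply pow_le, Cmod_ge_0. 
      apply Rlt_le, Rinv_0_lt_compat, Hr2. apply HK.
Qed.

Lemma ps_cdiff a F F' z : ps a F -> ps (dcoef a) F' -> Cmod z < 1 -> cdiff F z (F' z).
Proof.
  intros HF HF' Hz. assert (Hz0 := Cmod_ge_0 z).
  set (r := (1 + Cmod z) / 2). assert (Hr : 0 < r < 1) by (unfold r; lra).
  destruct (ps_taylor_bound a F F' z r HF HF' Hr ltac:(unfold r; lra)) as [K HK].
  exists (fun w => if Ceq_dec w z then F' z else ((F w - F z) / (w - z))%C).
  split; [|split].
  - intros P HP. apply locally_Cmod. 
    destruct (Ceq_dec z z) as [_|N] in HP; [|congruence].
    apply locally_Cmod in HP. destruct HP as [d [Hd HP]].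
    assert (K0 := Rabs_pos K).
    exists (Rmin (r - Cmod z) (d / (Rabs K + 1))). split.
    + apply Rmin_pos. unfold r; lra. apply Rdiv_lt_0_compat; lra.
    + intros w Hw. apply HP. destruct (Ceq_dec w z) as [E|E].
      * replace (F' z - F' z)%C with (RtoC 0) by ring. rewrite Cmod_0; exact Hd.
      * assert (E' : (w - z <> 0)%C) by (apply Cminus_eq_contra; exact E).
        assert (P0 := proj1 (Cmod_gt_0 _) E').
        replace ((F w - F z) / (w - z) - F' z)%C with ((F w - F z - F' z * (w - z)) / (w - z))%C by (field; exact E').
        rewrite Cmod_div by exact E'.
        assert (H1 : Cmod w <= r).
        { replace w with (z + (w - z))%C by ring. eapply Rle_trans; [apply Cmod_triangle|].
          assert (Cmod (w - z) < r - Cmod z) by (eapply Rlt_le_trans; [exact Hw|apply Rmin_l]). lra. }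
        assert (H2 : Cmod (w - z) < d / (Rabs K + 1)) by (eapply Rlt_le_trans; [exact Hw|apply Rmin_r]).
        specialize (HK w H1).
        apply Rle_lt_trans with (Rabs K * Cmod (w - z)).
        -- apply (Rmult_le_reg_r (Cmod (w - z))). exact P0.
           unfold Rdiv. rewrite Rmult_assoc, Rinv_l, Rmult_1_r by lra.
           eapply Rle_trans. exact HK. simpl. rewrite Rmult_1_r, <- Rmult_assoc.
           apply Rmult_le_compat_r. lra. apply Rmult_le_compat_r. lra. apply Rle_abs.
        -- apply (Rmult_lt_compat_l (Rabs K + 1)) in H2; [|lra].
           replace ((Rabs K + 1) * (d / (Rabs K + 1))) with d in H2 by (field; lra). lra.
  - destruct (Ceq_dec z z); congruence.
  - apply filter_forall. intros w. change C in w. destruct (Ceq_dec w z) as [E|E].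
    + rewrite E. ring.
    + field. apply Cminus_eq_contra; exact E.
Qed.

(** The second derivative enters only to make the first one continuous. *)
Lemma ps_derivative a F : ps a F ->
  exists F', ps (dcoef a) F' /\ hol 1 F F'.
Proof.
  intros HF. destruct (pbound_ps _ (pbound_dcoef _ (proj1 HF))) as [F' HF'].
  destruct (pbound_ps _ (pbound_dcoef _ (proj1 HF'))) as [F'' HF''].
  exists F'. split; [exact HF'|]. intros z Hz. split.
  - eapply ps_cdiff; eassumption.
  - eapply cdiff_continuous, ps_cdiff; eassumption.
Qed.

Lemma ps_tail a F n : ps a F ->
  exists T, ps (fun k => a (n + k)%nat) T /\
    forall z, Cmod z < 1 -> F z = (psum a n z + z ^ n * T z)%C.
Proof.
  intros HF. destruct (pbound_ps _ (pbound_shift _ n (proj1 HF))) as [T HT].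
  exists T. split; [exact HT|]. intros z Hz.
  apply (tends_unique (fun m => psum a (n + m) z)).
  - apply (tends_ext_shift (fun m => psum a m z) _ _ n). 
    intros m. rewrite Nat.add_comm. reflexivity. apply HF, Hz.
  - apply (tends_ext_shift (fun m => psum a n z + z ^ n * psum (fun k => a (n + k)%nat) m z)%C _ _ 0).
    + intros m. rewrite Nat.add_0_r. induction m.
      * rewrite Nat.add_0_r. simpl. ring.
      * rewrite Nat.add_succ_r. simpl. rewrite <- IHm. rewrite Cpow_add_r. ring.
    + apply tends_plus. apply tends_const. apply tends_scal, HT, Hz.
Qed.

Lemma pbound_lin c a b : pbound a -> pbound b -> pbound (fun k => a k + c * b k)%C.
Proof.
  intros Ha Hb r Hr. destruct (Ha r Hr) as [A HA], (Hb r Hr) as [B HB].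
  exists (A + Cmod c * B). intros k.
  assert (P : 0 <= r ^ k) by (apply pow_le; lra).
  apply Rle_trans with ((Cmod (a k) + Cmod c * Cmod (b k)) * r ^ k).
  - apply Rmult_le_compat_r. exact P. rewrite <- Cmod_mult. apply Cmod_triangle.
  - specialize (HA k). specialize (HB k). assert (Hc := Cmod_ge_0 c).
    assert (Cmod c * (Cmod (b k) * r ^ k) <= Cmod c * B) by (apply Rmult_le_compat_l; assumption).
    lra.
Qed.

Lemma ps_lin c a b F G : ps a F -> ps b G -> ps (fun k => a k + c * b k)%C (fun z => F z + c * G z)%C.
Proof.
  intros [Ha HF] [Hb HG]. split. apply pbound_lin; assumption.
  intros z Hz. apply (tends_ext_shift (fun n => psum a n z + c * psum b n z)%C _ _ 0).
  - intros n. rewrite Nat.add_0_r. induction n; simpl. ring. rewrite <- IHn. ring.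
  - apply tends_plus. apply HF, Hz. apply tends_scal, HG, Hz.
Qed.

Lemma ps_mul_z a F : ps a F ->
  ps (fun k => match k with O => 0%C | S m => a m end) (fun z => z * F z)%C.
Proof.
  intros [Ha HF]. split.
  - intros r Hr. destruct (Ha r Hr) as [B HB]. 
    assert (HB0 : 0 <= B).
    { eapply Rle_trans; [|apply (HB O)]. apply Rmult_le_pos. apply Cmod_ge_0. apply pow_le; lra. }
    exists B. intros [|k]. rewrite Cmod_0. lra.
    simpl. rewrite (Rmult_comm r), <- Rmult_assoc. apply Rle_trans with (B * r).
    apply Rmult_le_compat_r. lra. apply HB. rewrite <- (Rmult_1_r B) at 2. apply Rmult_le_compat_l; lra.
  - intros z Hz. apply (tends_unshift (fun n => z * psum a n z)%C _ _ 1).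
    + intros n. rewrite Nat.add_1_r. induction n. simpl. ring.
      change (psum ?c (S (S n)) z) with (psum c (S n) z + c (S n) * z ^ S n)%C.
      rewrite IHn. simpl. ring.
    + apply tends_scal, HF, Hz.
Qed.

Lemma ps_at_0 a F : ps a F -> F 0%C = a 0%nat.
Proof.
  intros [_ HF]. apply (tends_unique (fun n => psum a n 0%C)).
  - apply HF. rewrite Cmod_0; lra.
  - apply (tends_unshift (fun n => a 0%nat) _ _ 1); [|apply tends_const].
    intros n. rewrite Nat.add_1_r. induction n; simpl. ring. simpl in IHn. rewrite IHn. ring.
Qed.

(** * Coefficient bounds *)

Lemma Cmod_circle (rho t : R) : 0 < rho -> Cmod (rho * cis t) = rho.
Proof. intros H. rewrite Cmod_mult, Cmod_cis, Cmod_R, Rabs_pos_eq; lra. Qed.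

Lemma continuous_circle (rho t : R) : continuous (U := C_UniformSpace) (fun t => rho * cis t)%C t.
Proof. apply continuous_Cmult; [apply continuous_const|apply continuous_cis]. Qed.

Lemma ccont_hol (r rho : R) F F' : hol r F F' -> 0 < rho < r -> ccont (fun t => F (rho * cis t)%C).
Proof.
  intros HF Hr t. apply (continuous_comp (fun t => rho * cis t)%C F). apply continuous_circle.
  eapply hol_continuous. exact HF. rewrite Cmod_circle; lra.
Qed.

Lemma ccont_mult F G : ccont F -> ccont G -> ccont (fun t => F t * G t)%C.
Proof. intros HF HG t. apply continuous_Cmult; [apply HF|apply HG]. Qed.

Lemma ccont_plus F G : ccont F -> ccont G -> ccont (fun t => F t + G t)%C.
Proof. intros HF HG t. apply continuous_Cplus; [apply HF|apply HG]. Qed.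

Lemma ccont_conj F : ccont F -> ccont (fun t => Cconj (F t)).
Proof. intros HF t. apply continuous_Cconj, HF. Qed.

Lemma ccont_const c : ccont (fun _ => c).
Proof. intros t. apply continuous_const. Qed.

Lemma ccont_circle (rho : R) : ccont (fun t => rho * cis t)%C.
Proof. intros t. apply continuous_circle. Qed.

Lemma ccont_pow F n : ccont F -> ccont (fun t => F t ^ n)%C.
Proof. intros HF t. apply continuous_Cpow, HF. Qed.

Lemma rcont_Cmod2 F : ccont F -> rcont (fun t => Cmod (F t) ^ 2).
Proof.
  intros HF t. simpl. repeat apply continuous_Rmult; try apply continuous_Cmod, HF.
  apply continuous_const.
Qed.

Lemma ccont_psum a n (rho : R) : ccont (fun t => psum a n (rho * cis t)%C).
Proof.
  induction n; simpl. apply ccont_const. apply ccont_plus. exact IHn.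
  apply ccont_mult. apply ccont_const. apply ccont_pow, ccont_circle.
Qed.

Lemma circle_pow_conj (rho t : R) k :
  ((rho * cis t) ^ k * Cconj ((rho * cis t) ^ k) = RtoC ((rho ^ 2) ^ k))%C.
Proof.
  rewrite <- Cmod2_conj, Cmod_pow, Cmod_mult, Cmod_cis, Cmod_R, Rmult_1_r.
  f_equal. rewrite <- !pow_mult, Nat.mul_comm, !pow_mult. f_equal. apply pow2_abs.
Qed.

(** For [|z| = rho] and [k <= n], [z ^ n * K z * conj (z ^ k)] is
    [rho ^ (2 k) * z ^ (n - k) * K z], whose mean is its value [0] at the centre. *)
Lemma circle_orthogonal (rho : R) K K' a n m :
  hol 1 K K' -> K 0%C = 0%C -> 0 < rho < 1 -> (m <= S n)%nat ->
  mean (fun t => (rho * cis t) ^ n * K (rho * cis t) * Cconj (psum a m (rho * cis t)))%C = 0%C.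
Proof.
  intros HK H0 Hr. induction m; intros Hm.
  - rewrite (mean_ext _ (fun _ => 0%C)). apply mean_const. 
    intros t; simpl. replace (Cconj 0) with (RtoC 0) by (apply C_ext; unfold Re, Im; simpl; ring). ring.
  - assert (CK : ccont (fun t => K (rho * cis t)%C)) by (eapply ccont_hol; eassumption).
    assert (CP : forall j, ccont (fun t => (rho * cis t) ^ j)%C) by (intros; apply ccont_pow, ccont_circle).
    rewrite (mean_ext _ (fun t => (rho * cis t) ^ n * K (rho * cis t) * Cconj (psum a m (rho * cis t))
       + (Cconj (a m) * RtoC ((rho ^ 2) ^ m)) * ((rho * cis t) ^ (n - m) * K (rho * cis t)))%C).
    + rewrite mean_plus.
      * rewrite IHm by lia. rewrite mean_scal by (apply ccont_mult; auto).
        destruct (hol_pow 1 (n - m)) as [Q HQ].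
        rewrite (mean_value 1 rho (fun w => w ^ (n - m) * K w)%C _ (hol_mult _ _ _ _ _ HQ HK) Hr).
        rewrite H0. ring.
      * apply ccont_mult. apply ccont_mult; auto. apply ccont_conj, ccont_psum.
      * apply ccont_mult. apply ccont_const. apply ccont_mult; auto.
    + intros t. cbn [psum]. rewrite Cplus_conj, Cmult_conj.
      rewrite <- (circle_pow_conj rho t m).
      replace ((rho * cis t) ^ n)%C with ((rho * cis t) ^ (n - m) * (rho * cis t) ^ m)%C.
      ring. rewrite <- Cpow_add_r. f_equal. lia.
Qed.

Lemma Cmod2_plus (P Q : C) :
  Cmod (P + Q) ^ 2 = Cmod P ^ 2 + Cmod Q ^ 2 + 2 * Re (Q * Cconj P).
Proof. rewrite !Cmod2_alt. unfold Re, Im; simpl. ring. Qed.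

Lemma rmean_Cmod2_plus P Q : ccont P -> ccont Q ->
  mean (fun t => Q t * Cconj (P t))%C = 0%C ->
  rmean (fun t => Cmod (P t + Q t) ^ 2) = rmean (fun t => Cmod (P t) ^ 2) + rmean (fun t => Cmod (Q t) ^ 2).
Proof.
  intros HP HQ H.
  assert (CR : rcont (fun t => Re (Q t * Cconj (P t))%C)).
  { apply (ccont_Re (fun t => Q t * Cconj (P t))%C). apply ccont_mult, ccont_conj; assumption. }
  rewrite (rmean_ext _ (fun t => (Cmod (P t) ^ 2 + Cmod (Q t) ^ 2) + 2 * Re (Q t * Cconj (P t))))
    by (intros; apply Cmod2_plus).
  assert (C1 := rcont_Cmod2 _ HP). assert (C2 := rcont_Cmod2 _ HQ).
  rewrite rmean_plus, rmean_plus, rmean_scal; try assumption.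
  - assert (E : rmean (fun t => Re (Q t * Cconj (P t))) = 0) by (exact (f_equal Re H)).
    rewrite E. ring.
  - intros t. apply continuous_Rplus; [apply C1|apply C2].
  - apply rcont_scal, CR.
Qed.

Lemma parseval (rho : R) a n : 0 < rho < 1 ->
  rmean (fun t => Cmod (psum a n (rho * cis t)) ^ 2) = rsum (fun k => Cmod (a k) ^ 2 * (rho ^ 2) ^ k) n.
Proof.
  intros Hr. induction n.
  - simpl. rewrite Cmod_0. rewrite (rmean_ext _ (fun _ => 0)) by (intros; ring). apply rmean_const.
  - change (rsum ?u (S n)) with (rsum u n + u n). cbv beta. rewrite <- IHn. cbn [psum].
    assert (CP : forall j, ccont (fun t => (rho * cis t) ^ j)%C) by (intros; apply ccont_pow, ccont_circle).
    rewrite (rmean_Cmod2_plus (fun t => psum a n (rho * cis t)) (fun t => a n * (rho * cis t) ^ n)%C).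
    + f_equal. rewrite (rmean_ext _ (fun _ => Cmod (a n) ^ 2 * (rho ^ 2) ^ n)). apply rmean_const.
      intros t. rewrite Cmod_mult, Cmod_pow, Cmod_circle by lra. 
      rewrite Rpow_mult_distr. f_equal. rewrite <- !pow_mult. f_equal. lia.
    + apply ccont_psum.
    + apply ccont_mult; [apply ccont_const|auto].
    + destruct n.
      * rewrite (mean_ext _ (fun _ => 0%C)). apply mean_const. 
        intros t; simpl. replace (Cconj 0) with (RtoC 0) by (apply C_ext; unfold Re, Im; simpl; ring). ring.
      * rewrite (mean_ext _ (fun t => a (S n) * ((rho * cis t) ^ n * (rho * cis t) * Cconj (psum a (S n) (rho * cis t))))%C)
          by (intros; simpl; ring).
        rewrite mean_scal.
        rewrite (circle_orthogonal rho (fun w => w) (fun _ => 1%C)); try assumption; try reflexivity.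
        ring. apply hol_id.
        apply ccont_mult. apply ccont_mult; [auto|apply ccont_circle]. apply ccont_conj, ccont_psum.
Qed.

(** Clunie's method.  With [w = G / H], the polynomial [w * H_n] has the same
    first coefficients as [G] because [w 0 = 0]; so Bessel's inequality and
    [|w| <= 1] compare the coefficients of [G] up to [n] with those of [H] below [n]. *)
Lemma clunie g h G H (rho : R) n :
  ps g G -> ps h H -> G 0%C = 0%C -> (forall z, Cmod z < 1 -> Cmod (G z) < Cmod (H z)) ->
  0 < rho < 1 ->
  rsum (fun k => Cmod (g k) ^ 2 * (rho ^ 2) ^ k) (S n) <= rsum (fun k => Cmod (h k) ^ 2 * (rho ^ 2) ^ k) n.
Proof.
  intros HG HH G0 Hlt Hr.
  assert (Hnz : forall z, Cmod z < 1 -> H z <> 0%C).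
  { intros z Hz E. specialize (Hlt z Hz). rewrite E, Cmod_0 in Hlt. generalize (Cmod_ge_0 (G z)); lra. }
  destruct (ps_derivative _ _ HG) as [G' [_ HG']]. destruct (ps_derivative _ _ HH) as [H' [_ HH']].
  destruct (ps_tail _ _ (S n) HG) as [S [HS ES]]. destruct (ps_tail _ _ n HH) as [T [HT ET]].
  destruct (ps_derivative _ _ HS) as [S' [_ HS']]. destruct (ps_derivative _ _ HT) as [T' [_ HT']].
  set (w := fun z => (G z * / H z)%C).
  assert (Hw := hol_mult _ _ _ _ _ HG' (hol_inv _ _ _ HH' Hnz)). fold w in Hw.
  set (K := fun z => (z * S z + (-(1)) * (w z * T z))%C).
  assert (HK := hol_plus _ _ _ _ _ (hol_mult _ _ _ _ _ (hol_id 1) HS')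
     (hol_mult _ _ _ _ _ (hol_const 1 (-(1))%C) (hol_mult _ _ _ _ _ Hw HT'))). fold K in HK.
  assert (K0 : K 0%C = 0%C) by (unfold K, w; rewrite G0; ring).
  rewrite <- (parseval rho g _ Hr), <- (parseval rho h _ Hr).
  set (Q := fun t => ((rho * cis t) ^ n * K (rho * cis t))%C).
  assert (CK : ccont Q).
  { apply ccont_mult. apply ccont_pow, ccont_circle. eapply ccont_hol; eassumption. }
  apply Rle_trans with (rmean (fun t => Cmod (psum g (Datatypes.S n) (rho * cis t) + Q t) ^ 2)).
  - rewrite rmean_Cmod2_plus.
    + rewrite <- (Rplus_0_r (rmean (fun t => Cmod (psum g (Datatypes.S n) (rho * cis t)) ^ 2))) at 1.
      apply Rplus_le_compat_l. rewrite <- (rmean_const 0). apply rmean_le.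
      intros t; apply continuous_const. apply rcont_Cmod2, CK. intros t. apply pow2_ge_0.
    + apply ccont_psum.
    + exact CK.
    + apply (circle_orthogonal rho K _ g n _ HK K0 Hr). lia.
  - apply rmean_le.
    + apply rcont_Cmod2. apply ccont_plus. apply ccont_psum. exact CK.
    + apply rcont_Cmod2, ccont_psum.
    + intros t. assert (Hz : Cmod (rho * cis t) < 1) by (rewrite Cmod_circle; lra).
      unfold Q. set (z := (rho * cis t)%C) in *.
      replace (psum g (Datatypes.S n) z + z ^ n * K z)%C with (w z * psum h n z)%C.
      * rewrite Cmod_mult, Rpow_mult_distr. 
        assert (Cmod (w z) <= 1).
        { unfold w. rewrite Cmod_mult, Cmod_inv by (apply Hnz, Hz).
          assert (P := proj1 (Cmod_gt_0 _) (Hnz z Hz)). specialize (Hlt z Hz).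
          apply (Rmult_le_reg_r (Cmod (H z))). exact P. rewrite Rmult_assoc, Rinv_l by lra. lra. }
        assert (A := Cmod_ge_0 (w z)). assert (B := pow2_ge_0 (Cmod (psum h n z))).
        rewrite <- (Rmult_1_l (Cmod (psum h n z) ^ 2)) at 2. apply Rmult_le_compat_r. exact B.
        simpl. nra.
      * replace (psum h n z) with (H z - z ^ n * T z)%C by (rewrite (ET z Hz); ring).
        transitivity (w z * H z - z ^ n * (w z * T z))%C. ring.
        replace (w z * H z)%C with (G z) by (unfold w; field; apply Hnz, Hz).
        rewrite (ES z Hz). unfold K. rewrite Cpow_S. ring.
Qed.

(** For [h] with coefficients [(k - alpha) (k+1) a_(k+1)] and [g] with
    coefficients [k (k+1) a_(k+1)], all terms of the difference but the one of
    index [0] have the favourable sign, since [(k - alpha)^2 <= k^2] for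
    [k >= 1 >= alpha]. *)
Lemma coefficient_bound (alpha : R) (a : nat -> C) (f1 f2 : C -> C) n :
  0 < alpha <= 1 -> a 1%nat = 1%C -> ps (dcoef a) f1 -> ps (dcoef (dcoef a)) f2 ->
  (forall z, Cmod z < 1 -> Cmod (z * f2 z) < Cmod (z * f2 z + (- alpha) * f1 z)%C) ->
  INR n * INR (S n) * Cmod (a (S n)) <= alpha.
Proof.
  intros Ha a1 H1 H2 Hlt.
  set (g := fun k => match k with O => RtoC 0 | S m => dcoef (dcoef a) m end).
  assert (Hg : ps g (fun z => z * f2 z)%C) by (apply ps_mul_z, H2).
  set (h := fun k => (g k + (- alpha) * dcoef a k)%C).
  assert (Hh : ps h (fun z => z * f2 z + (- alpha) * f1 z)%C) by (apply ps_lin; assumption).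
  assert (Eg : forall k, g k = (INR k * INR (S k) * a (S k))%C).
  { intros [|k]; unfold g, dcoef. simpl. ring. ring. }
  assert (Eh : forall k, h k = (RtoC (INR k - alpha) * INR (S k) * a (S k))%C).
  { intros k. unfold h. rewrite Eg. unfold dcoef. rewrite RtoC_minus. ring. }
  assert (Mg : forall k, Cmod (g k) = INR k * INR (S k) * Cmod (a (S k))).
  { intros k. rewrite Eg, !Cmod_mult, !Cmod_R, !Rabs_pos_eq by apply pos_INR. reflexivity. }
  destruct n as [|n]. { simpl. lra. }
  assert (K : forall rho, 0 < rho < 1 -> Cmod (g (S n)) ^ 2 * (rho ^ 2) ^ S n <= alpha ^ 2).
  { intros rho Hr.
    assert (C := clunie g h _ _ rho (S n) Hg Hh ltac:(cbv beta; ring) Hlt Hr).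
    assert (D : rsum (fun k => Cmod (h k) ^ 2 * (rho ^ 2) ^ k) (S n) <=
                alpha ^ 2 + rsum (fun k => Cmod (g k) ^ 2 * (rho ^ 2) ^ k) (S n)).
    { clear C. induction n.
      - cbn [rsum pow]. rewrite Mg, Eh, a1. rewrite !Cmod_mult, !Cmod_R, Rabs_R1.
        rewrite (Rabs_pos_eq (INR 1)) by apply pos_INR.
        replace (INR 0 - alpha) with (- alpha) by (simpl; ring). rewrite Rabs_Ropp, Rabs_pos_eq by lra.
        simpl. lra.
      - change (rsum ?u (S (S n))) with (rsum u (S n) + u (S n)). cbv beta.
        assert (Cmod (h (S n)) ^ 2 * (rho ^ 2) ^ S n <= Cmod (g (S n)) ^ 2 * (rho ^ 2) ^ S n).
        { apply Rmult_le_compat_r. apply pow_le, pow2_ge_0.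
          rewrite Mg, Eh, !Cmod_mult, !Cmod_R. rewrite (Rabs_pos_eq (INR (S (S n)))) by apply pos_INR.
          rewrite !Rpow_mult_distr. apply Rmult_le_compat_r. apply pow2_ge_0.
          apply Rmult_le_compat_r. apply pow2_ge_0. rewrite pow2_abs.
          rewrite S_INR. assert (Hn := pos_INR n). nra. }
        lra. }
    change (rsum ?u (S (S n))) with (rsum u (S n) + u (S n)) in C. cbv beta in C. lra. }
  rewrite <- Mg. apply Rnot_lt_le. intros L.
  set (M := Cmod (g (S n))) in *. assert (HM : 0 < M) by lra.
  (* if [M > alpha], then [rho ^ n > alpha / M] for [rho] close to [1] *)
  assert (Hq : 0 < alpha / M < 1).
  { split. apply Rdiv_lt_0_compat; lra. apply (Rmult_lt_reg_r M). lra. unfold Rdiv.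
    rewrite Rmult_assoc, Rinv_l by lra. lra. }
  assert (Hc : continuity_pt (fun r => r ^ S n) 1) by (apply derivable_continuous_pt, derivable_pt_pow).
  destruct (Hc (1 - alpha / M) ltac:(lra)) as [d [Hd Hd']].
  set (r := 1 - Rmin (d / 2) (1 / 2)).
  assert (Hm : 0 < Rmin (d / 2) (1 / 2)) by (apply Rmin_pos; lra).
  assert (Hm1 : Rmin (d / 2) (1 / 2) <= 1 / 2) by apply Rmin_r.
  assert (Hm2 : Rmin (d / 2) (1 / 2) <= d / 2) by apply Rmin_l.
  assert (Hr : 0 < r < 1) by (unfold r; lra).
  assert (X : Rabs (r ^ S n - 1 ^ S n) < 1 - alpha / M).
  { apply Hd'. split. split. exact I. lra. simpl. unfold Rdist. unfold r.
    rewrite Rabs_left by lra. lra. }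
  rewrite pow1 in X. apply Rabs_def2 in X. 
  assert (Y : alpha / M < r ^ S n) by lra. specialize (K r Hr).
  rewrite <- pow_mult, Nat.mul_comm, pow_mult, <- Rpow_mult_distr in K.
  assert (Z : alpha < M * r ^ S n).
  { apply (Rmult_lt_compat_l M) in Y; [|lra]. replace (M * (alpha / M)) with alpha in Y by (field; lra). exact Y. }
  set (x := M * r ^ S n) in *. simpl in K. nra.
Qed.

(** * Logarithm and exponential *)

Definition cexp (w : C) : C := (exp (Re w) * cos (Im w), exp (Re w) * sin (Im w)).
Definition clog (w : C) : C := (ln (Re w ^ 2 + Im w ^ 2) / 2, atan (Im w / Re w)).

Lemma cexp_plus u v : cexp (u + v) = (cexp u * cexp v)%C.
Proof.
  apply C_ext; unfold cexp, Re, Im; simpl; rewrite exp_plus, ?cos_plus, ?sin_plus; ring.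
Qed.

Lemma cexp_0 : cexp 0 = 1%C.
Proof. apply C_ext; unfold cexp, Re, Im; simpl; rewrite exp_0, ?cos_0, ?sin_0; ring. Qed.

Lemma cexp_opp u : (cexp u * cexp (- u) = 1)%C.
Proof. rewrite <- cexp_plus. replace (u + - u)%C with (RtoC 0) by ring. apply cexp_0. Qed.

Lemma cexp_neq_0 u : cexp u <> 0%C.
Proof. intros E. generalize (cexp_opp u). rewrite E, Cmult_0_l. intros H. apply C1_nz. symmetry; exact H. Qed.

Lemma is_derive_exp_cos (u v : R -> R) t du dv : is_derive u t du -> is_derive v t dv ->
  is_derive (fun s => exp (u s) * cos (v s)) t (exp (u t) * (cos (v t) * du - sin (v t) * dv)).
Proof.
  intros H1 H2. evar_last. apply is_derive_Rmult.
  apply (is_derive_comp exp u). apply is_derive_exp. exact H1.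
  apply (is_derive_comp cos v). apply is_derive_cos. exact H2.
  unfold scal; simpl; unfold mult; simpl. ring.
Qed.

Lemma is_derive_exp_sin (u v : R -> R) t du dv : is_derive u t du -> is_derive v t dv ->
  is_derive (fun s => exp (u s) * sin (v s)) t (exp (u t) * (cos (v t) * dv + sin (v t) * du)).
Proof.
  intros H1 H2. evar_last. apply is_derive_Rmult.
  apply (is_derive_comp exp u). apply is_derive_exp. exact H1.
  apply (is_derive_comp sin v). apply is_derive_sin. exact H2.
  unfold scal; simpl; unfold mult; simpl. ring.
Qed.

Lemma cder_cexp g t d : cder g t d -> cder (fun s => cexp (g s)) t (cexp (g t) * d)%C.
Proof.
  intros [H1 H2]. split.
  - replace (Re (cexp (g t) * d)) with
      (exp (Re (g t)) * (cos (Im (g t)) * Re d - sin (Im (g t)) * Im d))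
      by (unfold cexp, Re, Im; simpl; ring).
    exact (is_derive_exp_cos _ _ _ _ _ H1 H2).
  - replace (Im (cexp (g t) * d)) with
      (exp (Re (g t)) * (cos (Im (g t)) * Im d + sin (Im (g t)) * Re d))
      by (unfold cexp, Re, Im; simpl; ring).
    exact (is_derive_exp_sin _ _ _ _ _ H1 H2).
Qed.

Lemma cexp_clog w : 0 < Re w -> cexp (clog w) = w.
Proof.
  intros H. unfold cexp, clog; simpl.
  assert (P : 0 < Re w ^ 2 + Im w ^ 2) by nra.
  assert (E : exp (ln (Re w ^ 2 + Im w ^ 2) / 2) = Re w * sqrt (1 + (Im w / Re w)²)).
  { replace (Re w ^ 2 + Im w ^ 2) with ((Re w * sqrt (1 + (Im w / Re w)²)) * (Re w * sqrt (1 + (Im w / Re w)²))).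
    - assert (Q : 0 < Re w * sqrt (1 + (Im w / Re w)²)).
      { apply Rmult_lt_0_compat. exact H. apply sqrt_lt_R0. generalize (Rle_0_sqr (Im w / Re w)); lra. }
      rewrite ln_mult by assumption. replace ((ln _ + ln _) / 2) with (ln (Re w * sqrt (1 + (Im w / Re w)²))) by field.
      apply exp_ln, Q.
    - replace (Re w * sqrt (1 + (Im w / Re w)²) * (Re w * sqrt (1 + (Im w / Re w)²))) with
        (Re w * Re w * (sqrt (1 + (Im w / Re w)²) * sqrt (1 + (Im w / Re w)²))) by ring.
      rewrite sqrt_sqrt by (generalize (Rle_0_sqr (Im w / Re w)); lra).
      unfold Rsqr. field. lra. }
  assert (S : sqrt (1 + (Im w / Re w)²) <> 0).
  { apply Rgt_not_eq, sqrt_lt_R0. generalize (Rle_0_sqr (Im w / Re w)); lra. }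
  apply C_ext; unfold Re at 1, Im at 1; cbn [fst snd].
  - change (exp (ln (Re w ^ 2 + Im w ^ 2) / 2) * cos (atan (Im w / Re w)) = Re w).
    rewrite E, cos_atan. field. exact S.
  - change (exp (ln (Re w ^ 2 + Im w ^ 2) / 2) * sin (atan (Im w / Re w)) = Im w).
    rewrite E, sin_atan. field. split; [lra|exact S].
Qed.

Lemma clog_Im_bound w : - PI / 2 < Im (clog w) < PI / 2.
Proof. unfold clog; simpl. generalize (atan_bound (Im w / Re w)). lra. Qed.

Lemma clog_1 : clog 1 = 0%C.
Proof.
  unfold clog. apply C_ext; simpl; unfold Re, Im; simpl.
  - replace (1 * (1 * 1) + 0 * (0 * 1)) with 1 by ring. rewrite ln_1. field.
  - replace (0 / 1) with 0 by field. apply atan_0.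
Qed.

Lemma continuous_clog {U : UniformSpace} (g : U -> C) x :
  continuous (U := C_UniformSpace) g x -> 0 < Re (g x) ->
  continuous (U := C_UniformSpace) (fun u => clog (g u)) x.
Proof.
  intros Hg H. assert (H1 := continuous_Re _ _ Hg). assert (H2 := continuous_Im _ _ Hg).
  assert (P : 0 < Re (g x) ^ 2 + Im (g x) ^ 2) by nra.
  apply continuous_C; unfold clog; simpl.
  - unfold Rdiv. apply continuous_Rmult; [|apply continuous_const].
    apply (continuous_comp (fun u => Re (g u) * (Re (g u) * 1) + Im (g u) * (Im (g u) * 1)) ln).
    + repeat (apply continuous_Rplus || apply continuous_Rmult); try assumption; apply continuous_const.
    + apply (is_derive_continuous ln _ (/ (Re (g x) * (Re (g x) * 1) + Im (g x) * (Im (g x) * 1)))).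
      apply is_derive_Reals. apply derivable_pt_lim_ln. exact P.
  - apply (continuous_comp (fun u => Im (g u) / Re (g u)) atan).
    + unfold Rdiv. apply continuous_Rmult; [assumption|]. apply (continuous_Rinv_comp (fun u => Re (g u))). assumption. lra.
    + eapply is_derive_continuous. apply is_derive_Reals, derivable_pt_lim_atan.
Qed.

Lemma cder_clog_ray (z : C) (s : R) : 0 < Re (1 - s * z) ->
  cder (fun u => clog (1 - RtoC u * z)) s (- (z / (1 - s * z)))%C.
Proof.
  intros H. destruct z as [a b].
  assert (H' : 0 < 1 - s * a) by (unfold Re in H; simpl in H; lra). clear H.
  assert (P : 0 < (1 - s * a) ^ 2 + (s * b) ^ 2) by nra.
  assert (E : forall u : R, (1 - u * (a, b))%C = ((1 - u * a)%R, (- (u * b))%R))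
    by (intros u; apply C_ext; unfold Re, Im; simpl; ring).
  assert (D1 : is_derive (fun u => ln ((1 - u * a) ^ 2 + (u * b) ^ 2) / 2) s
     ((- a * (1 - s * a) + s * b * b) / ((1 - s * a) ^ 2 + (s * b) ^ 2))).
  { simpl in P. auto_derive. lra. field. repeat split; lra. }
  assert (D2 : is_derive (fun u => atan (- (u * b) / (1 - u * a))) s
     (- b / ((1 - s * a) ^ 2 + (s * b) ^ 2))).
  { simpl in P. auto_derive. lra. field. repeat split; try lra. }
  split.
  - replace (Re (- ((a, b) / (1 - s * (a, b))))%C) with
      ((- a * (1 - s * a) + s * b * b) / ((1 - s * a) ^ 2 + (s * b) ^ 2)).
    + apply is_derive_ext with (2 := D1). intros u. rewrite E. unfold clog, Re, Im; simpl.
      f_equal. f_equal. ring.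
    + rewrite E. unfold Re, Im; simpl. field. simpl in P; lra.
  - replace (Im (- ((a, b) / (1 - s * (a, b))))%C) with (- b / ((1 - s * a) ^ 2 + (s * b) ^ 2)).
    + apply is_derive_ext with (2 := D2). intros u. rewrite E. reflexivity.
    + rewrite E. unfold Re, Im; simpl. field. simpl in P; lra.
Qed.

(** * An averaging inequality *)

(** Concavity of [ln o cos]: its derivative is [- tan], which decreases. *)
Lemma ln_cos_tangent v v0 :
  - PI / 2 < v < PI / 2 -> - PI / 2 < v0 < PI / 2 ->
  ln (cos v) <= ln (cos v0) - tan v0 * (v - v0).
Proof.
  intros Hv Hv0.
  assert (C : forall x, - PI / 2 < x < PI / 2 -> 0 < cos x).
  { intros x Hx. apply cos_gt_0; lra. }
  set (h := fun x => ln (cos x) + tan v0 * (x - v0)).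
  assert (D : forall x, - PI / 2 < x < PI / 2 -> is_derive h x (tan v0 - tan x)).
  { intros x Hx. assert (Cx := C x Hx). assert (C0 := C v0 Hv0).
    unfold h. auto_derive. exact Cx. unfold tan. field. lra. }
  assert (T : forall x y, - PI / 2 < x -> x <= y -> y < PI / 2 -> tan x <= tan y).
  { intros x y Hx Hxy Hy. destruct (Req_dec x y) as [E|E]. rewrite E; lra.
    apply Rlt_le, tan_increasing; lra. }
  assert (G : h v <= h v0).
  { destruct (Rle_dec v v0) as [L|L].
    - apply (increasing_of_derive_nonneg h (fun x => tan v0 - tan x)). exact L.
      intros; apply D; lra. intros x Hx. assert (tan x <= tan v0) by (apply T; lra). lra.
    - assert (K : - h v0 <= - h v).
      { apply (increasing_of_derive_nonneg (fun x => - h x) (fun x => - (tan v0 - tan x))). lra.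
        intros. apply @is_derive_opp. apply D; lra. 
        intros x Hx. assert (tan v0 <= tan x) by (apply T; lra). lra. }
      lra. }
  unfold h in G. replace (v0 - v0) with 0 in G by ring. lra.
Qed.

Lemma mean_real_mult mu L : 
  mean (fun t => RtoC (mu t) * L t)%C = (rmean (fun t => mu t * Re (L t)), rmean (fun t => mu t * Im (L t))).
Proof. apply C_ext; simpl; apply rmean_ext; intros; unfold Re, Im; simpl; ring. Qed.

(** The set [{e^u cos v >= c, |v| < pi/2}] is convex in [(u, v)], and
    contains [alpha * (u, v)] with [c^alpha] in place of [c] as [-ln o cos] is
    convex and vanishes at [0]. *)
Lemma exp_cos_mean (alpha c : R) (mu : R -> R) (L : R -> C) :
  0 < alpha <= 1 -> 0 < c -> rcont mu -> (forall t, 0 < mu t) -> rmean mu = 1 -> ccont L ->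
  (forall t, - PI / 2 < Im (L t) < PI / 2) ->
  (forall t, c <= exp (Re (L t)) * cos (Im (L t))) ->
  Rpower c alpha <= Re (cexp (alpha * mean (fun t => RtoC (mu t) * L t))%C).
Proof.
  intros Ha Hc Cmu Pmu Emu CL HI HR. rewrite mean_real_mult.
  assert (CRe : rcont (fun t => mu t * Re (L t))).
  { intros t. apply continuous_Rmult. apply Cmu. apply (ccont_Re _ CL). }
  assert (CIm : rcont (fun t => mu t * Im (L t))).
  { intros t. apply continuous_Rmult. apply Cmu. apply (ccont_Im _ CL). }
  set (U := rmean (fun t => mu t * Re (L t))). set (V := rmean (fun t => mu t * Im (L t))).
  assert (HV1 : V < PI / 2).
  { assert (0 < rmean (fun t => mu t * (PI / 2) + -1 * (mu t * Im (L t)))).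
    { apply rmean_gt_0.
      - intros t. apply continuous_Rplus. apply continuous_Rmult. apply Cmu. apply continuous_const.
        apply continuous_Rmult. apply continuous_const. apply CIm.
      - intros t. specialize (HI t). specialize (Pmu t). 
        replace (mu t * (PI / 2) + -1 * (mu t * Im (L t))) with (mu t * (PI / 2 - Im (L t))) by ring.
        apply Rmult_lt_0_compat; lra. }
    rewrite rmean_plus, rmean_scal, (rmean_ext _ (fun t => PI / 2 * mu t)), rmean_scal, Emu in H; try assumption.
    unfold V; lra. intros; ring.
    intros t. apply continuous_Rmult. apply Cmu. apply continuous_const.
    apply rcont_scal, CIm. }
  assert (HV2 : - PI / 2 < V).
  { assert (0 < rmean (fun t => mu t * (PI / 2) + 1 * (mu t * Im (L t)))).
    { apply rmean_gt_0.
      - intros t. apply continuous_Rplus. apply continuous_Rmult. apply Cmu. apply continuous_const.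
        apply continuous_Rmult. apply continuous_const. apply CIm.
      - intros t. specialize (HI t). specialize (Pmu t). 
        replace (mu t * (PI / 2) + 1 * (mu t * Im (L t))) with (mu t * (PI / 2 + Im (L t))) by ring.
        apply Rmult_lt_0_compat; lra. }
    rewrite rmean_plus, rmean_scal, (rmean_ext _ (fun t => PI / 2 * mu t)), rmean_scal, Emu in H; try assumption.
    unfold V; lra. intros; ring.
    intros t. apply continuous_Rmult. apply Cmu. apply continuous_const.
    apply rcont_scal, CIm. }
  set (v0 := alpha * V). generalize PI_RGT_0; intros HPI.
  assert (Hv0 : - PI / 2 < v0 < PI / 2) by (unfold v0; nra).
  assert (Cv0 : 0 < cos v0) by (apply cos_gt_0; lra).
  (* the supporting line at [v0], averaged, and evaluated at [0] *)
  assert (A : ln c - ln (cos v0) + tan v0 * (V - v0) <= U).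
  { set (k := ln c - ln (cos v0) - tan v0 * v0).
    assert (B : rmean (fun t => k * mu t + tan v0 * (mu t * Im (L t))) <= U).
    { apply rmean_le.
      - intros t. apply continuous_Rplus; apply continuous_Rmult; try apply continuous_const. apply Cmu. apply CIm.
      - exact CRe.
      - intros t. specialize (HI t). specialize (HR t). specialize (Pmu t).
        assert (Cc : 0 < cos (Im (L t))) by (apply cos_gt_0; lra).
        assert (T := ln_cos_tangent _ _ HI Hv0).
        assert (Q : ln c <= Re (L t) + ln (cos (Im (L t)))).
        { rewrite <- (ln_exp (Re (L t))), <- ln_mult by (try apply exp_pos; assumption).
          destruct (Req_dec c (exp (Re (L t)) * cos (Im (L t)))) as [E|E]. rewrite <- E; lra.
          apply Rlt_le, ln_increasing; lra. }
        replace (k * mu t + tan v0 * (mu t * Im (L t))) with (mu t * (k + tan v0 * Im (L t))) by ring.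
        apply Rmult_le_compat_l. lra. unfold k. lra. }
    rewrite rmean_plus, rmean_scal, rmean_scal, Emu in B; try assumption; try (apply rcont_scal; assumption).
    fold V in B. unfold k in B. lra. }
  assert (B : 0 <= ln (cos v0) + tan v0 * v0).
  { assert (T := ln_cos_tangent 0 v0 ltac:(lra) Hv0). rewrite cos_0, ln_1 in T. lra. }
  replace (Re (cexp (alpha * (U, V))%C)) with (exp (alpha * U) * cos v0).
  2:{ unfold cexp, Re, Im; simpl. unfold v0. f_equal; f_equal; ring. }
  rewrite <- (exp_ln (cos v0)) by exact Cv0. rewrite <- exp_plus. unfold Rpower.
  assert (G : alpha * ln c <= alpha * U + ln (cos v0)).
  { assert (alpha * (ln c - ln (cos v0) + tan v0 * (V - v0)) <= alpha * U) by (apply Rmult_le_compat_l; lra).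
    assert (0 <= (1 - alpha) * (ln (cos v0) + tan v0 * v0)) by (apply Rmult_le_pos; lra).
    unfold v0 in *. nra. }
  destruct G as [G|G]; [apply Rlt_le, exp_increasing, G|rewrite G; lra].
Qed.

(** * Representation of [f'] *)

Lemma cis_conj_inv t : Cconj (cis t) = (/ cis t)%C.
Proof.
  generalize (cis_conj t); intros Q. rewrite <- (Cmult_1_r (/ cis t)), <- Q. field. apply cis_neq_0.
Qed.

Lemma Cconj_RtoC (x : R) : Cconj x = x.
Proof. apply C_ext; unfold Re, Im; simpl; ring. Qed.

Section Kernel.

Variables (z0 : C) (rho : R).
Hypothesis Hrho : Cmod z0 < rho < 1.

Definition zeta (t : R) : C := (z0 / (rho * cis t))%C.

Lemma rho_pos : 0 < rho.
Proof. generalize (Cmod_ge_0 z0); lra. Qed.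

Lemma RtoC_neq_0 (x : R) : x <> 0 -> RtoC x <> 0%C.
Proof. intros H E. apply RtoC_inj in E. auto. Qed.

Lemma circle_neq_0 t : (rho * cis t <> 0)%C.
Proof. apply Cmult_neq_0. apply RtoC_neq_0. generalize rho_pos; lra. apply cis_neq_0. Qed.

Lemma Cmod_zeta t : Cmod (zeta t) = Cmod z0 / rho.
Proof.
  unfold zeta. rewrite Cmod_div by apply circle_neq_0. rewrite Cmod_circle by exact rho_pos. reflexivity.
Qed.

Lemma zeta_ratio : 0 <= Cmod z0 / rho < 1.
Proof.
  generalize rho_pos (Cmod_ge_0 z0); intros A B. split.
  apply Rmult_le_pos. exact B. apply Rlt_le, Rinv_0_lt_compat, A.
  apply (Rmult_lt_reg_r rho). exact A. unfold Rdiv; rewrite Rmult_assoc, Rinv_l by lra. lra.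
Qed.

Lemma ccont_zeta : ccont zeta.
Proof.
  intros t. unfold zeta, Cdiv. apply continuous_Cmult. apply continuous_const.
  apply continuous_Cinv. apply continuous_circle. apply circle_neq_0.
Qed.

Lemma Cmod_s_zeta (s : R) t : Rabs s * Cmod z0 < rho -> Cmod (s * zeta t) < 1.
Proof.
  intros Hs. rewrite Cmod_mult, Cmod_R, Cmod_zeta. generalize rho_pos; intros P.
  apply (Rmult_lt_reg_r rho). exact P. unfold Rdiv. rewrite !Rmult_assoc, Rinv_l by lra. lra.
Qed.

(** This is minus the derivative in [s] of [clog (1 - s * zeta t)]. *)
Definition kernel (s t : R) : C := (zeta t * / (1 - s * zeta t))%C.

Lemma kernel_den (s t : R) : Rabs s * Cmod z0 < rho -> (1 - s * zeta t <> 0)%C.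
Proof. intros Hs. apply one_minus_neq_0, Cmod_s_zeta, Hs. Qed.

Lemma ccont_kernel (s : R) : Rabs s * Cmod z0 < rho -> ccont (kernel s).
Proof.
  intros Hs t. apply continuous_Cmult. apply ccont_zeta. apply continuous_Cinv; [|apply kernel_den, Hs].
  apply continuous_Cminus. apply continuous_const. apply continuous_Cmult. apply continuous_const. apply ccont_zeta.
Qed.

(** On the circle, [zeta] is the conjugate of [conj z0 * y / rho ^ 2] with
    [y = rho * cis t]; so the integrand is the conjugate of the boundary values of
    a function that is holomorphic in a larger disk and vanishes at [0]. *)
Lemma mean_conj_kernel (s : R) (Q Q' : C -> C) :
  Rabs s * Cmod z0 < rho -> hol 1 Q Q' ->
  mean (fun t => Cconj (Q (rho * cis t)) * kernel s t)%C = 0%C.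
Proof.
  intros Hs HQ. generalize rho_pos (Cmod_ge_0 z0) (Rabs_pos s); intros P Pz Ps.
  set (m := Rabs s * Cmod z0) in *. assert (Hm : 0 <= m) by (apply Rmult_le_pos; lra).
  set (c := (Cconj z0 / rho ^ 2)%C).
  set (r := Rmin 1 (2 * rho ^ 2 / (rho + m))).
  assert (Er : 2 * rho ^ 2 / (rho + m) * (rho + m) = 2 * rho ^ 2) by (field; lra).
  assert (Hr1 : rho < r).
  { apply Rmin_glb_lt. lra. apply (Rmult_lt_reg_r (rho + m)). lra. rewrite Er. nra. }
  assert (HrR : RtoC rho <> 0%C) by (apply RtoC_neq_0; lra).
  assert (Hc : forall z, Cmod z < r -> Cmod (s * c * z) < 1).
  { intros z Hz. unfold c. rewrite !Cmod_mult, Cmod_div by (apply Cpow_nz, HrR).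
    rewrite Cmod_conj, Cmod_pow, !Cmod_R, (Rabs_pos_eq rho) by lra.
    replace (Rabs s * (Cmod z0 / rho ^ 2) * Cmod z) with (m * Cmod z / rho ^ 2) by (unfold m; field; lra).
    assert (Hq : 0 < rho ^ 2) by (apply pow_lt; lra).
    apply (Rmult_lt_reg_r (rho ^ 2)). exact Hq.
    replace (m * Cmod z / rho ^ 2 * rho ^ 2) with (m * Cmod z) by (field; lra).
    rewrite Rmult_1_l. apply Rle_lt_trans with (m * (2 * rho ^ 2 / (rho + m))).
    - apply Rmult_le_compat_l. exact Hm. apply Rlt_le. eapply Rlt_le_trans. exact Hz. apply Rmin_r.
    - apply (Rmult_lt_reg_r (rho + m)). lra. rewrite Rmult_assoc, Er. nra. }
  destruct (hol_geom r (s * c)%C Hc) as [G' HG].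
  assert (HQr : hol r Q Q') by (apply (hol_sub 1); [apply Rmin_l|exact HQ]).
  assert (HK := hol_mult _ _ _ _ _ HQr (hol_mult _ _ _ _ _ (hol_mult _ _ _ _ _ (hol_const r c) (hol_id r)) HG)).
  assert (M := mean_value r rho _ _ HK (conj P Hr1)). cbv beta in M.
  rewrite (mean_ext _ (fun t => Cconj (Q (rho * cis t) * (c * (rho * cis t) * / (1 - s * c * (rho * cis t)))))%C).
  - rewrite mean_conj, M.
    + replace (Q 0 * (c * 0 * / (1 - s * c * 0)))%C with (RtoC 0) by ring. apply Cconj_RtoC.
    + apply (ccont_hol r rho _ _ HK). lra.
  - intros t. rewrite Cmult_conj. f_equal. unfold kernel.
    assert (E : Cconj (c * (rho * cis t)) = zeta t).
    { unfold c, zeta. rewrite !Cmult_conj, Cdiv_conj by (apply Cpow_nz, HrR).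
      rewrite Cconj_conj, cis_conj_inv, Cpow_conj, !Cconj_RtoC. field. split; [apply cis_neq_0|exact HrR]. }
    assert (D : (1 - s * c * (rho * cis t) <> 0)%C).
    { apply one_minus_neq_0, Hc. rewrite Cmod_circle by exact P. exact Hr1. }
    rewrite Cmult_conj, Cinv_conj, E by exact D.
    f_equal. f_equal. rewrite Cminus_conj, Cconj_RtoC. f_equal.
    replace (s * c * (rho * cis t))%C with (s * (c * (rho * cis t)))%C by ring.
    rewrite Cmult_conj, E, Cconj_RtoC. reflexivity.
Qed.

Lemma mean_kernel (s : R) : Rabs s * Cmod z0 < rho -> mean (kernel s) = 0%C.
Proof.
  intros Hs. rewrite <- (mean_conj_kernel s _ _ Hs (hol_const 1 1%C)).
  apply mean_ext. intros t. rewrite Cconj_RtoC. ring.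
Qed.

Section Herglotz.

Variables (alpha : R) (p p' : C -> C).
Hypothesis Halpha : 0 < alpha.
Hypothesis Hp : hol 1 p p'.
Hypothesis Hre : forall z, Cmod z < 1 -> Re (z * p z) < alpha / 2.

(** The density of the Herglotz measure of [1 - (2 / alpha) z p z]. *)
Definition weight (t : R) : R := 1 - 2 / alpha * Re (rho * cis t * p (rho * cis t)).

Lemma Cmod_circle_lt_1 t : Cmod (rho * cis t) < 1.
Proof. rewrite Cmod_circle by exact rho_pos. lra. Qed.

Lemma weight_pos t : 0 < weight t.
Proof.
  unfold weight. assert (H := Hre _ (Cmod_circle_lt_1 t)).
  apply (Rmult_lt_compat_l (2 / alpha)) in H; [|apply Rdiv_lt_0_compat; lra].
  replace (2 / alpha * (alpha / 2)) with 1 in H by (field; lra). lra.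
Qed.

Lemma hol_zp : hol 1 (fun z => z * p z)%C (fun z => 1 * p z + z * p' z)%C.
Proof. apply hol_mult. apply hol_id. exact Hp. Qed.

Lemma ccont_zp : ccont (fun t => rho * cis t * p (rho * cis t))%C.
Proof. apply (ccont_hol 1 rho _ _ hol_zp). generalize rho_pos; lra. Qed.

Lemma rcont_weight : rcont weight.
Proof.
  intros t. unfold weight, Rminus. apply continuous_Rplus. apply continuous_const.
  apply continuous_Ropp, continuous_Rmult. apply continuous_const.
  apply (continuous_Re (fun t => rho * cis t * p (rho * cis t))%C), ccont_zp.
Qed.

Lemma rmean_weight : rmean weight = 1.
Proof.
  assert (M := mean_value 1 rho _ _ hol_zp ltac:(generalize rho_pos; lra)). cbv beta in M.
  rewrite (rmean_ext _ (fun t => 1 + - (2 / alpha) * Re (rho * cis t * p (rho * cis t)))).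
  2:{ intros; unfold weight; ring. }
  assert (CR := ccont_Re _ ccont_zp).
  rewrite rmean_plus, rmean_const, rmean_scal.
  - replace (rmean (fun t => Re (rho * cis t * p (rho * cis t)))) with 0. ring.
    symmetry. transitivity (Re (0 * p 0)). exact (f_equal Re M). 
    replace (0 * p 0)%C with (RtoC 0) by ring. reflexivity.
  - exact CR.
  - intros t; apply continuous_const.
  - apply rcont_scal, CR.
Qed.

(** The Schwarz formula.  Writing [Re q] as [(q + conj q) / 2] with [q = z * p],
    the constant and [conj q] contribute nothing, and [q] gives Cauchy's integral
    because [q (rho x) * kernel = z0 * p (rho x) / (1 - s * zeta)]. *)
Lemma mean_weight_kernel (s : R) : Rabs s * Cmod z0 < rho ->
  (alpha * mean (fun t => weight t * (- kernel s t)))%C = (z0 * p (s * z0))%C.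
Proof.
  intros Hs. assert (CK := ccont_kernel s Hs). assert (CQ := ccont_zp).
  assert (Ea : RtoC alpha <> 0%C) by (apply RtoC_neq_0; lra).
  rewrite (mean_ext _ (fun t => - kernel s t + / alpha * ((rho * cis t * p (rho * cis t)) * kernel s t
     + Cconj (rho * cis t * p (rho * cis t)) * kernel s t))%C).
  2:{ intros t. unfold weight. rewrite RtoC_minus, RtoC_mult, re_alt.
      rewrite RtoC_div by lra. field. exact Ea. }
  assert (C1 : ccont (fun t => - kernel s t)%C) by (intros t; apply continuous_Copp, CK).
  assert (C2 : ccont (fun t => rho * cis t * p (rho * cis t) * kernel s t)%C)
    by (apply ccont_mult; assumption).
  assert (C3 : ccont (fun t => Cconj (rho * cis t * p (rho * cis t)) * kernel s t)%C)
    by (apply ccont_mult; [apply ccont_conj|]; assumption).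
  assert (C4 := ccont_plus _ _ C2 C3).
  rewrite mean_plus; [|exact C1|apply ccont_mult; [apply ccont_const|exact C4]].
  rewrite mean_scal, mean_plus, mean_opp, mean_kernel by assumption.
  rewrite (mean_conj_kernel s _ _ Hs hol_zp).
  assert (C := cauchy_formula 1 rho p p' (s * z0)%C Hp ltac:(generalize rho_pos; lra)
     ltac:(rewrite Cmod_mult, Cmod_R; exact Hs)).
  rewrite <- C.
  rewrite <- mean_scal.
  - rewrite (mean_ext (fun t => z0 * _)%C (fun t => (rho * cis t * p (rho * cis t)) * kernel s t)%C).
    field. exact Ea.
    intros t. unfold kernel, zeta. assert (D := kernel_den s t Hs). unfold zeta in D.
    assert (X := circle_neq_0 t). set (y := (rho * cis t)%C) in *.
    assert (D' : (y - s * z0 <> 0)%C).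
    { intros E. apply D. replace (1 - s * (z0 / y))%C with ((y - s * z0) / y)%C by (field; exact X). 
      rewrite E. field. exact X. }
    field. repeat split; assumption.
  - assert (D' : forall t, (rho * cis t - s * z0 <> 0)%C).
    { intros t E. assert (D := kernel_den s t Hs). unfold zeta in D.
      assert (X := circle_neq_0 t). set (y := (rho * cis t)%C) in *.
      apply D. replace (1 - s * (z0 / y))%C with ((y - s * z0) / y)%C by (field; exact X). 
      rewrite E. field. exact X. }
    apply ccont_mult. apply (ccont_hol 1 rho _ _ Hp). generalize rho_pos; lra.
    intros t. apply continuous_Cmult. apply continuous_circle. apply continuous_Cinv; [|apply D'].
    apply continuous_Cminus. apply continuous_circle. apply continuous_const.
Qed.

Definition logmean (s : R) : C := mean (fun t => weight t * clog (1 - s * zeta t))%C.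

Lemma Re_den_pos (s t : R) : Rabs s * Cmod z0 < rho -> 0 < Re (1 - s * zeta t).
Proof.
  intros Hs. assert (H := Cmod_s_zeta s t Hs). assert (A := re_le_Cmod (s * zeta t)).
  assert (B := Rle_abs (Re (s * zeta t))). 
  replace (Re (1 - s * zeta t)) with (1 - Re (s * zeta t)) by (unfold Re; simpl; ring). lra.
Qed.

Lemma ccont_log (s : R) : Rabs s * Cmod z0 < rho -> ccont (fun t => clog (1 - s * zeta t)).
Proof.
  intros Hs t. apply continuous_clog; [|apply Re_den_pos, Hs].
  apply continuous_Cminus. apply continuous_const. apply continuous_Cmult. apply continuous_const. apply ccont_zeta.
Qed.

Lemma ccont_weight : ccont (fun t => RtoC (weight t)).
Proof. intros t. apply continuous_RtoC, rcont_weight. Qed.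

Lemma cder_RtoC (s : R) : cder RtoC s 1%C.
Proof. split; simpl. apply @is_derive_id. apply @is_derive_const. Qed.

Lemma cder_mult_const (c : C) g t d : cder g t d -> cder (fun s => c * g s)%C t (c * d)%C.
Proof.
  intros H. eapply cder_eq. apply cder_mult. apply cder_const. exact H. cbv beta; ring.
Qed.

Lemma cder_logmean (s : R) : 0 <= s <= 1 ->
  cder (fun s => alpha * logmean s)%C s (z0 * p (s * z0))%C.
Proof.
  intros Hs. 
  assert (L : locally s (fun u => Rabs u * Cmod z0 < rho)).
  { assert (H : continuous (fun u => Rabs u * Cmod z0) s).
    { apply continuous_Rmult. apply continuous_Rabs. apply continuous_const. }
    apply (H (fun x => x < rho)). apply (open_lt rho). rewrite Rabs_pos_eq by lra. generalize (Cmod_ge_0 z0); nra. }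
  assert (Hs' := locally_singleton _ _ L). cbv beta in Hs'.
  rewrite <- mean_weight_kernel by exact Hs'.
  apply cder_mult_const. unfold logmean.
  apply (mean_cder (fun s t => weight t * clog (1 - s * zeta t))%C (fun s t => weight t * - kernel s t)%C).
  - revert L. apply filter_imp. intros u Hu t. apply cder_mult_const.
    eapply cder_eq. apply cder_clog_ray. apply Re_den_pos, Hu.
    reflexivity.
  - revert L. apply filter_imp. intros u Hu. apply ccont_mult. apply ccont_weight. apply ccont_log, Hu.
  - intros t. 
    assert (CZ : continuous (U := C_UniformSpace) (fun q : R * R => zeta (snd q)) (s, t)).
    { apply (continuous_comp snd zeta). apply continuous_snd. apply ccont_zeta. }
    apply continuous_Cmult.
    + apply continuous_RtoC. apply (continuous_comp snd weight). apply continuous_snd. apply rcont_weight.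
    + apply continuous_Copp. unfold kernel. apply continuous_Cmult. exact CZ.
      apply continuous_Cinv; [|apply kernel_den, Hs'].
      apply continuous_Cminus. apply continuous_const. apply continuous_Cmult. 
      apply continuous_RtoC, continuous_fst. exact CZ.
Qed.

Lemma logmean_0 : logmean 0 = 0%C.
Proof.
  unfold logmean. rewrite (mean_ext _ (fun _ => 0%C)). apply mean_const.
  intros t. replace (1 - 0 * zeta t)%C with (RtoC 1) by ring. rewrite clog_1. ring.
Qed.

(** Both sides solve [y' = z0 * p (s z0) * y], [y 0 = 1], in the variable [s]. *)
Lemma exp_representation (f1 f2 : C -> C) :
  hol 1 f1 f2 -> f1 0%C = 1%C -> (forall z, Cmod z < 1 -> f2 z = f1 z * p z)%C ->
  forall s : R, 0 <= s <= 1 -> f1 (s * z0)%C = cexp (alpha * logmean s).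
Proof.
  intros H1 H0 H2 s Hs.
  assert (Hz : forall u : R, 0 <= u <= 1 -> Cmod (u * z0) < 1).
  { intros u Hu. rewrite Cmod_mult, Cmod_R, Rabs_pos_eq by lra. generalize (Cmod_ge_0 z0); nra. }
  assert (E : (f1 (s * z0) * cexp (- (1) * (alpha * logmean s)) = f1 (RtoC 0 * z0) * cexp (-(1) * (alpha * logmean 0)))%C).
  { apply (cder_0_const (fun s : R => f1 (s * z0) * cexp (- (1) * (alpha * logmean s)))%C); [lra|].
    intros u Hu. assert (Hu' : 0 <= u <= 1) by lra.
    eapply cder_eq. apply cder_mult.
    - apply (cder_comp f1 (fun u : R => u * z0)%C). apply H1, Hz, Hu'.
      apply (cder_mult (fun u : R => RtoC u) (fun _ => z0)).
      apply cder_RtoC. apply cder_const.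
    - apply cder_cexp. apply cder_mult_const. apply cder_logmean, Hu'.
    - rewrite H2 by (apply Hz, Hu'). cbv beta. ring. }
  rewrite logmean_0 in E.
  replace (RtoC 0 * z0)%C with (RtoC 0) in E by ring. rewrite H0 in E.
  replace (- (1) * (alpha * 0))%C with (RtoC 0) in E by ring. rewrite cexp_0 in E.
  replace (- (1) * (alpha * logmean s))%C with (- (alpha * logmean s))%C in E by ring.
  assert (Q := cexp_opp (alpha * logmean s)).
  transitivity (f1 (s * z0) * (cexp (alpha * logmean s) * cexp (- (alpha * logmean s))))%C.
  rewrite Q; ring.
  transitivity ((f1 (s * z0) * cexp (- (alpha * logmean s))) * cexp (alpha * logmean s))%C. ring.
  rewrite E. ring.
Qed.

End Herglotz.

End Kernel.

(** * Distortion *)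

(** After clearing denominators the difference of both sides is
    [(1 - t) (1 + t r) (r - Re w)] with [r = |w|]. *)
Lemma Re_quotient_lower (w : C) (t : R) :
  Cmod w < 1 -> 0 <= t <= 1 ->
  (1 - Cmod w) / (1 - t * Cmod w) <= Re ((1 - w) / (1 - t * w)).
Proof.
  intros Hw Ht. assert (H0 := Cmod_ge_0 w). assert (Hq := Cmod2_alt w).
  assert (Hre := re_le_Cmod w). apply Rabs_le_between in Hre.
  set (r := Cmod w) in *. destruct w as [a b]. unfold Re, Im in *; simpl in Hq, Hre |- *.
  assert (P1 : 0 < 1 - t * r) by nra.
  assert (P2 : 0 < (1 - t * a) ^ 2 + (t * b) ^ 2) by (assert (0 < 1 - t * a) by nra; nra).
  replace ((1 + - a) * _ - _) with 
    ((1 - (1 + t) * a + t * (r * r)) / ((1 - t * a) ^ 2 + (t * b) ^ 2)).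
  2:{ replace (r * r) with (a * a + b * b) by lra. field. simpl in P2. lra. }
  apply (Rmult_le_reg_r (1 - t * r)). exact P1.
  apply (Rmult_le_reg_r ((1 - t * a) ^ 2 + (t * b) ^ 2)). exact P2.
  replace ((1 - r) / (1 - t * r) * (1 - t * r) * ((1 - t * a) ^ 2 + (t * b) ^ 2)) with
    ((1 - r) * (1 - 2 * t * a + t * t * (a * a + b * b))) by (field; lra).
  replace (_ / _ * (1 - t * r) * _) with
    ((1 - (1 + t) * a + t * (r * r)) * (1 - t * r)) by (field; simpl in P2; lra).
  replace (a * a + b * b) with (r * r) by lra.
  assert (0 <= (1 - t) * (1 + t * r) * (r - a)) by (repeat apply Rmult_le_pos; nra).
  nra.
Qed.

(** Here the difference is [(1 - t) (1 - r) (r + Re w)]. *)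
Lemma Re_quotient_upper (w : C) (t : R) :
  Cmod w < 1 -> 0 <= t <= 1 ->
  (1 + t * Cmod w) / (1 + Cmod w) <= Re ((1 - t * w) / (1 - w)).
Proof.
  intros Hw Ht. assert (H0 := Cmod_ge_0 w). assert (Hq := Cmod2_alt w).
  assert (Hre := re_le_Cmod w). apply Rabs_le_between in Hre.
  set (r := Cmod w) in *. destruct w as [a b]. unfold Re, Im in *; simpl in Hq, Hre |- *.
  assert (P2 : 0 < (1 - a) ^ 2 + b ^ 2) by (assert (0 < 1 - a) by nra; nra).
  replace ((1 + - _) * _ - _) with 
    ((1 - (1 + t) * a + t * (r * r)) / ((1 - a) ^ 2 + b ^ 2)).
  2:{ replace (r * r) with (a * a + b * b) by lra. field. simpl in P2. lra. }
  apply (Rmult_le_reg_r (1 + r)). lra.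
  apply (Rmult_le_reg_r ((1 - a) ^ 2 + b ^ 2)). exact P2.
  replace ((1 + t * r) / (1 + r) * (1 + r) * ((1 - a) ^ 2 + b ^ 2)) with
    ((1 + t * r) * (1 - 2 * a + (a * a + b * b))) by (field; lra).
  replace (_ / _ * (1 + r) * _) with
    ((1 - (1 + t) * a + t * (r * r)) * (1 + r)) by (field; simpl in P2; lra).
  replace (a * a + b * b) with (r * r) by lra.
  assert (0 <= (1 - t) * (1 - r) * (a + r)) by (repeat apply Rmult_le_pos; lra).
  nra.
Qed.

Lemma left_limit_le (k : R -> R) r A :
  r < 1 -> continuous k 1 -> (forall rho, r < rho < 1 -> k rho <= A) -> k 1 <= A.
Proof.
  intros Hr Hk H. apply Rnot_lt_le. intros L.
  assert (Q : locally 1 (fun x => A < k x)) by (apply (Hk (fun y => A < y)); apply (open_gt A); exact L).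
  destruct Q as [d Hd]. assert (P := cond_pos d).
  set (m := Rmin (d / 2) ((1 - r) / 2)).
  assert (Hm : 0 < m) by (apply Rmin_pos; lra).
  assert (M1 : m <= d / 2) by apply Rmin_l. assert (M2 : m <= (1 - r) / 2) by apply Rmin_r.
  specialize (H (1 - m) ltac:(lra)). specialize (Hd (1 - m)).
  assert (A < k (1 - m)).
  { apply Hd. change (Rabs (1 - m - 1) < d). rewrite Rabs_left; lra. }
  lra.
Qed.

Lemma cos_pos_half (x : R) : - PI < x < PI -> 0 < cos x -> - PI / 2 < x < PI / 2.
Proof.
  intros Hx Hc. split; apply Rnot_le_lt; intros L.
  - assert (cos (- x) <= 0) by (apply cos_le_0; lra). rewrite cos_neg in H. lra.
  - assert (cos x <= 0) by (apply cos_le_0; lra). lra.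
Qed.

Section Distortion.

Variables (alpha : R) (p p' f1 f2 : C -> C).
Hypothesis Halpha : 0 < alpha <= 1.
Hypothesis Hp : hol 1 p p'.
Hypothesis Hre : forall z, Cmod z < 1 -> Re (z * p z) < alpha / 2.
Hypothesis Hf1 : hol 1 f1 f2.
Hypothesis Hf10 : f1 0%C = 1%C.
Hypothesis Hf2 : forall z, Cmod z < 1 -> f2 z = (f1 z * p z)%C.

Section Radius.

Variables (z0 : C) (rho t : R).
Hypothesis Hrho : Cmod z0 < rho < 1.
Hypothesis Ht : 0 <= t <= 1.

Local Notation zt := (zeta z0 rho).
(* the logarithm of [(1 - zeta) / (1 - t zeta)] *)
Let L (th : R) : C := (clog (1 - 1 * zt th) - clog (1 - t * zt th))%C.
Let r' := Cmod z0 / rho.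

Lemma radius_small (s : R) : 0 <= s <= 1 -> Rabs s * Cmod z0 < rho.
Proof. intros Hs. rewrite Rabs_pos_eq by lra. generalize (Cmod_ge_0 z0); nra. Qed.

Lemma cexp_L th : cexp (L th) = ((1 - zt th) / (1 - t * zt th))%C.
Proof.
  unfold L, Cminus at 1. rewrite cexp_plus.
  assert (D1 := Re_den_pos z0 rho Hrho 1 th (radius_small 1 ltac:(lra))).
  assert (D2 := Re_den_pos z0 rho Hrho t th (radius_small t Ht)).
  rewrite cexp_clog by exact D1.
  assert (Q := cexp_opp (clog (1 - t * zt th))). rewrite cexp_clog in Q by exact D2.
  assert (N : (1 - t * zt th)%C <> 0%C) by (intros E; rewrite E in D2; unfold Re in D2; simpl in D2; lra).
  replace (1 - 1 * zt th)%C with (1 - zt th)%C by ring.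
  set (y := (1 - t * zt th)%C) in *. set (x := (1 - zt th)%C) in *.
  transitivity (x / y * (y * cexp (- clog y)))%C. field. exact N. rewrite Q. ring.
Qed.

Lemma zeta_lt_1 th : Cmod (zt th) < 1.
Proof. rewrite (Cmod_zeta z0 rho Hrho). apply (zeta_ratio z0 rho Hrho). Qed.

Lemma lower_pos : 0 < (1 - r') / (1 - t * r').
Proof. assert (H := zeta_ratio z0 rho Hrho). fold r' in H. apply Rdiv_lt_0_compat; nra. Qed.

Lemma upper_pos : 0 < (1 + t * r') / (1 + r').
Proof. assert (H := zeta_ratio z0 rho Hrho). fold r' in H. apply Rdiv_lt_0_compat; nra. Qed.

Lemma L_lower th : (1 - r') / (1 - t * r') <= exp (Re (L th)) * cos (Im (L th)).
Proof.
  change (exp (Re (L th)) * cos (Im (L th))) with (Re (cexp (L th))). rewrite cexp_L.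
  assert (H := Re_quotient_lower (zt th) t (zeta_lt_1 th) Ht).
  rewrite (Cmod_zeta z0 rho Hrho) in H. exact H.
Qed.

Lemma L_upper th : (1 + t * r') / (1 + r') <= exp (Re (- L th)) * cos (Im (- L th)).
Proof.
  change (exp (Re (- L th)) * cos (Im (- L th))) with (Re (cexp (- L th))).
  assert (H := Re_quotient_upper (zt th) t (zeta_lt_1 th) Ht).
  rewrite (Cmod_zeta z0 rho Hrho) in H. fold r' in H.
  replace (cexp (- L th)) with ((1 - t * zt th) / (1 - zt th))%C. exact H.
  assert (Q := cexp_opp (L th)). rewrite cexp_L in Q.
  assert (N1 : (1 - zt th)%C <> 0%C) by apply one_minus_neq_0, zeta_lt_1.
  assert (N2 : (1 - t * zt th)%C <> 0%C).
  { apply (kernel_den z0 rho Hrho t th), radius_small, Ht. }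
  transitivity ((1 - t * zt th) / (1 - zt th) * ((1 - zt th) / (1 - t * zt th) * cexp (- L th)))%C.
  rewrite Q. ring. field. split; assumption.
Qed.

(** A difference of two arguments in [(-pi/2, pi/2)] whose cosine is positive
    lies in that interval again. *)
Lemma Im_L th : - PI / 2 < Im (L th) < PI / 2.
Proof.
  apply cos_pos_half.
  - assert (H1 := clog_Im_bound (1 - 1 * zt th)). assert (H2 := clog_Im_bound (1 - t * zt th)).
    replace (Im (L th)) with (Im (clog (1 - 1 * zt th)) - Im (clog (1 - t * zt th)))
      by (unfold L, Im; simpl; ring). lra.
  - apply (Rmult_lt_reg_l (exp (Re (L th)))). apply exp_pos. rewrite Rmult_0_r.
    eapply Rlt_le_trans. apply lower_pos. apply L_lower.
Qed.

Lemma ccont_L : ccont L.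
Proof.
  intros th. apply continuous_Cminus; apply (ccont_log z0 rho Hrho); apply radius_small; lra.
Qed.

Let mu := weight rho alpha p.
Let W (s : R) := logmean z0 rho alpha p s.

Lemma mean_L : mean (fun th => mu th * L th)%C = (W 1 - W t)%C.
Proof.
  unfold W, logmean. rewrite <- mean_minus.
  - apply mean_ext. intros th. unfold L, mu. ring.
  - apply ccont_mult. apply (ccont_weight z0 rho Hrho alpha p p' Hp). apply (ccont_log z0 rho Hrho), radius_small; lra.
  - apply ccont_mult. apply (ccont_weight z0 rho Hrho alpha p p' Hp). apply (ccont_log z0 rho Hrho), radius_small; lra.
Qed.

Lemma f1_on_ray (s : R) : 0 <= s <= 1 -> f1 (s * z0)%C = cexp (alpha * W s).
Proof.
  intros Hs. apply (exp_representation z0 rho Hrho alpha p p' ltac:(lra) Hp f1 f2 Hf1 Hf10 Hf2 s Hs).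
Qed.

(** [f1 z0 / f1 (t z0)] is the exponential of [alpha] times the average of [L],
    and its inverse that of [- L]; the averaging inequality applies to both. *)
Lemma distortion_rho :
  Rpower ((1 - Cmod z0 / rho) / (1 - t * (Cmod z0 / rho))) alpha <= Re (f1 z0 / f1 (t * z0)%C) /\
  Rpower ((1 + t * (Cmod z0 / rho)) / (1 + Cmod z0 / rho)) alpha <= Re (f1 (t * z0)%C / f1 z0).
Proof.
  fold r'. assert (E1 := f1_on_ray 1 ltac:(lra)). assert (Et := f1_on_ray t Ht).
  replace (1 * z0)%C with z0 in E1 by ring.
  assert (Cmu := rcont_weight z0 rho Hrho alpha p p' Hp).
  assert (Pmu := weight_pos z0 rho Hrho alpha p ltac:(lra) Hre).
  assert (Mmu := rmean_weight z0 rho Hrho alpha p p' Hp).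
  assert (Q1 := cexp_opp (alpha * W 1)). assert (Qt := cexp_opp (alpha * W t)).
  assert (N1 := cexp_neq_0 (alpha * W 1)). assert (Nt := cexp_neq_0 (alpha * W t)).
  assert (I1 : cexp (- (alpha * W 1)) = (/ cexp (alpha * W 1))%C).
  { rewrite <- (Cmult_1_r (/ _)), <- Q1. field. exact N1. }
  assert (It : cexp (- (alpha * W t)) = (/ cexp (alpha * W t))%C).
  { rewrite <- (Cmult_1_r (/ _)), <- Qt. field. exact Nt. }
  rewrite E1, Et. split.
  - replace (cexp (alpha * W 1) / cexp (alpha * W t))%C with (cexp (alpha * mean (fun th => mu th * L th))%C).
    + apply exp_cos_mean; try assumption. apply lower_pos. apply ccont_L. apply Im_L. apply L_lower.
    + rewrite mean_L. unfold Cdiv. rewrite <- It, <- cexp_plus. f_equal. ring.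
  - replace (cexp (alpha * W t) / cexp (alpha * W 1))%C with (cexp (alpha * mean (fun th => mu th * (- L th)))%C).
    + apply exp_cos_mean; try assumption. apply upper_pos. 
      intros th; apply continuous_Copp, ccont_L.
      intros th. assert (H := Im_L th). replace (Im (- L th)) with (- Im (L th)) by reflexivity. lra.
      apply L_upper.
    + rewrite (mean_ext _ (fun th => - (mu th * L th))%C) by (intros; ring).
      rewrite mean_opp, mean_L. unfold Cdiv. rewrite <- I1, <- cexp_plus. f_equal. ring.
      apply ccont_mult. apply (ccont_weight z0 rho Hrho alpha p p' Hp). apply ccont_L.
Qed.

End Radius.

(** The kernel representation holds on circles of radius [rho < 1]; the bounds
    for [f1] follow by letting [rho] tend to [1]. *)
Lemma distortion (z0 : C) (t : R) : Cmod z0 < 1 -> 0 <= t <= 1 ->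
  Rpower ((1 - Cmod z0) / (1 - t * Cmod z0)) alpha <= Re (f1 z0 / f1 (t * z0)%C) /\
  Rpower ((1 + t * Cmod z0) / (1 + Cmod z0)) alpha <= Re (f1 (t * z0)%C / f1 z0).
Proof.
  intros Hz Ht. assert (H0 := Cmod_ge_0 z0). set (r := Cmod z0) in *. split.
  - assert (K := left_limit_le (fun rho => Rpower ((1 - r / rho) / (1 - t * (r / rho))) alpha) r
      (Re (f1 z0 / f1 (t * z0)%C)) Hz).
    cbv beta in K. rewrite Rdiv_1_r in K. apply K.
    + apply (ex_derive_continuous (fun rho => Rpower ((1 - r / rho) / (1 - t * (r / rho))) alpha)).
      unfold Rpower. auto_derive. rewrite ?Rdiv_1_r, ?Rinv_1, ?Rmult_1_r.
      assert (0 < 1 - t * r) by nra.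
      repeat split; try lra. apply Rdiv_lt_0_compat; lra.
    + intros rho Hr. apply (distortion_rho z0 rho t Hr Ht).
  - assert (K := left_limit_le (fun rho => Rpower ((1 + t * (r / rho)) / (1 + r / rho)) alpha) r
      (Re (f1 (t * z0)%C / f1 z0)) Hz).
    cbv beta in K. rewrite Rdiv_1_r in K. apply K.
    + apply (ex_derive_continuous (fun rho => Rpower ((1 + t * (r / rho)) / (1 + r / rho)) alpha)).
      unfold Rpower. auto_derive. rewrite ?Rdiv_1_r, ?Rinv_1, ?Rmult_1_r.
      assert (0 <= t * r) by nra.
      repeat split; try lra. apply Rdiv_lt_0_compat; lra.
    + intros rho Hr. apply (distortion_rho z0 rho t Hr Ht).
Qed.

End Distortion.

(** * Growth and the logarithmic derivative *)

(** Weighted arithmetic-geometric mean inequality, from the tangent to [exp] at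
    [alpha * ln x]. *)
Lemma Rpower_bernoulli (x alpha : R) : 0 < x -> 0 < alpha <= 1 -> Rpower x alpha <= 1 + alpha * (x - 1).
Proof.
  intros Hx Ha. unfold Rpower. set (u := ln x).
  assert (Ex : x = exp u) by (unfold u; rewrite exp_ln; auto). rewrite Ex.
  assert (P := exp_pos (alpha * u)).
  assert (H1 : exp (alpha * u) * (1 + (u - alpha * u)) <= exp u).
  { replace (exp u) with (exp (alpha * u) * exp (u - alpha * u)) by (rewrite <- exp_plus; f_equal; ring).
    apply Rmult_le_compat_l. lra. apply exp_ineq1_le. }
  assert (H2 : exp (alpha * u) * (1 + (- (alpha * u))) <= 1).
  { rewrite <- exp_0. replace (exp 0) with (exp (alpha * u) * exp (- (alpha * u))) at 2 by (rewrite <- exp_plus; f_equal; ring).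
    rewrite exp_0. apply Rmult_le_compat_l. lra. apply exp_ineq1_le. }
  apply (Rmult_le_compat_l alpha) in H1; [|lra]. apply (Rmult_le_compat_l (1 - alpha)) in H2; [|lra].
  nra.
Qed.

Lemma Rpower_1_plus (x alpha : R) : 0 < x -> Rpower x (1 + alpha) = x * Rpower x alpha.
Proof. intros Hx. rewrite Rpower_plus, Rpower_1 by exact Hx. reflexivity. Qed.

Lemma disk_of_inverse (u : C) (c : R) : 0 < c -> c <= Re (/ u) -> u <> 0%C ->
  Re u ^ 2 + Im u ^ 2 <= / c * Re u.
Proof.
  intros Hc H Hu. assert (Q := Re_Im_sq_neq_0 u Hu). 
  assert (P : 0 < Re u ^ 2 + Im u ^ 2) by (assert (0 <= Re u ^ 2 + Im u ^ 2) by nra; lra).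
  assert (E : Re (/ u) = Re u / (Re u ^ 2 + Im u ^ 2)) by reflexivity.
  rewrite E in H. set (m := Re u ^ 2 + Im u ^ 2) in *.
  apply (Rmult_le_reg_l c). exact Hc. rewrite <- Rmult_assoc, Rinv_r, Rmult_1_l by lra.
  apply (Rmult_le_compat_r m) in H; [|lra]. unfold Rdiv in H. rewrite Rmult_assoc, Rinv_l in H by lra. lra.
Qed.

(** A disk with diameter from [0] to [d] is replaced by its supporting
    half-planes, since linear inequalities can be integrated in [t]. *)
Lemma disk_support (u e : C) (d : R) : Re u ^ 2 + Im u ^ 2 <= d * Re u -> Cmod e = 1 -> 0 <= d ->
  Re (e * u) <= (Re e + 1) / 2 * d.
Proof.
  intros Hu He Hd. 
  assert (H : Re (e * (u - d / 2)) <= d / 2).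
  { eapply Rle_trans; [apply Rle_abs|]. eapply Rle_trans; [apply re_le_Cmod|].
    rewrite Cmod_mult, He, Rmult_1_l. apply Rsqr_incr_0_var; [|lra].
    unfold Rsqr.
    replace (Cmod (u - d / 2) * Cmod (u - d / 2)) with (Cmod (u - d / 2) ^ 2) by ring.
    rewrite Cmod2_alt. 
    replace (u - d / 2)%C with (u - RtoC (d / 2))%C by (rewrite RtoC_div by lra; reflexivity).
    unfold Re, Im in *; simpl in *. nra. }
  replace (u - d / 2)%C with (u - RtoC (d / 2))%C in H by (rewrite RtoC_div by lra; reflexivity).
  unfold Re, Im in *; simpl in *. lra.
Qed.

(** The useful direction [e] is that of the conjugate of [u - d / 2]. *)
Lemma disk_of_support (u : C) (d : R) : 0 < d ->
  (forall e, Cmod e = 1 -> Re (e * u) <= (Re e + 1) / 2 * d) -> Re u ^ 2 + Im u ^ 2 <= d * Re u.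
Proof.
  intros Hd H. set (v := (u - RtoC (d / 2))%C).
  assert (K : Cmod v <= d / 2).
  { destruct (Ceq_dec v 0) as [E|E]. rewrite E, Cmod_0; lra.
    assert (P := proj1 (Cmod_gt_0 _) E).
    assert (He : Cmod (Cconj v / Cmod v) = 1).
    { rewrite Cmod_div by (apply RtoC_neq_0; lra). rewrite Cmod_conj, Cmod_R, Rabs_pos_eq by lra. field. lra. }
    assert (Hm : (Cconj v / Cmod v * v)%C = RtoC (Cmod v)).
    { transitivity (v * Cconj v / Cmod v)%C. unfold Cdiv; ring. rewrite <- Cmod2_conj.
      rewrite <- RtoC_div by lra. f_equal. field. lra. }
    specialize (H _ He). set (e := (Cconj v / Cmod v)%C) in *.
    assert (X : Re (e * u) = Re (e * v) + Re e * (d / 2)) by (unfold v, Re; simpl; ring).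
    rewrite Hm in X. change (Re (RtoC (Cmod v))) with (Cmod v) in X. lra. }
  assert (K2 : Cmod v ^ 2 <= (d / 2) ^ 2) by (apply pow_incr; split; [apply Cmod_ge_0|exact K]).
  rewrite Cmod2_alt in K2. unfold v, Re, Im in *; simpl in *. lra.
Qed.

Section Growth.

Variables (alpha : R) (f f1 : C -> C).
Hypothesis Halpha : 0 < alpha <= 1.
Hypothesis Hf : hol 1 f f1.
Hypothesis Hf0 : f 0%C = 0%C.
Hypothesis Hf10 : f1 0%C = 1%C.
Hypothesis Hnz : forall z, Cmod z < 1 -> f1 z <> 0%C.
Hypothesis Hdist : forall (z0 : C) (t : R), Cmod z0 < 1 -> 0 <= t <= 1 ->
  Rpower ((1 - Cmod z0) / (1 - t * Cmod z0)) alpha <= Re (f1 z0 / f1 (t * z0)%C) /\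
  Rpower ((1 + t * Cmod z0) / (1 + Cmod z0)) alpha <= Re (f1 (t * z0)%C / f1 z0).

Section Point.

Variable z : C.
Hypothesis Hz : 0 < Cmod z < 1.

Let r := Cmod z.

Lemma z_neq_0 : z <> 0%C.
Proof. apply Cmod_gt_0. apply Hz. Qed.

Lemma ray_in_disk (t : R) : 0 <= t <= 1 -> Cmod (t * z) < 1.
Proof. intros Ht. rewrite Cmod_mult, Cmod_R, Rabs_pos_eq by lra. nra. Qed.

Lemma ray_derive (c : C) (t : R) : 0 <= t <= 1 ->
  is_derive (fun t : R => Re (c * f (t * z))) t (Re (c * (f1 (t * z) * z))).
Proof.
  intros Ht. apply (cder_mult_const c (fun t : R => f (t * z)%C)).
  apply (cder_comp f (fun u : R => u * z)%C). apply Hf, ray_in_disk, Ht.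
  eapply cder_eq. apply (cder_mult (fun u : R => RtoC u) (fun _ => z)). apply cder_RtoC. apply cder_const.
  cbv beta. ring.
Qed.

(** Integration of an inequality along the ray from [0] to [z], in the form of
    monotonicity of a difference. *)
Lemma ray_compare (c : C) (phi dphi : R -> R) :
  (forall t, 0 <= t <= 1 -> is_derive phi t (dphi t)) ->
  (forall t, 0 <= t <= 1 -> dphi t <= Re (c * (f1 (t * z) * z))) ->
  phi 1 - phi 0 <= Re (c * f z).
Proof.
  intros H1 H2.
  assert (K : Re (c * f (RtoC 0 * z)) - phi 0 <= Re (c * f (RtoC 1 * z)) - phi 1).
  { apply (increasing_of_derive_nonneg (fun t : R => Re (c * f (t * z)) - phi t)
      (fun t : R => Re (c * (f1 (t * z) * z)) - dphi t)). lra.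
    - intros t Ht. apply (is_derive_minus (fun t : R => Re (c * f (t * z))) phi).
      apply ray_derive, Ht. apply H1, Ht.
    - intros t Ht. specialize (H2 t Ht). lra. }
  replace (RtoC 0 * z)%C with (RtoC 0) in K by ring. replace (RtoC 1 * z)%C with z in K by ring.
  rewrite Hf0 in K. replace (Re (c * 0)) with 0 in K by (unfold Re; simpl; ring). lra.
Qed.

(** Comparing [t z] with the centre, the distortion bound reads
    [Re f1 (t z) >= (1 - t r) ^ alpha]. *)
Lemma growth_Re : (1 - Rpower (1 - r) (1 + alpha)) / ((1 + alpha) * r) <= Re (/ z * f z).
Proof.
  assert (K := ray_compare (/ z)%C (fun t => - Rpower (1 - t * r) (1 + alpha) / ((1 + alpha) * r))
    (fun t => Rpower (1 - t * r) alpha)). unfold r in *. cbv beta in K.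
  eapply Rle_trans; [|apply K].
  - replace (1 - 1 * Cmod z) with (1 - Cmod z) by ring. replace (1 - 0 * Cmod z) with 1 by ring.
    rewrite Rpower_1_plus with (x := 1) by lra. 
    replace (Rpower 1 alpha) with 1 by (unfold Rpower; rewrite ln_1, Rmult_0_r, exp_0; reflexivity).
    apply Req_le. field. lra.
  - intros t Ht. assert (P : 0 < 1 - t * Cmod z) by nra.
    unfold Rpower. auto_derive. exact P.
    change (1 + - (t * Cmod z)) with (1 - t * Cmod z).
    replace (exp ((1 + alpha) * ln (1 - t * Cmod z))) with ((1 - t * Cmod z) * exp (alpha * ln (1 - t * Cmod z))).
    field. lra. symmetry. apply (Rpower_1_plus _ alpha P).
  - intros t Ht. replace (/ z * (f1 (t * z) * z))%C with (f1 (t * z)) by (field; apply z_neq_0).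
    destruct (Hdist (t * z)%C 0 (ray_in_disk t Ht) ltac:(lra)) as [D _].
    replace (0 * (t * z))%C with (RtoC 0) in D by ring. rewrite Hf10 in D.
    replace (f1 (t * z) / 1)%C with (f1 (t * z)) in D by (field; exact C1_nz).
    rewrite Rmult_0_l, Rminus_0_r, Rdiv_1_r in D.
    rewrite Cmod_mult, Cmod_R, Rabs_pos_eq in D by lra. exact D.
Qed.

Lemma growth_pos : 0 < (1 - Rpower (1 - r) (1 + alpha)) / ((1 + alpha) * r).
Proof.
  assert (Pr : 0 < r < 1) by apply Hz.
  assert (Rpower (1 - r) (1 + alpha) < 1).
  { unfold Rpower. apply Rlt_le_trans with (exp 0); [apply exp_increasing|rewrite exp_0; lra].
    assert (E : ln (1 - r) < ln 1) by (apply ln_increasing; lra). rewrite ln_1 in E. nra. }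
  apply Rdiv_lt_0_compat; nra.
Qed.

Lemma f_neq_0 : f z <> 0%C.
Proof.
  intros E. assert (H := growth_Re). assert (P := growth_pos). rewrite E in H.
  replace (Re (/ z * 0)) with 0 in H by (unfold Re; simpl; ring). lra.
Qed.

Lemma growth : (1 - Rpower (1 - r) (1 + alpha)) / (1 + alpha) <= Cmod (f z).
Proof.
  assert (H := growth_Re). assert (A := re_le_Cmod (/ z * f z)). 
  assert (B := Rle_abs (Re (/ z * f z))).
  rewrite Cmod_mult, Cmod_inv in A by apply z_neq_0. fold r in A.
  assert (Pr : 0 < r) by apply Hz.
  replace (Cmod (f z)) with (r * (/ r * Cmod (f z))) by (field; lra).
  replace ((1 - Rpower (1 - r) (1 + alpha)) / (1 + alpha)) with
    (r * ((1 - Rpower (1 - r) (1 + alpha)) / ((1 + alpha) * r))) by (field; lra).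
  apply Rmult_le_compat_l; lra.
Qed.

(* the inverse of [z f1 z / f z], i.e. the integral of [f1 (t z) / f1 z] over
   [0 <= t <= 1] *)
Let U : C := (/ (z * f1 z) * f z)%C.

Lemma f1_neq_0 : f1 z <> 0%C.
Proof. apply Hnz, Hz. Qed.

(** The integral of [((1 + t r) / (1 + r)) ^ alpha] is computed and compared
    with its rational lower bound by Bernoulli's inequality at [1 / (1 + r)]. *)
Lemma Re_U_lower : (1 + alpha + r) / ((1 + alpha) * (1 + r)) <= Re U.
Proof.
  assert (Pr : 0 < r < 1) by apply Hz.
  assert (K := ray_compare (/ (z * f1 z))%C 
    (fun t => (1 + r) / ((1 + alpha) * r) * Rpower ((1 + t * r) / (1 + r)) (1 + alpha))
    (fun t => Rpower ((1 + t * r) / (1 + r)) alpha)). cbv beta in K.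
  eapply Rle_trans; [|apply K].
  - replace ((1 + 1 * r) / (1 + r)) with 1 by (field; lra). replace ((1 + 0 * r) / (1 + r)) with (/ (1 + r)) by (field; lra).
    assert (Px : 0 < / (1 + r)) by (apply Rinv_0_lt_compat; lra).
    rewrite !Rpower_1_plus by lra.
    replace (Rpower 1 alpha) with 1 by (unfold Rpower; rewrite ln_1, Rmult_0_r, exp_0; reflexivity).
    assert (B := Rpower_bernoulli (/ (1 + r)) alpha Px Halpha).
    apply Rle_trans with ((1 + r) / ((1 + alpha) * r) * (1 - / (1 + r) * (1 + alpha * (/ (1 + r) - 1)))).
    + apply Req_le. field. lra.
    + replace ((1 + r) / ((1 + alpha) * r) * (1 * 1) - (1 + r) / ((1 + alpha) * r) * (/ (1 + r) * Rpower (/ (1 + r)) alpha))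
       with ((1 + r) / ((1 + alpha) * r) * (1 - / (1 + r) * Rpower (/ (1 + r)) alpha)) by ring.
      apply Rmult_le_compat_l. apply Rlt_le, Rdiv_lt_0_compat; nra.
      apply Rplus_le_compat_l, Ropp_le_contravar, Rmult_le_compat_l; lra.
  - intros t Ht. assert (P : 0 < (1 + t * r) / (1 + r)) by (apply Rdiv_lt_0_compat; nra).
    unfold Rpower. auto_derive. exact P. 
    replace (exp ((1 + alpha) * ln ((1 + t * r) * / (1 + r)))) with
      (((1 + t * r) / (1 + r)) * exp (alpha * ln ((1 + t * r) / (1 + r)))).
    unfold Rdiv. field. repeat split; nra. symmetry. apply (Rpower_1_plus _ alpha P).
  - intros t Ht. replace (/ (z * f1 z) * (f1 (t * z) * z))%C with (f1 (t * z) / f1 z)%C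
      by (field; split; [apply f1_neq_0|apply z_neq_0]).
    apply (Hdist z t); [apply Hz|exact Ht].
Qed.

(** Each [f1 (t z) / f1 z] lies in the disk with diameter from [0] to
    [((1 - t r) / (1 - r)) ^ alpha], so their average lies in the disk whose
    diameter ends at the average, bounded by Bernoulli's inequality at
    [1 / (1 - r)]. *)
Lemma U_disk : Re U ^ 2 + Im U ^ 2 <= (1 + alpha - r) / ((1 + alpha) * (1 - r)) * Re U.
Proof.
  assert (Pr : 0 < r < 1) by apply Hz.
  apply disk_of_support. apply Rdiv_lt_0_compat; nra.
  intros e He.
  assert (Pe : 0 <= (Re e + 1) / 2).
  { assert (A := re_le_Cmod e). rewrite He in A. apply Rabs_le_between in A. lra. }
  set (k := (1 - r) / ((1 + alpha) * r)).
  assert (Pk : 0 < k) by (apply Rdiv_lt_0_compat; nra).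
  assert (K := ray_compare (- e * / (z * f1 z))%C 
    (fun t => (Re e + 1) / 2 * (k * Rpower ((1 - t * r) / (1 - r)) (1 + alpha)))
    (fun t => - ((Re e + 1) / 2 * Rpower ((1 - t * r) / (1 - r)) alpha))). cbv beta in K.
  assert (X : Re (- e * / (z * f1 z) * f z) = - Re (e * U)).
  { replace (- e * / (z * f1 z) * f z)%C with (- (e * U))%C by (unfold U; ring). reflexivity. }
  rewrite X in K. clear X.
  assert (K1 : forall t : R, 0 <= t <= 1 -> is_derive
     (fun t => (Re e + 1) / 2 * (k * Rpower ((1 - t * r) / (1 - r)) (1 + alpha))) t
     (- ((Re e + 1) / 2 * Rpower ((1 - t * r) / (1 - r)) alpha))).
  { intros t Ht. assert (P0 : 0 < 1 - t * r) by nra.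
    assert (P : 0 < (1 - t * r) / (1 - r)) by (apply Rdiv_lt_0_compat; lra).
    unfold Rpower. auto_derive. exact P.
    change ((1 + - (t * r)) * / (1 - r)) with ((1 - t * r) / (1 - r)).
    replace (exp ((1 + alpha) * ln ((1 - t * r) / (1 - r)))) with
      (((1 - t * r) / (1 - r)) * exp (alpha * ln ((1 - t * r) / (1 - r))))
      by (symmetry; apply (Rpower_1_plus _ alpha P)).
    unfold k. field. repeat split; lra. }
  assert (K' := K K1). clear K K1.
  assert (Y : k * Rpower ((1 - 0 * r) / (1 - r)) (1 + alpha) - k * Rpower ((1 - 1 * r) / (1 - r)) (1 + alpha) <=
       (1 + alpha - r) / ((1 + alpha) * (1 - r))).
  { replace ((1 - 1 * r) / (1 - r)) with 1 by (field; lra). replace ((1 - 0 * r) / (1 - r)) with (/ (1 - r)) by (field; lra).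
    assert (Py : 0 < / (1 - r)) by (apply Rinv_0_lt_compat; lra).
    rewrite !Rpower_1_plus by lra.
    replace (Rpower 1 alpha) with 1 by (unfold Rpower; rewrite ln_1, Rmult_0_r, exp_0; reflexivity).
    assert (B := Rpower_bernoulli (/ (1 - r)) alpha Py Halpha).
    apply Rle_trans with (k * (/ (1 - r) * (1 + alpha * (/ (1 - r) - 1)) - 1)).
    - replace (k * (/ (1 - r) * Rpower (/ (1 - r)) alpha) - k * (1 * 1)) with 
       (k * (/ (1 - r) * Rpower (/ (1 - r)) alpha - 1)) by ring.
      apply Rmult_le_compat_l. lra. apply Rplus_le_compat_r, Rmult_le_compat_l; lra.
    - apply Req_le. unfold k. field. lra. }
  apply (Rmult_le_compat_l ((Re e + 1) / 2)) in Y; [|exact Pe].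
  cut (- ((Re e + 1) / 2 * (k * Rpower ((1 - 0 * r) / (1 - r)) (1 + alpha) - k * Rpower ((1 - 1 * r) / (1 - r)) (1 + alpha))) <= - Re (e * U)).
  { intros Q. unfold U in *. lra. }
  eapply Rle_trans; [|apply K'].
  - apply Req_le. ring.
  - intros t Ht. 
    assert (P1 : 0 < 1 - t * r) by nra.
    assert (X : e <> 0%C) by (apply Cmod_gt_0; rewrite He; lra).
    replace (- e * / (z * f1 z) * (f1 (t * z) * z))%C with (- (e * (f1 (t * z) / f1 z)))%C
      by (field; split; [apply f1_neq_0|apply z_neq_0]).
    change (Re (- (e * (f1 (t * z) / f1 z)))%C) with (- Re (e * (f1 (t * z) / f1 z))%C).
    apply Ropp_le_contravar. apply disk_support; [|exact He|apply Rlt_le, exp_pos].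
    assert (N := Hnz _ (ray_in_disk t Ht)). assert (N1 := f1_neq_0).
    destruct (Hdist z t ltac:(apply Hz) Ht) as [D _]. fold r in D.
    replace (Rpower ((1 - t * r) / (1 - r)) alpha) with (/ Rpower ((1 - r) / (1 - t * r)) alpha).
    + apply disk_of_inverse. apply exp_pos. 
      replace (/ (f1 (t * z) / f1 z))%C with (f1 z / f1 (t * z))%C by (field; split; assumption). exact D.
      unfold Cdiv. apply Cmult_neq_0. exact N. intros E. 
      apply C1_nz. transitivity (f1 z * / f1 z)%C. field; exact N1. rewrite E; ring. 
    + unfold Rpower. rewrite <- exp_Ropp. f_equal. unfold Rdiv. rewrite !ln_mult, !ln_Rinv; 
       try (apply Rinv_0_lt_compat); try lra.
Qed.

Lemma log_derivative_bounds :
  (1 + alpha) * (1 - r) / (1 + alpha - r) <= Re (z * f1 z / f z) /\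
  Cmod (z * f1 z / f z) <= (1 + alpha) * (1 + r) / (1 + alpha + r).
Proof.
  assert (Pr : 0 < r < 1) by apply Hz.
  assert (HL := Re_U_lower). assert (HD := U_disk).
  assert (Nf := f_neq_0). assert (N1 := f1_neq_0). assert (Nz := z_neq_0).
  assert (PL : 0 < (1 + alpha + r) / ((1 + alpha) * (1 + r))) by (apply Rdiv_lt_0_compat; nra).
  assert (PU : 0 < Re U) by lra.
  assert (NU : U <> 0%C) by (intros E; rewrite E in PU; simpl in PU; lra).
  assert (E : (z * f1 z / f z = / U)%C) by (unfold U; field; repeat split; assumption).
  rewrite E. split.
  - replace (Re (/ U)) with (Re U / (Re U ^ 2 + Im U ^ 2)) by reflexivity.
    assert (PD : 0 < (1 + alpha - r) / ((1 + alpha) * (1 - r))) by (apply Rdiv_lt_0_compat; nra).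
    set (d := (1 + alpha - r) / ((1 + alpha) * (1 - r))) in *.
    replace ((1 + alpha) * (1 - r) / (1 + alpha - r)) with (/ d) by (unfold d; field; lra).
    assert (Pm : 0 < Re U ^ 2 + Im U ^ 2) by nra.
    apply (Rmult_le_reg_r (Re U ^ 2 + Im U ^ 2)). exact Pm.
    replace (Re U / (Re U ^ 2 + Im U ^ 2) * (Re U ^ 2 + Im U ^ 2)) with (Re U) by (field; lra).
    apply (Rmult_le_reg_l d). exact PD. rewrite <- Rmult_assoc, Rinv_r, Rmult_1_l by lra. exact HD.
  - rewrite Cmod_inv by exact NU.
    replace ((1 + alpha) * (1 + r) / (1 + alpha + r)) with (/ ((1 + alpha + r) / ((1 + alpha) * (1 + r)))) by (field; lra).
    apply Rinv_le_contravar. exact PL.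
    assert (A := re_le_Cmod U). assert (B := Rle_abs (Re U)). lra.
Qed.

End Point.

End Growth.

(** * Tails of the extremal series *)

Lemma is_derive_rsum (u du : nat -> R -> R) n x :
  (forall k, is_derive (u k) x (du k x)) ->
  is_derive (fun y => rsum (fun k => u k y) n) x (rsum (fun k => du k x) n).
Proof.
  intros H. induction n; simpl. apply @is_derive_const.
  apply (is_derive_plus (fun y => rsum (fun k => u k y) n) (u n)). exact IHn. apply H.
Qed.

Lemma rsum_zero n : rsum (fun _ => 0) n = 0.
Proof. induction n; simpl; lra. Qed.

Lemma rsum_ext u v n : (forall k, u k = v k) -> rsum u n = rsum v n.
Proof. intros H; induction n; simpl; [reflexivity|rewrite IHn, H; reflexivity]. Qed.

Lemma rsum_shift u n : rsum u (S n) = u O + rsum (fun k => u (S k)) n.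
Proof. induction n; simpl in *. ring. rewrite IHn. ring. Qed.

Lemma INR_S_pos n : 0 < INR (S n).
Proof. apply lt_0_INR; lia. Qed.

Lemma log_series_le x n : 0 <= x < 1 -> rsum (fun k => x ^ S k / INR (S k)) n <= - ln (1 - x).
Proof.
  intros Hx.
  assert (H : - ln (1 - 0) - rsum (fun k => 0 ^ S k / INR (S k)) n <= - ln (1 - x) - rsum (fun k => x ^ S k / INR (S k)) n).
  { apply (increasing_of_derive_nonneg (fun y => - ln (1 - y) - rsum (fun k => y ^ S k / INR (S k)) n)
      (fun y => / (1 - y) - rsum (fun k => y ^ k) n)). lra.
    - intros t Ht. apply (is_derive_minus (fun y => - ln (1 - y)) (fun y => rsum (fun k => y ^ S k / INR (S k)) n)).
      + auto_derive. lra. field. lra.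
      + apply (is_derive_rsum (fun k y => y ^ S k / INR (S k)) (fun k y => y ^ k)). intros k.
        generalize (INR_S_pos k); intros P.
        apply is_derive_ext with (fun y => / INR (S k) * y ^ S k). { intros y; apply Rmult_comm. }
        replace (t ^ k) with (/ INR (S k) * (INR (S k) * 1 * t ^ pred (S k))) by (simpl pred; field; lra).
        apply is_derive_scal. apply (is_derive_pow (fun y => y)). apply @is_derive_id.
    - intros t Ht. generalize (rsum_geom t n ltac:(lra)). lra. }
  rewrite (rsum_ext (fun k => 0 ^ S k / INR (S k)) (fun _ => 0)), rsum_zero in H.
  rewrite !Rminus_0_r, ln_1 in H. lra.
  intros k; simpl. unfold Rdiv; ring.
Qed.

Lemma log_primitive_series_le x n : 0 <= x < 1 ->
  rsum (fun k => x ^ S (S k) / (INR (S k) * INR (S (S k)))) n <= x + (1 - x) * ln (1 - x).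
Proof.
  intros Hx.
  assert (H : 0 + (1 - 0) * ln (1 - 0) - rsum (fun k => 0 ^ S (S k) / (INR (S k) * INR (S (S k)))) n <= 
     x + (1 - x) * ln (1 - x) - rsum (fun k => x ^ S (S k) / (INR (S k) * INR (S (S k)))) n).
  { apply (increasing_of_derive_nonneg (fun y => y + (1 - y) * ln (1 - y) - rsum (fun k => y ^ S (S k) / (INR (S k) * INR (S (S k)))) n)
      (fun y => - ln (1 - y) - rsum (fun k => y ^ S k / INR (S k)) n)). lra.
    - intros t Ht. apply (is_derive_minus (fun y => y + (1 - y) * ln (1 - y)) (fun y => rsum (fun k => y ^ S (S k) / (INR (S k) * INR (S (S k)))) n)).
      + auto_derive. lra. change (1 + - t) with (1 - t). field. lra.
      + apply (is_derive_rsum (fun k y => y ^ S (S k) / (INR (S k) * INR (S (S k)))) (fun k y => y ^ S k / INR (S k))). intros k.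
        generalize (INR_S_pos k) (INR_S_pos (S k)); intros P P2.
        apply is_derive_ext with (fun y => / (INR (S k) * INR (S (S k))) * y ^ S (S k)). { intros y; apply Rmult_comm. }
        replace (t ^ S k / INR (S k)) with (/ (INR (S k) * INR (S (S k))) * (INR (S (S k)) * 1 * t ^ pred (S (S k))))
          by (simpl pred; field; lra).
        apply is_derive_scal. apply (is_derive_pow (fun y => y)). apply @is_derive_id.
    - intros t Ht. generalize (log_series_le t n ltac:(lra)). lra. }
  rewrite (rsum_ext (fun k => 0 ^ S (S k) / _) (fun _ => 0)), rsum_zero in H.
  rewrite !Rminus_0_r, ln_1 in H. lra.
  intros k; simpl. unfold Rdiv; ring.
Qed.

Lemma log_tail_le x n : 0 <= x < 1 ->
  rsum (fun j => x ^ (3 + j) / INR (2 + j)) n <= - x * ln (1 - x) - x ^ 2.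
Proof.
  intros Hx. assert (H := log_series_le x (S n) Hx). rewrite rsum_shift in H.
  apply (Rmult_le_compat_l x) in H; [|lra]. 
  replace (rsum (fun j => x ^ (3 + j) / INR (2 + j)) n) with (x * rsum (fun k => x ^ S (S k) / INR (S (S k))) n).
  - replace (x ^ 1 / INR 1) with x in H by (simpl; field).
    set (y := rsum (fun k => x ^ S (S k) / INR (S (S k))) n) in *. lra.
  - rewrite <- rsum_scal. apply rsum_ext. intros k. change (2 + k)%nat with (S (S k)). 
    change (3 + k)%nat with (S (S (S k))). rewrite <- (tech_pow_Rmult x (S (S k))). unfold Rdiv; ring.
Qed.

Lemma log_primitive_tail_le x n : 0 <= x < 1 ->
  rsum (fun j => x ^ (3 + j) / (INR (2 + j) * INR (3 + j))) n <= x + (1 - x) * ln (1 - x) - x ^ 2 / 2.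
Proof.
  intros Hx. assert (H := log_primitive_series_le x (S n) Hx). rewrite rsum_shift in H.
  replace (x ^ 2 / (INR 1 * INR 2)) with (x ^ 2 / 2) in H by (simpl; field).
  change (rsum (fun j => x ^ (3 + j) / (INR (2 + j) * INR (3 + j))) n) with
   (rsum (fun k => x ^ S (S (S k)) / (INR (S (S k)) * INR (S (S (S k))))) n). lra.
Qed.

(** The bound starts at a fixed index [q <= m], so that one majorant serves all
    sections. *)
Lemma psum_tail_le c (z : C) q m n : (q <= m)%nat ->
  Cmod (psum c (m + n) z - psum c m z) <=
  rsum (fun j => Cmod (c (q + j)%nat) * Cmod z ^ (q + j)) (m - q + n).
Proof.
  intros H. set (v := fun j => Cmod (c (q + j)%nat) * Cmod z ^ (q + j)).
  assert (Hv : forall j, 0 <= v j) by (intros; apply Rmult_le_pos; [apply Cmod_ge_0|apply pow_le, Cmod_ge_0]).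
  induction n.
  - rewrite Nat.add_0_r. replace (psum c m z - psum c m z)%C with (RtoC 0) by ring.
    rewrite Cmod_0. clear -Hv. induction (m - q + 0)%nat; simpl. lra. specialize (Hv n). lra.
  - rewrite !Nat.add_succ_r. simpl. 
    replace (psum c (m + n) z + c (m + n)%nat * z ^ (m + n) - psum c m z)%C with
     ((psum c (m + n) z - psum c m z) + c (m + n)%nat * z ^ (m + n))%C by ring.
    eapply Rle_trans; [apply Cmod_triangle|]. apply Rplus_le_compat. exact IHn.
    unfold v. rewrite Cmod_mult, Cmod_pow. replace (q + (m - q + n))%nat with (m + n)%nat by lia. lra.
Qed.

Lemma ps_tail_le c F (z : C) q m s : ps c F -> Cmod z < 1 -> (q <= m)%nat ->
  (forall n, rsum (fun j => Cmod (c (q + j)%nat) * Cmod z ^ (q + j)) n <= s) ->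
  Cmod (F z - psum c m z) <= s.
Proof.
  intros [_ HF] Hz Hq Hs.
  apply (tends_Cmod_le (fun n => psum c (m + n) z + (-(1)) * psum c m z)%C).
  - replace (F z - psum c m z)%C with (F z + (-(1)) * psum c m z)%C by ring.
    apply tends_plus; [|apply tends_const].
    apply (tends_ext_shift (fun n => psum c n z) _ _ m). intros n; f_equal; lia. apply HF, Hz.
  - intros n. replace (psum c (m + n) z + (-(1)) * psum c m z)%C with (psum c (m + n) z - psum c m z)%C by ring.
    eapply Rle_trans; [apply (psum_tail_le c z q m n Hq)|apply Hs].
Qed.

(** * The equation [J = 0] *)

(** The first product collects the lower bounds for [|f|] and for
    [Re (z f' / f) - beta], the rest the majorants of [z sigma'] and of
    [(2 - beta) sigma], where [sigma] is the tail from index [3] on. *)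
Lemma J_factor alpha beta r : 0 < alpha -> r < 1 ->
  J alpha beta r = (1 + alpha) * (1 + alpha - r) *
   ((1 - Rpower (1 - r) (1 + alpha)) / (1 + alpha) * ((1 + alpha) * (1 - r) / (1 + alpha - r) - beta)
    - alpha * ((- r * ln (1 - r) - r ^ 2) + (2 - beta) * (r + (1 - r) * ln (1 - r) - r ^ 2 / 2))).
Proof. intros Ha Hr. unfold J. field. lra. Qed.

(** The zero is the supremum of the [x] such that [F] is positive on [(0, x]]. *)
Lemma least_root_exists (F : R -> R) (b e : R) :
  0 < e -> (forall x, 0 < x < e -> 0 < F x) -> 0 < b < 1 -> F b < 0 ->
  (forall x, 0 < x <= b -> continuous F x) ->
  exists rho, least_positive_root F rho /\ forall x, 0 < x < rho -> 0 < F x.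
Proof.
  intros He Hpos Hb HFb Hc.
  set (E := fun x => 0 < x <= b /\ forall y, 0 < y <= x -> 0 < F y).
  set (x0 := Rmin (e / 2) b).
  assert (E0 : E x0).
  { assert (P : 0 < x0) by (apply Rmin_pos; lra). assert (Q : x0 <= e / 2) by apply Rmin_l.
    split. split. exact P. apply Rmin_r. intros y Hy. apply Hpos; lra. }
  destruct (completeness E) as [rho [U L]].
  { exists b. intros x [Hx _]. lra. }
  { exists x0. exact E0. }
  assert (H0 : 0 < rho) by (assert (x0 <= rho) by (apply U, E0); destruct E0; lra).
  assert (H1 : rho <= b) by (apply L; intros x [Hx _]; lra).
  assert (Hlt : forall x, 0 < x < rho -> 0 < F x).
  { intros x Hx. destruct (Classical_Prop.classic (exists y, E y /\ x < y)) as [[y [Ey Hy]]|N].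
    - apply Ey. lra.
    - exfalso. assert (rho <= x); [|lra]. apply L. intros y Ey. apply Rnot_lt_le. intros K. apply N. exists y. auto. }
  assert (HF : F rho = 0).
  { specialize (Hc rho ltac:(lra)).
    destruct (Rtotal_order (F rho) 0) as [K|[K|K]]; [|exact K|].
    - exfalso. assert (Q : locally rho (fun x => F x < 0)) by (apply (Hc (fun y => y < 0)), (open_lt 0); exact K).
      destruct Q as [d Hd]. assert (P := cond_pos d).
      set (m := Rmin (d / 2) (rho / 2)).
      assert (M0 : 0 < m) by (apply Rmin_pos; lra). assert (M1 : m <= d / 2) by apply Rmin_l.
      assert (M2 : m <= rho / 2) by apply Rmin_r.
      assert (A : F (rho - m) < 0). { apply Hd. change (Rabs (rho - m - rho) < d). rewrite Rabs_left; lra. }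
      assert (B := Hlt (rho - m) ltac:(lra)). lra.
    - exfalso. assert (Q : locally rho (fun x => 0 < F x)) by (apply (Hc (fun y => 0 < y)), (open_gt 0); exact K).
      destruct Q as [d Hd]. assert (P := cond_pos d).
      assert (Hrb : rho < b). { destruct H1 as [H1|H1]; [exact H1|]. rewrite H1 in K. lra. }
      set (m := Rmin (d / 2) (b - rho)).
      assert (M0 : 0 < m) by (apply Rmin_pos; lra). assert (M1 : m <= d / 2) by apply Rmin_l.
      assert (M2 : m <= b - rho) by apply Rmin_r.
      assert (rho + m <= rho); [|lra]. apply U. split. lra.
      intros y Hy. destruct (Rlt_le_dec y rho) as [Ly|Ly]. apply Hlt; lra.
      apply Hd. change (Rabs (y - rho) < d). rewrite Rabs_pos_eq; lra. }
  exists rho. split; [|exact Hlt]. split; [lra|split; [exact HF|]].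
  intros x Hx. generalize (Hlt x Hx). lra.
Qed.

Lemma J_continuous alpha beta x : x < 1 -> continuous (J alpha beta) x.
Proof.
  intros Hx. apply (ex_derive_continuous (J alpha beta)). unfold J, Rpower. auto_derive. repeat split; lra.
Qed.

Lemma J_derive_0 alpha beta : is_derive (J alpha beta) 0 ((1 + alpha) ^ 2 * (1 - beta)).
Proof.
  unfold J, Rpower. auto_derive. lra. 
  rewrite ?Ropp_0, ?Rplus_0_r, ?Rminus_0_r, ln_1, ?Rmult_0_r, exp_0. field.
Qed.

Lemma J_pos_near_0 alpha beta : 0 < alpha -> beta < 1 ->
  exists e, 0 < e /\ forall x, 0 < x < e -> 0 < J alpha beta x.
Proof.
  intros Ha Hb. assert (D := J_derive_0 alpha beta). apply is_derive_Reals in D.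
  set (d := (1 + alpha) ^ 2 * (1 - beta)) in *.
  assert (P : 0 < d) by (unfold d; apply Rmult_lt_0_compat; nra).
  destruct (D d P) as [e He]. exists e. split. apply cond_pos.
  intros x Hx. specialize (He x ltac:(lra) ltac:(rewrite Rabs_pos_eq; lra)).
  assert (J0 : J alpha beta 0 = 0).
  { unfold J, Rpower. rewrite Rminus_0_r, ln_1, Rmult_0_r, exp_0. field. }
  rewrite Rplus_0_l, J0, Rminus_0_r in He. apply Rabs_def2 in He.
  assert (Q : 0 < J alpha beta x / x) by lra.
  apply (Rmult_lt_compat_r x) in Q; [|lra]. unfold Rdiv in Q. rewrite Rmult_assoc, Rinv_l in Q by lra. lra.
Qed.

(** As [rho] tends to [1] the logarithmic term of [J] tends to minus infinity;
    at [1 - exp (- T)] it is at most [alpha ^ 2 (2 - T / 3)], the rest at most [1]. *)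
Lemma J_neg_near_1 alpha beta : 0 < alpha <= 1 -> 0 <= beta < 1 ->
  exists b, 0 < b < 1 /\ J alpha beta b < 0.
Proof.
  intros Ha Hb. set (T := 10 + 10 / alpha ^ 2).
  assert (Pa : 0 < alpha ^ 2) by (apply pow_lt; lra).
  assert (P10 : 0 < 10 / alpha ^ 2) by (apply Rdiv_lt_0_compat; lra).
  assert (PT : 10 < T) by (unfold T; lra).
  assert (Pe : exp (- T) < 1 / 6).
  { rewrite exp_Ropp. assert (1 + T <= exp T) by apply exp_ineq1_le.
    apply Rle_lt_trans with (/ 11). apply Rinv_le_contravar; lra. lra. }
  assert (Pe0 := exp_pos (- T)).
  exists (1 - exp (- T)). set (r := 1 - exp (- T)). split. unfold r; lra.
  assert (Hr : 5 / 6 < r < 1) by (unfold r; lra).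
  assert (El : ln (1 - r) = - T) by (unfold r; replace (1 - (1 - exp (- T))) with (exp (- T)) by ring; apply ln_exp).
  unfold J. rewrite El.
  assert (Pp : 0 < Rpower (1 - r) (1 + alpha)) by apply exp_pos.
  assert (Pp1 : Rpower (1 - r) (1 + alpha) <= 1).
  { unfold Rpower. rewrite El. apply Rle_trans with (exp 0); [|rewrite exp_0; lra].
    destruct (Req_dec ((1 + alpha) * - T) 0) as [E|E]. rewrite E; lra. apply Rlt_le, exp_increasing. nra. }
  set (q := Rpower (1 - r) (1 + alpha)) in *.
  assert (A1 : (1 - q) * ((1 + alpha) * (1 - beta - r) + beta * r) <= 1).
  { assert ((1 + alpha) * (1 - beta - r) + beta * r <= 1) by nra. nra. }
  assert (A2 : ((3 - beta) * r - (2 - beta)) * - T - (2 - beta) * r + (2 - beta / 2) * r ^ 2 <= 2 - T / 3).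
  { assert (1 / 3 <= (3 - beta) * r - (2 - beta)) by nra. 
    assert ((2 - beta / 2) * r ^ 2 <= (2 - beta / 2) * 1) by (apply Rmult_le_compat_l; nra).
    nra. }
  set (B := ((3 - beta) * r - (2 - beta)) * - T - (2 - beta) * r + (2 - beta / 2) * r ^ 2) in *.
  assert (A3 : alpha ^ 2 * (T / 3 - 2) > 3).
  { unfold T. replace (alpha ^ 2 * ((10 + 10 / alpha ^ 2) / 3 - 2)) with (alpha ^ 2 * (4 / 3) + 10 / 3) by (field; lra). lra. }
  assert (A4 : alpha ^ 2 <= alpha * (1 + alpha) * (1 + alpha - r)) by nra.
  assert (A5 : alpha ^ 2 * (T / 3 - 2) <= alpha * (1 + alpha) * (1 + alpha - r) * (T / 3 - 2)).
  { apply Rmult_le_compat_r; lra. }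
  assert (A6 : alpha * (1 + alpha) * (1 + alpha - r) * B <= alpha * (1 + alpha) * (1 + alpha - r) * (2 - T / 3)).
  { apply Rmult_le_compat_l; lra. }
  lra.
Qed.

Lemma J_least_root alpha beta : 0 < alpha <= 1 -> 0 <= beta < 1 ->
  exists rho, least_positive_root (J alpha beta) rho /\ forall x, 0 < x < rho -> 0 < J alpha beta x.
Proof.
  intros Ha Hb. destruct (J_pos_near_0 alpha beta ltac:(lra) ltac:(lra)) as [e [He Hpos]].
  destruct (J_neg_near_1 alpha beta Ha Hb) as [b [Hb1 Hneg]].
  apply (least_root_exists _ b e); try assumption.
  intros x Hx. apply J_continuous. lra.
Qed.

(** * Sections *)

Lemma section_psum (a : nat -> C) n z : a 0%nat = 0%C -> a 1%nat = 1%C -> (2 <= n)%nat ->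
  section a n z = psum a (S n) z.
Proof.
  intros H0 H1 Hn. unfold section. 
  destruct n as [|[|n]]; try lia. clear Hn. induction n.
  - rewrite sum_n_n. simpl. rewrite H0, H1. ring.
  - rewrite sum_n_Sm by lia. change (plus ?x ?y) with (Cplus x y). 
    rewrite Cplus_assoc, IHn. reflexivity.
Qed.

Lemma psum_cdiff a n z : cdiff (psum a (S n)) z (psum (dcoef a) n z).
Proof.
  induction n.
  - apply cdiff_ext_loc with (fun _ => a 0%nat). apply filter_forall. intros w. change C in w. simpl. ring.
    apply cdiff_const.
  - eapply cdiff_eq. apply (cdiff_plus (psum a (S n)) (fun w => a (S n) * w ^ S n)%C). exact IHn.
    apply cdiff_mult. apply cdiff_const. apply cdiff_pow.
    change (psum (dcoef a) (S n) z) with (psum (dcoef a) n z + dcoef a n * z ^ n)%C.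
    change (dcoef a n) with (INR (S n) * a (S n))%C. cbv beta. change (pred (S n)) with n. ring.
Qed.

Lemma psum_horner a n z : psum a (S n) z = (a 0%nat + z * psum (fun k => a (S k)) n z)%C.
Proof.
  induction n. simpl. ring.
  change (psum a (S (S n)) z) with (psum a (S n) z + a (S n) * z ^ S n)%C. rewrite IHn. simpl. ring.
Qed.

(** By Horner's rule, a polynomial in [z0 + h] is rewritten as one in [h]; the
    coefficients beyond the degree vanish, whence all partial sums from [n] on
    agree. *)
Lemma polynomial_recentered n : forall a (z0 : C), exists c : nat -> C, 
  forall N h, (n <= N)%nat -> psum c N h = psum a n (z0 + h)%C.
Proof.
  induction n; intros a z0.
  - exists (fun _ => 0%C). intros N h _. induction N; simpl. reflexivity. rewrite IHN. simpl. ring.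
  - destruct (IHn (fun k => a (S k)) z0) as [c Hc].
    exists (fun k => match k with O => (a 0%nat + z0 * c 0%nat)%C | S m => (c m + z0 * c (S m))%C end).
    intros [|N] h HN. lia. rewrite psum_horner.
    rewrite (psum_horner a). rewrite <- (Hc N h) by lia.
    assert (E : psum c (S N) h = psum c N h) by (rewrite !Hc by lia; reflexivity).
    rewrite psum_horner in E.
    assert (F : psum (fun k => c k + z0 * c (S k))%C N h = (psum c N h + z0 * psum (fun k => c (S k)) N h)%C).
    { clear. induction N; simpl. ring. rewrite IHN. ring. }
    rewrite F. rewrite <- E at 2. set (x := psum c N h) in *. set (y := psum (fun k => c (S k)) N h) in *.
    transitivity (a 0%nat + z0 * (c 0%nat + h * y) + h * x)%C. ring. rewrite E. ring.
Qed.

Lemma psum_analytic a n r F : (forall z, F z = psum a n z) -> analytic_in r F.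
Proof.
  intros HF z0 _. destruct (polynomial_recentered n a z0) as [c Hc].
  exists c, 1. split. lra. intros z _. apply is_series_tends.
  intros e He. exists n. intros m Hm. rewrite (Hc m _ Hm), HF.
  replace (z0 + (z - z0))%C with z by ring. replace (psum a n z - psum a n z)%C with (RtoC 0) by ring.
  rewrite Cmod_0. exact He.
Qed.

(** With [sigma = f - s] and [w = z f' / f] one has
    [z s' / s = w + (w sigma - z sigma') / s].  The hypothesis [M + N <= 2] absorbs
    the loss [|sigma|] in [|s| >= |f| - |sigma|] into the coefficient [2 - beta]. *)
Lemma log_derivative_perturbation (z f f' s s' : C) (beta L M N S A : R) :
  f <> 0%C -> Cmod (f - s) <= S -> Cmod (z * (f' - s')) <= A -> L <= Cmod f ->
  M <= Re (z * f' / f) -> Cmod (z * f' / f) <= N -> M + N <= 2 -> 0 < L ->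
  A + (2 - beta) * S < L * (M - beta) -> beta <= 2 ->
  s <> 0%C /\ beta < Re (z * s' / s).
Proof.
  intros Hf HS HA HL HM HN HMN L0 Hmain Hb2.
  assert (S0 : 0 <= S) by (eapply Rle_trans; [apply Cmod_ge_0|exact HS]).
  assert (A0 : 0 <= A) by (eapply Rle_trans; [apply Cmod_ge_0|exact HA]).
  assert (N0 : 0 <= N) by (eapply Rle_trans; [apply Cmod_ge_0|exact HN]).
  assert (Hb : 0 <= (2 - beta) * S) by (apply Rmult_le_pos; lra).
  assert (P : 0 < M - beta) by (apply (Rmult_lt_reg_l L); lra).
  assert (K : N * S + A < (M - beta) * (L - S)).
  { assert ((M + N) * S <= 2 * S) by (apply Rmult_le_compat_r; lra). lra. }
  assert (NS : 0 <= N * S) by (apply Rmult_le_pos; assumption).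
  assert (PL : 0 < L - S) by (apply (Rmult_lt_reg_l (M - beta)); lra).
  assert (Hs : L - S <= Cmod s).
  { assert (Cmod f <= Cmod s + Cmod (f - s)).
    { replace f with (s + (f - s))%C at 1 by ring. apply Cmod_triangle. } lra. }
  assert (Ns : s <> 0%C) by (apply Cmod_gt_0; lra).
  split. exact Ns.
  set (w := (z * f' / f)%C) in *.
  set (v := ((w * (f - s) - z * (f' - s')) / s)%C).
  assert (E : (z * s' / s = w + v)%C) by (unfold v, w; field; split; assumption).
  assert (Hv : Cmod v * (L - S) <= N * S + A).
  { apply Rle_trans with (Cmod v * Cmod s).
    - apply Rmult_le_compat_l. apply Cmod_ge_0. exact Hs.
    - unfold v. rewrite Cmod_div by exact Ns. unfold Rdiv. rewrite Rmult_assoc, Rinv_l, Rmult_1_r by lra.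
      unfold Cminus at 1. eapply Rle_trans; [apply Cmod_triangle|]. rewrite Cmod_opp, Cmod_mult.
      apply Rplus_le_compat; [|exact HA]. apply Rmult_le_compat; try apply Cmod_ge_0; assumption. }
  assert (Hv2 : Cmod v < M - beta) by (apply (Rmult_lt_reg_r (L - S)); lra).
  rewrite E. replace (Re (w + v)) with (Re w + Re v) by reflexivity.
  assert (B := re_le_Cmod v). apply Rabs_le_between in B. lra.
Qed.

(** The sum is [2 ((1 + alpha)^2 - (1 + alpha) r^2) / ((1 + alpha)^2 - r^2)]. *)
Lemma bounds_sum_le_2 alpha r : 0 < alpha -> 0 < r < 1 ->
  (1 + alpha) * (1 - r) / (1 + alpha - r) + (1 + alpha) * (1 + r) / (1 + alpha + r) <= 2.
Proof.
  intros Ha Hr. 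
  assert (P1 : 0 < 1 + alpha - r) by lra. assert (P2 : 0 < 1 + alpha + r) by lra.
  apply (Rmult_le_reg_r ((1 + alpha - r) * (1 + alpha + r))). apply Rmult_lt_0_compat; assumption.
  replace (_ * ((1 + alpha - r) * (1 + alpha + r))) with
   ((1 + alpha) * ((1 - r) * (1 + alpha + r) + (1 + r) * (1 + alpha - r))) by (field; lra).
  assert (0 <= alpha * r ^ 2) by (apply Rmult_le_pos; [lra|apply pow2_ge_0]). nra.
Qed.

Lemma class_G_data alpha f a : 0 < alpha <= 1 -> class_G alpha f -> has_expansion f a ->
  exists f1 f2 p p' : C -> C,
    ps a f /\ ps (dcoef a) f1 /\ ps (dcoef (dcoef a)) f2 /\ hol 1 f f1 /\ hol 1 f1 f2 /\ hol 1 p p' /\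
    f 0%C = 0%C /\ f1 0%C = 1%C /\ (forall z, Cmod z < 1 -> f1 z <> 0%C) /\
    (forall z, Cmod z < 1 -> Re (z * p z) < alpha / 2) /\
    (forall z, Cmod z < 1 -> f2 z = (f1 z * p z)%C).
Proof.
  intros Ha [_ [_ [Hnz Hre]]] [a0 [a1 Hexp]].
  assert (Pf := ps_of_is_pseries a f Hexp).
  destruct (ps_derivative _ _ Pf) as [f1 [P1 H1]].
  destruct (ps_derivative _ _ P1) as [f2 [P2 H2]].
  destruct (ps_derivative _ _ P2) as [f3 [P3 H3]].
  assert (D1 : forall z, Cmod z < 1 -> C_derive f z = f1 z).
  { intros z Hz. apply cdiff_C_derive, H1, Hz. }
  assert (D2 : forall z, Cmod z < 1 -> C_derive (C_derive f) z = f2 z).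
  { intros z Hz. apply cdiff_C_derive. apply cdiff_ext_loc with f1; [|apply H2, Hz].
    generalize (locally_disk 1 z Hz). apply filter_imp. intros w Hw. symmetry; apply D1, Hw. }
  assert (Nz : forall z, Cmod z < 1 -> f1 z <> 0%C).
  { intros z Hz. rewrite <- D1 by exact Hz. apply Hnz, Hz. }
  exists f1, f2, (fun z => f2 z * / f1 z)%C. eexists.
  split; [exact Pf|]. split; [exact P1|]. split; [exact P2|]. split; [exact H1|]. split; [exact H2|].
  split; [exact (hol_mult _ _ _ _ _ H3 (hol_inv _ _ _ H2 Nz))|].
  split; [rewrite (ps_at_0 _ _ Pf); exact a0|].
  split; [rewrite (ps_at_0 _ _ P1); unfold dcoef; rewrite a1; simpl; ring|].
  split; [exact Nz|]. split.
  - intros z Hz. specialize (Hre z Hz). rewrite D1, D2 in Hre by exact Hz.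
    replace (1 + z * f2 z / f1 z)%C with (1 + z * (f2 z * / f1 z))%C in Hre by (unfold Cdiv; ring).
    assert (E : Re (1 + z * (f2 z * / f1 z)) = 1 + Re (z * (f2 z * / f1 z))) by (unfold Re; simpl; ring).
    rewrite E in Hre. lra.
  - intros z Hz. field. apply Nz, Hz.
Qed.

(** [|q| < |q - alpha|] says that [q] is to the left of the line
    [Re = alpha / 2]. *)
Lemma clunie_condition alpha (f1 f2 p : C -> C) z : 0 < alpha ->
  f1 z <> 0%C -> Re (z * p z) < alpha / 2 -> f2 z = (f1 z * p z)%C ->
  Cmod (z * f2 z) < Cmod (z * f2 z + (- alpha) * f1 z)%C.
Proof.
  intros Ha N H E. set (q := (z * p z)%C) in *.
  replace (z * f2 z)%C with (f1 z * q)%C by (rewrite E; unfold q; ring).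
  replace (f1 z * q + - alpha * f1 z)%C with (f1 z * (q - alpha))%C by ring.
  rewrite !Cmod_mult. apply Rmult_lt_compat_l. apply Cmod_gt_0, N.
  apply Rsqr_incrst_0; try apply Cmod_ge_0. rewrite !Rsqr_pow2, !Cmod2_alt.
  unfold Re, Im in *; simpl in *. nra.
Qed.

Theorem theorem3p2 (alpha beta : R)
    (Halpha : 0 < alpha <= 1) (Hbeta : 0 <= beta < 1) :
  exists rho : R,
    least_positive_root (J alpha beta) rho /\
    forall (f : C -> C) (a : nat -> C),
      class_G alpha f -> has_expansion f a ->
      forall n : nat, (2 <= n)%nat -> starlike beta rho (section a n).
Proof.
  destruct (J_least_root alpha beta Halpha Hbeta) as [rho [Hroot Hpos]].
  exists rho. split; [exact Hroot|].
  intros f a HG Hexp n Hn.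
  assert (Hrho : 0 < rho < 1) by apply Hroot.
  assert (a0 : a 0%nat = 0%C) by apply Hexp. assert (a1 : a 1%nat = 1%C) by apply Hexp.
  destruct (class_G_data alpha f a Halpha HG Hexp) as
    [f1 [f2 [p [p' [Pf [P1 [P2 [Hf [Hf1 [Hp [f0 [f10 [Nz [Hre E2]]]]]]]]]]]]]].
  assert (Es : forall z, section a n z = psum a (S n) z) by (intros; apply section_psum; assumption).
  assert (Ds : forall z, C_derive (section a n) z = psum (dcoef a) n z).
  { intros z. apply cdiff_C_derive. apply cdiff_ext_loc with (psum a (S n)); [|apply psum_cdiff].
    apply filter_forall. intros w. symmetry. apply Es. }
  assert (Hcoef : forall k, INR k * INR (S k) * Cmod (a (S k)) <= alpha).
  { intros k. apply (coefficient_bound alpha a f1 f2 k Halpha a1 P1 P2).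
    intros z Hz. apply (clunie_condition alpha f1 f2 p); auto. lra. }
  assert (Hdist := distortion alpha p p' f1 f2 Halpha Hp Hre Hf1 f10 E2).
  assert (Hstar : forall z, 0 < Cmod z < rho ->
     section a n z <> 0%C /\ beta < Re (z * C_derive (section a n) z / section a n z)).
  { intros z Hz. rewrite Ds, Es. set (r := Cmod z) in *.
    assert (Hr : 0 < r < 1) by lra.
    assert (HJ := Hpos r Hz). rewrite J_factor in HJ by lra.
    set (L := (1 - Rpower (1 - r) (1 + alpha)) / (1 + alpha)) in *.
    set (M := (1 + alpha) * (1 - r) / (1 + alpha - r)) in *.
    set (A := - r * ln (1 - r) - r ^ 2) in *.
    set (B := r + (1 - r) * ln (1 - r) - r ^ 2 / 2) in *.
    assert (HJ' : 0 < L * (M - beta) - alpha * (A + (2 - beta) * B)).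
    { apply (Rmult_lt_reg_l ((1 + alpha) * (1 + alpha - r))). nra. rewrite Rmult_0_r. exact HJ. }
    assert (HL := growth alpha f f1 Halpha Hf f0 f10 Hdist z Hr). 
    assert (HP := growth_pos alpha Halpha z Hr).
    destruct (log_derivative_bounds alpha f f1 Halpha Hf f0 f10 Nz Hdist z Hr) as [HM HN].
    apply (log_derivative_perturbation z (f z) (f1 z) _ _ beta L M 
      ((1 + alpha) * (1 + r) / (1 + alpha + r)) (alpha * B) (alpha * A)).
    - apply (f_neq_0 alpha f f1 Halpha Hf f0 f10 Hdist z Hr).
    - apply (ps_tail_le a f z 3 (S n) _ Pf). apply Hr. lia.
      intros m. eapply Rle_trans; [|apply Rmult_le_compat_l; [|apply (log_primitive_tail_le r m)]]; [|lra|lra].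
      rewrite <- rsum_scal. apply rsum_le. intros j.
      assert (H := Hcoef (2 + j)%nat). change (S (2 + j)) with (3 + j)%nat in H.
      assert (Q1 : 0 < INR (2 + j)) by (apply lt_0_INR; lia). assert (Q2 : 0 < INR (3 + j)) by (apply lt_0_INR; lia).
      fold r. replace (alpha * (r ^ (3 + j) / (INR (2 + j) * INR (3 + j)))) with
        (alpha / (INR (2 + j) * INR (3 + j)) * r ^ (3 + j)) by (field; lra).
      apply Rmult_le_compat_r. apply pow_le; lra.
      apply (Rmult_le_reg_l (INR (2 + j) * INR (3 + j))). apply Rmult_lt_0_compat; assumption.
      replace (INR (2 + j) * INR (3 + j) * (alpha / (INR (2 + j) * INR (3 + j)))) with alpha by (field; lra). exact H.
    - rewrite Cmod_mult. fold r. 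
      apply Rle_trans with (r * (alpha * A / r)); [|apply Req_le; field; lra].
      apply Rmult_le_compat_l. lra.
      apply (ps_tail_le (dcoef a) f1 z 2 n _ P1). apply Hr. lia.
      intros m. apply (Rmult_le_reg_l r). lra. 
      replace (r * (alpha * A / r)) with (alpha * A) by (field; lra).
      eapply Rle_trans; [|apply Rmult_le_compat_l; [|apply (log_tail_le r m)]]; [|lra|lra].
      rewrite <- !rsum_scal. apply rsum_le. intros j.
      assert (H := Hcoef (2 + j)%nat). change (S (2 + j)) with (3 + j)%nat in H.
      assert (Q1 : 0 < INR (2 + j)) by (apply lt_0_INR; lia).
      unfold dcoef. rewrite Cmod_mult, Cmod_R, Rabs_pos_eq by apply pos_INR.
      change (S (2 + j)) with (3 + j)%nat. fold r.
      replace (alpha * (r ^ (3 + j) / INR (2 + j))) with (alpha / INR (2 + j) * r ^ (3 + j)) by (field; lra).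
      replace (r * (INR (3 + j) * Cmod (a (3 + j)%nat) * r ^ (2 + j))) with
        (INR (3 + j) * Cmod (a (3 + j)%nat) * r ^ (3 + j)) by (simpl; ring).
      apply Rmult_le_compat_r. apply pow_le; lra.
      apply (Rmult_le_reg_l (INR (2 + j))). exact Q1.
      replace (INR (2 + j) * (alpha / INR (2 + j))) with alpha by (field; lra). lra.
    - exact HL.
    - exact HM.
    - exact HN.
    - apply bounds_sum_le_2; lra.
    - fold r in HP. apply (Rmult_lt_compat_l r) in HP; [|lra].
      replace (r * ((1 - Rpower (1 - r) (1 + alpha)) / ((1 + alpha) * r))) with L in HP by (unfold L; field; lra). lra.
    - lra.
    - lra. }
  split; [|split; [|split]].
  - apply (psum_analytic a (S n)). exact Es.
  - split.
    + rewrite Es, psum_horner, a0. ring.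
    + rewrite Ds. destruct n as [|n]; [lia|]. rewrite psum_horner. unfold dcoef at 1. rewrite a1. simpl. ring.
  - intros z Hz. apply Hstar, Hz.
  - intros z Hz. unfold starlike_quotient. destruct (Ceq_dec z 0) as [E|E].
    + simpl. lra.
    + apply Hstar. split; [apply Cmod_gt_0, E|exact Hz].
Qed.
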